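(* Let $$A(u)=\sum_{\sigma\in\mathfrak{S}_N}(-1)^{\sigma}\,T_{1,\sigma(1)}(u)\,T_{2,\sigma(2)}(u+1)\cdots T_{N,\sigma(N)}(u+N-1),$$ where $(-1)^\sigma$ is the sign of $\sigma$ and all series are re-expanded as formal power series in $u^{-1}$. Then all the coefficients of the formal power series in $u^{-1}$ $$A(u)\,A(1-N-u)$$ belong to the centre of $\operatorname{X}(\mathfrak{p}_N)$.
   Context: Fix an integer $N\ge 1$; the ground field is $\mathbb{C}$. Indices $i,j$ run over $\pm1,\ldots,\pm N$; $\bar i=0$ if $i>0$ and $\bar i=1$ if $i<0$. $\mathbb{C}^{N|N}$ is $\mathbb{Z}_2$-graded with basis $e_i$, $\deg e_i=\bar i$; the matrix units $E_{ij}$ ($E_{ij}e_k=\delta_{jk}e_i$) have degree $\bar i+\bar j$. Tensor products of $\mathbb{Z}_2$-graded algebras have multiplication $(X\otimes Y)(X'\otimes Y')=XX'\otimes YY'\,(-1)^{\deg X'\deg Y}$. Put $P=\sum_{i,j}E_{ij}\otimes E_{ji}(-1)^{\bar j}$, $Q=\sum_{i,j}E_{ij}\otimes E_{-i,-j}(-1)^{\bar i\bar j+\bar i+\bar j}$ and $R(u,v)=1-\frac{P}{u-v}+\frac{Q}{u+v}$. The extended Yangian $\operatorname{X}(\mathfrak{p}_N)$ is the unital associative $\mathbb{Z}_2$-graded algebra with generators $T^{(r)}_{ij}$ ($r\ge1$) of degree $\bar i+\bar j$. Put $T_{ij}(u)=\delta_{ij}+T^{(1)}_{ij}u^{-1}+T^{(2)}_{ij}u^{-2}+\ldots$,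 $T(u)=\sum_{i,j}E_{ij}\otimes T_{ij}(u)$, and let $T_1(u),T_2(u)\in(\operatorname{End}\mathbb{C}^{N|N})^{\otimes2}\otimes\operatorname{X}(\mathfrak{p}_N)[[u^{-1}]]$ be obtained from $T(u)$ by placing $E_{ij}$ in the first, respectively second, tensor factor. The defining relations are $(R(u,v)\otimes1)\,T_1(u)\,T_2(v)=T_2(v)\,T_1(u)\,(R(u,v)\otimes1)$ (an equality of formal Laurent series in $u^{-1},v^{-1}$ after multiplication by $u^2-v^2$). An element of a $\mathbb{Z}_2$-graded associative algebra is central if its supercommutator with every element of the algebra is zero. *)

(* Defs.v *)
(* Everything is defined over a field K; for K = C, take K = R[i] with
   R : realType. *)
From HB Require Import structures.
From mathcomp Require Import all_boot all_order all_fingroup all_algebra.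
From mathcomp Require Import finmap boolp reals complex.
From mathcomp Require Import monalg.

Set Implicit Arguments.
Unset Strict Implicit.
Unset Printing Implicit Defensive.

Import GRing.Theory.
Local Open Scope ring_scope.
Local Open Scope quotient_scope.

(* Z_2-graded associative unital algebras; [part d] is the projection onto the
   component of degree [d], where [false] is even and [true] is odd. *)
HB.mixin Record Algebra_isSuper (K : fieldType) A of GRing.Algebra K A := {
  part : bool -> A -> A;
  part_is_linear : forall d, linear (part d);
  part_sum : forall x, \sum_(d : bool) part d x = x;
  part_part : forall d e x, part d (part e x) = if d == e then part e x else 0;
  part_mul : forall d x y,
    part d (x * y) = \sum_(e : bool) part (d (+) e) x * part e y
}.

#[short(type="superAlgType")]
HB.structure Definition SuperAlgebra (K : fieldType) :=
  {A of GRing.Algebra K A & Algebra_isSuper K A}.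

Section SuperAlgebraTheory.
Variables (K : fieldType) (A : superAlgType K).
Implicit Types x y : A.

HB.instance Definition _ d :=
  GRing.isLinear.Build K A A *:%R (part d : A -> A) (part_is_linear d).

(* The supercommutator, extended bilinearly from homogeneous elements. *)
Definition supercomm x y : A :=
  \sum_(d : bool) \sum_(e : bool)
    (part d x * part e y - (-1) ^+ (d && e) *: (part e y * part d x)).

Definition supercentral x : Prop := forall y, supercomm x y = 0.

Definition hom (d : bool) x : Prop := part d x = x.

Lemma part_hom d e x : hom e x -> part d x = if d == e then x else 0.
Proof. by move=> <-; rewrite part_part. Qed.

Lemma hom_part d x : hom d (part d x).
Proof. by rewrite /hom part_part eqxx. Qed.

Lemma hom0 d : hom d 0. Proof. exact: linear0. Qed.

Lemma homD d x y : hom d x -> hom d y -> hom d (x + y).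
Proof. by move=> hx hy; rewrite /hom linearD /= hx hy. Qed.

Lemma homN d x : hom d x -> hom d (- x).
Proof. by move=> hx; rewrite /hom linearN /= hx. Qed.

Lemma homB d x y : hom d x -> hom d y -> hom d (x - y).
Proof. by move=> hx hy; apply: homD => //; apply: homN. Qed.

Lemma homZ d c x : hom d x -> hom d (c *: x).
Proof. by move=> hx; rewrite /hom linearZ /= hx. Qed.

Lemma hom_sum d (I : finType) (P : pred I) (F : I -> A) :
  (forall i, P i -> hom d (F i)) -> hom d (\sum_(i | P i) F i).
Proof. by move=> h; apply: big_ind => //; [exact: hom0 | exact: homD]. Qed.

Lemma homM d e x y : hom d x -> hom e y -> hom (d (+) e) (x * y).
Proof.
move=> hx hy; rewrite /hom part_mul big_bool /=.
rewrite !(part_hom _ hx) !(part_hom _ hy).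
by case: d e {hx hy} => [] [] /=; rewrite ?mul0r ?mulr0 ?addr0 ?add0r.
Qed.

Lemma hom1 : hom false 1.
Proof.
have p1 x : part false x = part false x * part false 1 + part true x * part true 1.
  by rewrite -[in LHS](mulr1 x) part_mul big_bool addrC.
have pt x : part true x = part false x * part true 1 + part true x * part false 1.
  by rewrite -[in LHS](mulr1 x) part_mul big_bool.
suff t0 : part true 1 = 0 :> A.
  by rewrite /hom -[RHS]part_sum big_bool /= t0 add0r.
have h (x : A) d : hom d x -> x * part true 1 = 0.
  move=> hx; have := congr1 (part (~~ d)) (mulr1 x).
  rewrite part_mul big_bool !(part_hom _ hx).
  by case: d {hx} => /=; rewrite ?mul0r ?addr0 ?add0r.
rewrite -[LHS]mul1r -[X in X * _]part_sum big_bool mulrDl.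
by rewrite !(h _ _ (hom_part _ _)) addr0.
Qed.

Lemma hom_nat n : hom false n%:R.
Proof.
elim: n => [|n IH]; first exact: hom0.
by rewrite -addn1 natrD; apply: homD hom1.
Qed.

Lemma hom_sign n : hom false ((-1) ^+ n).
Proof.
elim: n => [|n IH]; first exact: hom1.
by rewrite exprS -[false]addbF; apply: homM IH; apply: homN hom1.
Qed.

End SuperAlgebraTheory.

(* The index set {1, ..., N, -1, ..., -N}: [(false, k)] stands for k + 1 and
   [(true, k)] for - (k + 1), so that the first component is the parity of
   the index. *)
Notation sidx N := (bool * 'I_N)%type.

Definition bar N (i : sidx N) : bool := i.1.
Definition sneg N (i : sidx N) : sidx N := (~~ i.1, i.2).
Definition spos N (k : 'I_N) : sidx N := (false, k).

Section DefiningRelations.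
Variables (K : fieldType) (A : superAlgType K) (N : nat).

(* An element of End C^{N|N} (x) End C^{N|N} (x) A is given by its
   coordinates: [X i j k l] is the third factor at E_ij (x) E_kl. *)
Definition tens2 : Type := sidx N -> sidx N -> sidx N -> sidx N -> A.
Implicit Types X Y : tens2.

(* For z of degree d,
     (E_ia (x) E_kb (x) z) (E_aj (x) E_bl (x) z')
   carries the sign of moving E_aj past E_kb (x) z and E_bl past z. *)
Definition tens2_mul X Y : tens2 := fun i j k l =>
  \sum_(a : sidx N) \sum_(b : sidx N) \sum_(d : bool)
    (-1) ^+ (((bar a (+) bar j) && (bar k (+) bar b (+) d))
             (+) ((bar b (+) bar l) && d))
    *: (part d (X i a k b) * Y a j b l).

Definition tens2_1 : tens2 := fun i j k l => ((i == j) && (k == l))%:R.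

Definition tens2_P : tens2 := fun i j k l =>
  ((k == j) && (l == i))%:R * (-1) ^+ bar j.

Definition tens2_Q : tens2 := fun i j k l =>
  ((k == sneg i) && (l == sneg j))%:R
  * (-1) ^+ ((bar i && bar j) (+) bar i (+) bar j).

(* The coefficient of u^a v^b in
   (u^2 - v^2) R(u, v) = u^2 - v^2 - (u + v) P + (u - v) Q. *)
Definition Rcoef (a b : nat) : tens2 := fun i j k l =>
  match a, b with
  | 2, 0 => tens2_1 i j k l
  | 0, 2 => - tens2_1 i j k l
  | 1, 0 => - tens2_P i j k l + tens2_Q i j k l
  | 0, 1 => - tens2_P i j k l - tens2_Q i j k l
  | _, _ => 0
  end.

(* [t i j r] is the coefficient of u^-r in T_ij(u), for r in Z. *)
Variable t : sidx N -> sidx N -> int -> A.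

(* The coefficients of u^-r in T_1(u) and of u^-s in T_2(u). *)
Definition T1coef (r : int) : tens2 := fun i j k l => (k == l)%:R * t i j r.
Definition T2coef (s : int) : tens2 := fun i j k l => (i == j)%:R * t k l s.

(* The coordinate at E_ij (x) E_kl of the coefficient of u^-r v^-s in
   (u^2 - v^2) (R(u,v) T_1(u) T_2(v) - T_2(v) T_1(u) R(u,v)). *)
Definition rtt_rel (r s : int) (i j k l : sidx N) : A :=
  \sum_(a < 3) \sum_(b < 3)
    (tens2_mul (tens2_mul (Rcoef a b) (T1coef (r + a%:Z))) (T2coef (s + b%:Z))
       i j k l
     - tens2_mul (tens2_mul (T2coef (s + b%:Z)) (T1coef (r + a%:Z))) (Rcoef a b)
       i j k l).

Definition idx_deg (i j k l : sidx N) : bool :=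
  bar i (+) bar j (+) bar k (+) bar l.

Definition even2 X := forall i j k l, hom (idx_deg i j k l) (X i j k l).

Lemma even2_mul X Y : even2 X -> even2 Y -> even2 (tens2_mul X Y).
Proof.
move=> hX hY i j k l; apply: hom_sum => a _; apply: hom_sum => b _.
apply: hom_sum => d _; apply: homZ; rewrite (part_hom _ (hX _ _ _ _)).
case: ifP => [/eqP _|_]; last by rewrite mul0r; exact: hom0.
suff -> : idx_deg i j k l = idx_deg i a k b (+) idx_deg a j b l.
  exact: homM.
by rewrite /idx_deg; do !case: (bar _).
Qed.

Lemma even2_1 : even2 tens2_1.
Proof.
move=> i j k l; rewrite /tens2_1.
case: andP => [[/eqP -> /eqP ->]|_]; last exact: hom0.
by rewrite /idx_deg addbb addFb addbb; exact: hom1.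
Qed.

Lemma even2_P : even2 tens2_P.
Proof.
move=> i j k l; rewrite /tens2_P.
case: andP => [[/eqP -> /eqP ->]|_]; last by rewrite mul0r; exact: hom0.
rewrite mul1r (_ : idx_deg _ _ _ _ = false); first exact: hom_sign.
by rewrite /idx_deg; do !case: (bar _).
Qed.

Lemma even2_Q : even2 tens2_Q.
Proof.
move=> i j k l; rewrite /tens2_Q.
case: andP => [[/eqP -> /eqP ->]|_]; last by rewrite mul0r; exact: hom0.
rewrite mul1r (_ : idx_deg _ _ _ _ = false); first exact: hom_sign.
by rewrite /idx_deg /bar /sneg /=; case: i.1; case: j.1.
Qed.

Lemma even2_R a b : even2 (Rcoef a b).
Proof.
move=> i j k l; rewrite /Rcoef.
case: a b => [|[|[|a]]] [|[|[|b]]]; try exact: hom0.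
- by apply: homB; [apply: homN; exact: even2_P | exact: even2_Q].
- by apply: homN; exact: even2_1.
- by apply: homD; [apply: homN; exact: even2_P | exact: even2_Q].
- exact: even2_1.
Qed.

Lemma hom_rtt_rel : (forall i j r, hom (bar i (+) bar j) (t i j r)) ->
  forall r s i j k l, hom (idx_deg i j k l) (rtt_rel r s i j k l).
Proof.
move=> ht.
have hT1 r : even2 (T1coef r).
  move=> i j k l; rewrite /T1coef; case: (k =P l) => [->|_].
    by rewrite mul1r /idx_deg -addbA addbb addbF; exact: ht.
  by rewrite mul0r; exact: hom0.
have hT2 r : even2 (T2coef r).
  move=> i j k l; rewrite /T2coef; case: (i =P j) => [->|_].
    by rewrite mul1r /idx_deg addbb; exact: ht.
  by rewrite mul0r; exact: hom0.
move=> r s i j k l; apply: hom_sum => a _; apply: hom_sum => b _; apply: homB.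
  exact: (even2_mul (even2_mul (even2_R _ _) (hT1 _)) (hT2 _)).
exact: (even2_mul (even2_mul (hT2 _) (hT1 _)) (even2_R _ _)).
Qed.

Section Augmentation.
Variable eps : {lrmorphism A -> K^o}.
Hypothesis eps_odd : forall x, eps (part true x) = 0.
Hypothesis eps_t : forall i j r, eps (t i j r) = ((r == 0) && (i == j))%:R.

Lemma eps_even x : eps (part false x) = eps x.
Proof. by rewrite -[in RHS](part_sum x) big_bool raddfD /= eps_odd add0r. Qed.

Lemma eps_mul X Y i j k l :
  eps (tens2_mul X Y i j k l) = \sum_(a : sidx N) \sum_(b : sidx N)
    (-1) ^+ ((bar a (+) bar j) && (bar k (+) bar b))
    * (eps (X i a k b) * eps (Y a j b l)).
Proof.
rewrite raddf_sum; apply: eq_bigr => a _; rewrite raddf_sum.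
apply: eq_bigr => b _; rewrite raddf_sum big_bool /= !linearZ /= !rmorphM /=.
rewrite eps_odd eps_even mul0r scaler0 add0r.
by rewrite addbF andbF addbF.
Qed.

Lemma eps_mulr (c : K^o) X Y :
    (forall i j k l, eps (Y i j k l) = c * ((i == j) && (k == l))%:R) ->
  forall i j k l, eps (tens2_mul X Y i j k l) = c * eps (X i j k l).
Proof.
move=> hY i j k l; rewrite eps_mul (bigD1 j) //= (bigD1 l) //= !big1.
- by rewrite !addr0 hY !eqxx addbb mul1r mulr1 mulrC.
- by move=> a aj; rewrite big1 // => b _; rewrite hY (negPf aj) !mulr0.
- by move=> b bl; rewrite hY (negPf bl) andbF !mulr0.
Qed.

Lemma eps_mull (c : K^o) X Y :
    (forall i j k l, eps (X i j k l) = c * ((i == j) && (k == l))%:R) ->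
  forall i j k l, eps (tens2_mul X Y i j k l) = c * eps (Y i j k l).
Proof.
move=> hX i j k l; rewrite eps_mul (bigD1 i) //= (bigD1 k) //= !big1.
- by rewrite !addr0 hX !eqxx addbb andbF mul1r mulr1.
- move=> a; rewrite eq_sym => ai; rewrite big1 // => b _.
  by rewrite hX (negPf ai) mulr0 mul0r mulr0.
- by move=> b; rewrite eq_sym => bk; rewrite hX (negPf bk) andbF mulr0 mul0r mulr0.
Qed.

Lemma eps_T1 r i j k l :
  eps (T1coef r i j k l) = (r == 0)%:R * ((i == j) && (k == l))%:R.
Proof.
rewrite rmorphM /= rmorph_nat eps_t -!natrM !mulnb.
by case: (k == l); rewrite /= ?andbT ?andbF.
Qed.

Lemma eps_T2 r i j k l :
  eps (T2coef r i j k l) = (r == 0)%:R * ((i == j) && (k == l))%:R.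
Proof. by rewrite rmorphM /= rmorph_nat eps_t -!natrM !mulnb andbCA. Qed.

Lemma eps_rtt_rel r s i j k l : eps (rtt_rel r s i j k l) = 0.
Proof.
rewrite raddf_sum big1 // => a _; rewrite raddf_sum big1 // => b _.
rewrite raddfB /= (eps_mulr _ (eps_T2 _)) (eps_mulr _ (eps_T1 _)).
rewrite (@eps_mull ((s + b%:Z == 0)%:R * (r + a%:Z == 0)%:R)) ?mulrA ?subrr //.
by move=> i' j' k' l'; rewrite (eps_mull _ (eps_T2 _)) eps_T1 mulrA.
Qed.

End Augmentation.

End DefiningRelations.

(* Proper two-sided homogeneous ideals. *)
HB.mixin Record isSuperIdeal (K : fieldType) (A : superAlgType K) (S : {pred A}) := {
  sideal1 : 1 \notin S;
  sidealMl : forall x y, y \in S -> x * y \in S;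
  sidealMr : forall x y, x \in S -> x * y \in S;
  sideal_part : forall d x, x \in S -> part d x \in S
}.

#[short(type="superIdeal")]
HB.structure Definition SuperIdeal (K : fieldType) (A : superAlgType K) :=
  {S of GRing.ZmodClosed A S & isSuperIdeal K A S}.

Section SuperQuotient.
Variables (K : fieldType) (A : superAlgType K) (I : superIdeal A).

Definition squot : Type := Quotient.quot I.
HB.instance Definition _ := GRing.Zmodule.on squot.
Local Notation X := squot.

Definition toX : A -> X := locked (fun x => \pi_(Quotient.quot I) x).
Definition ofX : X -> A := locked (fun x : X => generic_quotient.repr (x : Quotient.quot I)).

Lemma ofXK : cancel ofX toX.
Proof. by move=> x; rewrite /toX /ofX -!lock; exact: reprK. Qed.

Lemma toXP f g : toX f = toX g <-> f - g \in I.
Proof.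
rewrite /toX -lock Quotient.idealrBE; split; first by move/eqP.
by move/eqP.
Qed.

Lemma toX_ofX f : ofX (toX f) - f \in I.
Proof. by apply/toXP; exact: ofXK. Qed.

Lemma toX_ind (P : X -> Prop) : (forall f, P (toX f)) -> forall x, P x.
Proof. by move=> h x; rewrite -[x]ofXK. Qed.

Lemma toX_is_zmod_morphism : zmod_morphism toX.
Proof.
move=> f g; rewrite /toX -lock.
exact: (raddfB (\pi_(Quotient.quot I) : {additive A -> Quotient.quot I})).
Qed.

HB.instance Definition _ :=
  GRing.isZmodMorphism.Build A X toX toX_is_zmod_morphism.

Definition mulX : X -> X -> X := locked (fun x y => toX (ofX x * ofX y)).
Definition scaleX : K -> X -> X := locked (fun c x => toX (c *: ofX x)).
Definition partX : bool -> X -> X := locked (fun d x => toX (part d (ofX x))).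

Lemma mulXE f g : mulX (toX f) (toX g) = toX (f * g).
Proof.
rewrite /mulX -lock; apply/toXP.
rewrite -(subrKA (ofX (toX f) * g)) -mulrBr -mulrBl.
by apply: rpredD; [apply: sidealMl | apply: sidealMr]; exact: toX_ofX.
Qed.

Lemma scaleXE c f : scaleX c (toX f) = toX (c *: f).
Proof.
rewrite /scaleX -lock; apply/toXP.
by rewrite -scalerBr -mulr_algl; apply/sidealMl/toX_ofX.
Qed.

Lemma partXE d f : partX d (toX f) = toX (part d f).
Proof.
rewrite /partX -lock; apply/toXP.
by rewrite -linearB; apply/sideal_part/toX_ofX.
Qed.

Lemma mulXA : associative mulX.
Proof.
elim/toX_ind=> f; elim/toX_ind=> g; elim/toX_ind=> h.
by rewrite !mulXE mulrA.
Qed.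

Lemma mul1X : left_id (toX 1) mulX.
Proof. by elim/toX_ind=> f; rewrite mulXE mul1r. Qed.

Lemma mulX1 : right_id (toX 1) mulX.
Proof. by elim/toX_ind=> f; rewrite mulXE mulr1. Qed.

Lemma mulXDl : left_distributive mulX +%R.
Proof.
elim/toX_ind=> f; elim/toX_ind=> g; elim/toX_ind=> h.
by rewrite !mulXE -!raddfD /= mulXE mulrDl.
Qed.

Lemma mulXDr : right_distributive mulX +%R.
Proof.
elim/toX_ind=> f; elim/toX_ind=> g; elim/toX_ind=> h.
by rewrite !mulXE -!raddfD /= mulXE mulrDr.
Qed.

Lemma oneX_neq0 : toX 1 != 0.
Proof.
apply/eqP; rewrite -[RHS](raddf0 toX) => /toXP.
by rewrite subr0; apply/negP/sideal1.
Qed.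

HB.instance Definition _ := GRing.Zmodule_isNzRing.Build X
  mulXA mul1X mulX1 mulXDl mulXDr oneX_neq0.

Lemma scaleXA a b x : scaleX a (scaleX b x) = scaleX (a * b) x.
Proof. by elim/toX_ind: x => f; rewrite !scaleXE scalerA. Qed.

Lemma scale1X : left_id 1 scaleX.
Proof. by elim/toX_ind=> f; rewrite scaleXE scale1r. Qed.

Lemma scaleXDr : right_distributive scaleX +%R.
Proof.
move=> c; elim/toX_ind=> f; elim/toX_ind=> g.
by rewrite !scaleXE -!raddfD /= scaleXE scalerDr.
Qed.

Lemma scaleXDl x : {morph scaleX^~ x : a b / a + b}.
Proof. by elim/toX_ind: x => f a b; rewrite !scaleXE scalerDl raddfD. Qed.

HB.instance Definition _ := GRing.Zmodule_isLmodule.Build K X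
  scaleXA scale1X scaleXDr scaleXDl.

Lemma toX_is_monoid_morphism : monoid_morphism toX.
Proof. by split=> // f g; rewrite -mulXE. Qed.

HB.instance Definition _ :=
  GRing.isMonoidMorphism.Build A X toX toX_is_monoid_morphism.

Lemma toX_is_scalable : scalable toX.
Proof. by move=> c f; rewrite -scaleXE. Qed.

HB.instance Definition _ := GRing.isScalable.Build K A X *:%R toX toX_is_scalable.

Lemma scaleXAl (c : K) (x y : X) : c *: (x * y) = (c *: x) * y.
Proof.
elim/toX_ind: x => f; elim/toX_ind: y => g.
by rewrite -rmorphM -!linearZ -rmorphM /= scalerAl.
Qed.

HB.instance Definition _ := GRing.Lmodule_isLalgebra.Build K X scaleXAl.

Lemma scaleXAr (c : K) (x y : X) : c *: (x * y) = x * (c *: y).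
Proof.
elim/toX_ind: x => f; elim/toX_ind: y => g.
by rewrite -rmorphM -!linearZ -rmorphM /= scalerAr.
Qed.

HB.instance Definition _ := GRing.Lalgebra_isAlgebra.Build K X scaleXAr.

Lemma partX_is_linear d : linear (partX d).
Proof.
move=> c; elim/toX_ind=> f; elim/toX_ind=> g.
by rewrite -linearP !partXE -linearP /= linearP.
Qed.

Lemma partX_sum x : \sum_(d : bool) partX d x = x.
Proof.
elim/toX_ind: x => f; rewrite -[in RHS](part_sum f) raddf_sum.
by apply: eq_bigr => d _; rewrite partXE.
Qed.

Lemma partX_part d e x :
  partX d (partX e x) = if d == e then partX e x else 0.
Proof.
elim/toX_ind: x => f; rewrite !partXE part_part.
by case: ifP => // _; rewrite raddf0.
Qed.

Lemma partX_mul d x y :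
  partX d (x * y) = \sum_(e : bool) partX (d (+) e) x * partX e y.
Proof.
elim/toX_ind: x => f; elim/toX_ind: y => g.
rewrite -rmorphM partXE part_mul raddf_sum.
by apply: eq_bigr => e _; rewrite !partXE -rmorphM.
Qed.

HB.instance Definition _ := Algebra_isSuper.Build K X
  partX_is_linear partX_sum partX_part partX_mul.

End SuperQuotient.

(* The free superalgebra on the T_ij^(r); the letter [(i, j, r)] stands for
   T_ij^(r+1). *)
Notation letter N := (sidx N * sidx N * nat)%type.

Definition word_deg N (w : {fmonom letter N}) : bool :=
  foldr (fun x d => bar x.1.1 (+) bar x.1.2 (+) d) false w.

Lemma word_degM N (v w : {fmonom letter N}) :
  word_deg (mmul v w) = word_deg v (+) word_deg w.
Proof.
rewrite /word_deg fmM; elim: (fmonom_val v) => [|x s IH] //=.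
by rewrite IH !addbA.
Qed.

Section FreeSuperalgebra.
Variables (K : fieldType) (N : nat).
Local Notation F := {malg K[{fmonom letter N}]}.
Implicit Types f g : F.

Lemma malg_scaleU (c x : K) (w : {fmonom letter N}) :
  c *: mkmalgU w x = mkmalgU w (c * x).
Proof.
apply/malgP => v; apply: etrans (mcoeffZ c (mkmalgU w x) v) _.
apply: etrans (congr1 ( *%R c) (mcoeffU w x v)) _; rewrite /= mulrnAr.
exact/esym/mcoeffU.
Qed.

Lemma malg_scalerAr (c : K) f g : c *: (f * g) = f * (c *: g).
Proof.
have le : (msupp (c *: g) `<=` msupp g)%fset by exact: msuppZ_le.
rewrite (malgMEw (fsubset_refl _) le) malgME.
rewrite scaler_sumr; apply: eq_bigr => v _; rewrite scaler_sumr.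
apply: eq_bigr => w _.
by rewrite malg_scaleU (mcoeffZ c g w) mulrCA.
Qed.

Definition hpart (d : bool) f : F :=
  [malg w in msupp f => if word_deg w == d then mcoeff w f else 0].

Lemma hpartE d f w :
  mcoeff w (hpart d f) = if word_deg w == d then mcoeff w f else 0.
Proof. by rewrite mcoeffE; case: msuppP => // _; rewrite if_same. Qed.

Lemma hpart_is_linear d : linear (hpart d).
Proof.
move=> c f g; apply/malgP => w.
rewrite (mcoeffD w (c *: hpart d f)) (mcoeffZ c (hpart d f)) !hpartE.
rewrite (mcoeffD w (c *: f)) (mcoeffZ c f).
by case: ifP => // _; rewrite mulr0 addr0.
Qed.

HB.instance Definition _ d :=
  GRing.isLinear.Build K F F *:%R (hpart d) (hpart_is_linear d).

Lemma hpart_sum f : \sum_(d : bool) hpart d f = f.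
Proof.
apply/malgP => w; rewrite big_bool (mcoeffD w (hpart true f)) !hpartE.
by case: (word_deg w); rewrite /= ?addr0 ?add0r.
Qed.

Lemma hpart_hpart d e f : hpart d (hpart e f) = if d == e then hpart e f else 0.
Proof.
apply/malgP => w; rewrite !hpartE; case: (d =P e) => [->|de].
  by rewrite hpartE; case: eqP.
by rewrite mcoeff0; case: (word_deg w =P d) => // ->; case: eqP.
Qed.

Lemma hpart_homM d e e' f g :
  hpart d (hpart e f * hpart e' g)
  = if d == e (+) e' then hpart e f * hpart e' g else 0.
Proof.
have h w : w \in msupp (hpart e f * hpart e' g) -> word_deg w = e (+) e'.
  case/msuppM_le => v [v' [hv hv' ->]]; rewrite word_degM.
  move: hv hv'; rewrite -!mcoeff_neq0 !hpartE.
  by case: (word_deg v =P e) (word_deg v' =P e') => [->|_] [->|_]; rewrite ?eqxx.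
move: (hpart e f * _) h => p h; apply/malgP => w; rewrite hpartE.
case: (d =P e (+) e') => [->|/eqP/negPf ne].
  by case: (msuppP p w) => [/h ->|_]; rewrite ?eqxx ?if_same.
rewrite mcoeff0.
by case: (msuppP p w) => [/h ->|_]; rewrite ?if_same // eq_sym ne.
Qed.

Lemma sum_addb (V : nmodType) (u : bool -> V) (d e : bool) :
  \sum_(b : bool) (if d == b (+) e then u b else 0) = u (d (+) e).
Proof. by rewrite big_bool; case: d e => [] []; rewrite /= ?addr0 ?add0r. Qed.

Lemma hpart_mul d f g :
  hpart d (f * g) = \sum_(e : bool) hpart (d (+) e) f * hpart e g.
Proof.
rewrite -[in LHS](hpart_sum g) mulr_sumr linear_sum; apply: eq_bigr => e _.
rewrite -[in LHS](hpart_sum f) mulr_suml linear_sum.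
rewrite -(sum_addb (fun b => hpart b f * hpart e g)).
by apply: eq_bigr => b _; exact: hpart_homM.
Qed.

Definition free_alg : Type := F.
HB.instance Definition _ := GRing.Lalgebra.on free_alg.
HB.instance Definition _ :=
  GRing.Lalgebra_isAlgebra.Build K free_alg malg_scalerAr.
HB.instance Definition _ := Algebra_isSuper.Build K free_alg
  hpart_is_linear hpart_sum hpart_hpart hpart_mul.

Definition free_ct (f : free_alg) : K^o := mcoeff (mone : {fmonom letter N}) f.

Lemma free_ct_is_zmod_morphism : zmod_morphism free_ct.
Proof. exact: mcoeffB. Qed.

HB.instance Definition _ :=
  GRing.isZmodMorphism.Build free_alg K^o free_ct free_ct_is_zmod_morphism.

Lemma free_ct_is_monoid_morphism : monoid_morphism free_ct.
Proof. by case: (mcoeff1g_is_multiplicative {fmonom letter N} K). Qed.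

HB.instance Definition _ :=
  GRing.isMonoidMorphism.Build free_alg K^o free_ct free_ct_is_monoid_morphism.

Lemma free_ct_is_scalable : scalable free_ct.
Proof. by move=> c f; exact: mcoeffZ. Qed.

HB.instance Definition _ :=
  GRing.isScalable.Build K free_alg K^o *:%R free_ct free_ct_is_scalable.

Lemma free_ct_odd f : free_ct (part true (f : free_alg)) = 0.
Proof. by rewrite /free_ct [LHS]hpartE /word_deg fm1. Qed.

(* The coefficient of u^-r in T_ij(u), for r in Z. *)
Definition free_T (i j : sidx N) (r : int) : free_alg :=
  match r with
  | Posz 0 => (i == j)%:R
  | Posz r'.+1 => mkmalgU (fmu (i, j, r')) 1
  | Negz _ => 0
  end.

Lemma hom_free_T i j r : hom (bar i (+) bar j) (free_T i j r).
Proof.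
case: r => [[|r]|r]; last exact: hom0.
  by rewrite /free_T; case: (i =P j) => [->|_];
    rewrite ?addbb; [exact: hom1 | exact: hom0].
apply/malgP => w; apply: etrans (hpartE _ _ _) _; rewrite /free_T.
case: eqP => // h; apply/esym; apply: etrans (mcoeffU _ _ _) _.
by case: eqP h => // <-; rewrite /word_deg fmU /= addbF.
Qed.

Lemma free_ct_T i j r : free_ct (free_T i j r) = ((r == 0) && (i == j))%:R.
Proof.
case: r => [[|r]|r]; last exact: raddf0.
  exact: rmorph_nat.
by apply: etrans (mcoeffU _ _ _) _; rewrite fmP fmU fm1.
Qed.

(* The two-sided ideal generated by the defining relations. *)
Inductive rtt_gen : free_alg -> Prop :=
| rtt_gen0 : rtt_gen 0
| rtt_genR r s i j k l : rtt_gen (rtt_rel free_T r s i j k l)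
| rtt_genD f g : rtt_gen f -> rtt_gen g -> rtt_gen (f + g)
| rtt_genMl h f : rtt_gen f -> rtt_gen (h * f)
| rtt_genMr f h : rtt_gen f -> rtt_gen (f * h).

Definition rtt_ideal : {pred free_alg} := fun f => `[< rtt_gen f >].

Lemma rtt_zmod_closed : zmod_closed rtt_ideal.
Proof.
split; first by apply/asboolP; exact: rtt_gen0.
move=> f g /asboolP hf /asboolP hg; apply/asboolP.
by apply: rtt_genD => //; rewrite -mulN1r; apply: rtt_genMl.
Qed.

HB.instance Definition _ :=
  GRing.isZmodClosed.Build free_alg rtt_ideal rtt_zmod_closed.

Lemma rtt_ideal1 : 1 \notin rtt_ideal.
Proof.
suff h f : rtt_gen f -> free_ct f = 0.
  by apply/asboolP => /h /eqP; rewrite rmorph1 oner_eq0.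
elim=> {f} [||f g _ hf _ hg|h f _ hf|f h _ hf].
- exact: raddf0.
- exact: (@eps_rtt_rel K free_alg N free_T free_ct free_ct_odd free_ct_T).
- by rewrite raddfD /= hf hg addr0.
- by rewrite rmorphM /= hf mulr0.
- by rewrite rmorphM /= hf mul0r.
Qed.

Lemma rtt_idealMl f g : g \in rtt_ideal -> (f : free_alg) * g \in rtt_ideal.
Proof. by move=> /asboolP h; apply/asboolP/rtt_genMl. Qed.

Lemma rtt_idealMr f g : f \in rtt_ideal -> (f : free_alg) * g \in rtt_ideal.
Proof. by move=> /asboolP h; apply/asboolP/rtt_genMr. Qed.

Lemma rtt_gen_sum (G : bool -> free_alg) :
  (forall e, rtt_gen (G e)) -> rtt_gen (\sum_e G e).
Proof.
by move=> h; apply: big_ind => //; [exact: rtt_gen0 | exact: rtt_genD].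
Qed.

Lemma rtt_ideal_part d f :
  f \in rtt_ideal -> part d (f : free_alg) \in rtt_ideal.
Proof.
move=> /asboolP hf; apply/asboolP; elim: hf d => {f}.
- by move=> d; rewrite linear0; exact: rtt_gen0.
- move=> r s i j k l d.
  rewrite (part_hom _ (hom_rtt_rel hom_free_T _ _ _ _ _ _)).
  by case: ifP => _; [exact: rtt_genR | exact: rtt_gen0].
- by move=> f g _ hf _ hg d; rewrite linearD; exact: rtt_genD (hf d) (hg d).
- move=> h f _ hf d; rewrite part_mul; apply: rtt_gen_sum => e.
  exact: rtt_genMl.
- move=> f h _ hf d; rewrite part_mul; apply: rtt_gen_sum => e.
  exact: rtt_genMr.
Qed.

HB.instance Definition _ := isSuperIdeal.Build K free_alg rtt_ideal
  rtt_ideal1 rtt_idealMl rtt_idealMr rtt_ideal_part.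

(* The extended Yangian X(p_N). *)
Definition extYangian : Type := squot rtt_ideal.
HB.instance Definition _ := SuperAlgebra.on extYangian.

Lemma toX_rtt_rel r s i j k l :
  toX rtt_ideal (rtt_rel free_T r s i j k l) = 0.
Proof.
rewrite -(raddf0 (toX rtt_ideal)); apply/toXP; rewrite subr0.
by apply/asboolP; exact: rtt_genR.
Qed.

(* The coefficient of u^-r in T_ij(u). *)
Definition T (i j : sidx N) (r : nat) : extYangian :=
  toX rtt_ideal (free_T i j r%:Z).

End FreeSuperalgebra.

(* Formal power series in u^-1: [f m] is the coefficient of u^-m. *)
Section PowerSeries.
Variable A : nzRingType.

Definition ps_one (m : nat) : A := (m == 0%N)%:R.

Definition ps_mul (f g : nat -> A) (m : nat) : A :=
  \sum_(r < m.+1) f r * g (m - r)%N.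

End PowerSeries.

(* The expansion of (a u + c)^-1 as a power series in u^-1, for a != 0. *)
Definition affine_inv (K : fieldType) (a c : K) (m : nat) : K :=
  if m is k.+1 then a^-1 * (- (c / a)) ^+ k else 0.

Lemma affine_invP (K : fieldType) (a c : K) (m : nat) : a != 0 ->
  a * affine_inv a c m.+1 + c * affine_inv a c m = (m == 0%N)%:R.
Proof.
move=> a0; case: m => [|m]; rewrite /= mulVKf //.
  by rewrite expr0 mulr0 addr0.
by rewrite exprS mulNr mulrA addNr.
Qed.

(* The power series f(a u + c) in u^-1, for a != 0; the sum is truncated at
   r = m because (a u + c)^-r has no term in u^-m for r > m. *)
Definition ps_affine (K : fieldType) (A : algType K) (a c : K) (f : nat -> A)
    (m : nat) : A :=
  \sum_(r < m.+1) iter r (ps_mul (affine_inv a c)) (@ps_one K) m *: f r.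

(* The coefficient of u^-m in A(u): the factor with index k : 'I_N is
   T_(k+1, s(k+1))(u + k), and the product is in increasing order of k. *)
Definition Aseries (K : fieldType) (N : nat) (m : nat) : extYangian K N :=
  \sum_(s : 'S_N) (-1) ^+ s *:
    (\big[@ps_mul (extYangian K N)/@ps_one (extYangian K N)]_(k < N)
       ps_affine 1 k%:R (T K (spos k) (spos (s k)))) m.

(* Main.v *)
(** Write a, b, c, d for the blocks T_{i,j}, T_{i,-j}, T_{-i,j}, T_{-i,-j} with
    i, j > 0. The series a_ij(u) satisfy the relations of the Yangian of gl_N. With
    anticommuting variables phi_i, psi_j put t(u) = sum phi_i psi_j a_ij(u); then
    t(u) t(u+1) ... t(u+N-1) is a multiple of A(u) prod phi prod psi, which gives the
    row and the column expansion of A(u), and an induction on the number of factors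
    shows that A(u) commutes with all a_kl(v).

    The terms of lowest order of the defining relations express the remaining
    generators through a, c_kk^(1) and, for N > 1, b_kl^(1) with k <> l. The commutator
    of c_kk^(1) with A(u) A(1-N-u) only affects the last factor of A(u) and the first
    factor of A(1-N-u), after reordering rows so that both are the factors of row k.
    Their arguments are opposite, and the two contributions cancel by the relation
    between T(v) and T(-v) that comes from the pole of R(u,v) at u + v = 0. For
    b_kl^(1) the same works with columns and the two adjacent factors of columns k and
    l; for N = 1 the commutation with b(v) is computed directly. *)
From HB Require Import structures.
From mathcomp Require Import all_boot all_order all_fingroup all_algebra.
From mathcomp Require Import boolp reals complex ring zify.
From mathcomp Require Import monalg.
Require Import Defs.

Set Implicit Arguments.
Unset Strict Implicit.
Unset Printing Implicit Defensive.

Import GRing.Theory.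
Local Open Scope ring_scope.

(** * Linear identities in modules *)

(** Commutation with T(v) involves two variables, but all computations use series in the single
    variable h = u^-1. An argument al u + ka is encoded by p = al + ka h, so that the relations
    between such points have coefficients polynomial in p, q and h; instead of dividing, one cancels
    coefficients that are [regular]. Where commutation with all coefficients of T(v) is needed, it
    is tested at v = 2u, 3u, ..., and a Vandermonde system separates the coefficients. The entries
    do not commute, so determinant identities of commutative rings do not apply. Products of
    Grassmann forms keep the factors in order and turn the relations at arguments differing by 1
    into antisymmetry. To get back to A(u) the variables must be stripped off again; this takes
    derivations d/d theta, hence an injective extension of Clifford type. Two sets of variables
    serve first for the rows and columns of t(u), later for one determinant each, because the top
    product of a single set has square zero. The super signs are dealt with in the block relations;
    afterwards only ordinary commutators occur, as A(u) A(1-N-u) is even. *)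

Section LinearExpressions.
Variables (R : comNzRingType) (V : lmodType R).

Inductive linexp : Type :=
| LAtom of nat
| LZero
| LAdd of linexp & linexp
| LOpp of linexp
| LScale of R & linexp
| LMuln of linexp & nat.

Fixpoint linval (env : seq V) (e : linexp) : V :=
  match e with
  | LAtom n => nth 0 env n
  | LZero => 0
  | LAdd e1 e2 => linval env e1 + linval env e2
  | LOpp e1 => - linval env e1
  | LScale c e1 => c *: linval env e1
  | LMuln e1 n => linval env e1 *+ n
  end.

(** The test is [eqn] and not [==], so that [lin_ring] can evaluate it by [cbn] and leave pure ring
    identities between coefficients. *)
Fixpoint lincoef (e : linexp) (m : nat) : R :=
  match e with
  | LAtom n => if eqn n m then 1 else 0
  | LZero => 0
  | LAdd e1 e2 => lincoef e1 m + lincoef e2 m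
  | LOpp e1 => - lincoef e1 m
  | LScale c e1 => c * lincoef e1 m
  | LMuln e1 n => lincoef e1 m * n%:R
  end.

Lemma linvalE env e :
  linval env e = \sum_(m < size env) lincoef e m *: nth 0 env m.
Proof.
elim: e => /= [n||e1 -> e2 ->|e ->|c e ->|e -> n].
- case: (ltnP n (size env)) => hn.
    rewrite (bigD1 (Ordinal hn)) //= (_ : eqn n n = (n == n)) // eqxx scale1r big1 ?addr0 // => m.
    by rewrite -val_eqE eq_sym => /negPf/= nm; rewrite (_ : eqn n m = false) ?scale0r.
  (* An atom outside the environment has the value 0, and no index below [size env] meets it. *)
  rewrite nth_default // big1 // => m _; case: (n =P m :> nat) => [nm|/eqP/negPf nm].
    by move: (ltn_ord m); rewrite -nm ltnNge hn.
  by rewrite (_ : eqn n m = false) ?scale0r.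
- by rewrite big1 // => m _; rewrite scale0r.
- by rewrite -big_split; apply: eq_bigr => m _; rewrite scalerDl.
- by rewrite -sumrN; apply: eq_bigr => m _; rewrite scaleNr.
- by rewrite scaler_sumr; apply: eq_bigr => m _; rewrite scalerA.
- rewrite -sumrMnl; apply: eq_bigr => m _.
  by rewrite mulr_natr scalerMnl.
Qed.

Fixpoint eq_coefs (e1 e2 : linexp) (k : nat) : Prop :=
  if k is k'.+1 then eq_coefs e1 e2 k' /\ lincoef e1 k' = lincoef e2 k' else True.

Lemma linval_eq env e1 e2 :
  eq_coefs e1 e2 (size env) -> linval env e1 = linval env e2.
Proof.
move=> h; rewrite !linvalE; apply: eq_bigr => -[m /= hm] _; congr (_ *: _).
elim: (size env) h hm => // k IH [hk ek]; rewrite ltnS leq_eqVlt.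
by case/orP => [/eqP ->|]; last exact: IH.
Qed.

End LinearExpressions.

(* Atoms are compared up to conversion, since equal products may carry different
   but convertible ring structures. *)
Ltac lin_find x env :=
  lazymatch env with
  | ?y :: ?r =>
    match goal with
    | |- _ => let _ := match goal with |- _ => unify x y end in constr:(O)
    | |- _ => let n := lin_find x r in constr:(S n)
    end
  end.

Ltac lin_add x env :=
  lazymatch env with
  | nil => constr:(x :: nil)
  | ?y :: ?r =>
    match goal with
    | |- _ => let _ := match goal with |- _ => unify x y end in env
    | |- _ => let r' := lin_add x r in constr:(y :: r')
    end
  end.

Ltac lin_atoms t env :=
  lazymatch t with
  | GRing.zero => env
  | (?a + ?b)%R => let e := lin_atoms a env in lin_atoms b e
  | (- ?a)%R => lin_atoms a env
  | (_ *: ?a)%R => lin_atoms a env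
  | (?a *+ _)%R => lin_atoms a env
  | _ => lin_add t env
  end.

Ltac lin_reify R t env :=
  lazymatch t with
  | GRing.zero => constr:(@LZero R)
  | (?a + ?b)%R => let a' := lin_reify R a env in let b' := lin_reify R b env in
                   constr:(LAdd a' b')
  | (- ?a)%R => let a' := lin_reify R a env in constr:(LOpp a')
  | (?c *: ?a)%R => let a' := lin_reify R a env in constr:(@LScale R c a')
  | (?a *+ ?n)%R => let a' := lin_reify R a env in constr:(LMuln a' n)
  | _ => let n := lin_find t env in constr:(@LAtom R n)
  end.

(* Proves an equality of R-linear combinations in V: [ring] compares the coefficients
   of each atom. *)
Ltac lin_ring R V :=
  lazymatch goal with
  | |- ?a = ?b =>
    let env := lin_atoms a (@nil (GRing.Lmodule.sort V)) in
    let env := lin_atoms b env in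
    let a' := lin_reify R a env in
    let b' := lin_reify R b env in
    apply: (@linval_eq R V env a' b');
    cbn [eq_coefs lincoef size eqn]; repeat split; ring
  end.

(** * Anticommuting variables and determinants *)

Section MatrixAlgebra.
Variables (L : comNzRingType) (S : algType L).

(** A type of its own, because matrices over [S] already form a module with scalars in [S], while
    here the scalars come from [L]. *)
Definition mat2 : Type := 'M[S]_2.
HB.instance Definition _ := GRing.NzRing.on mat2.

Definition mat2_scale (c : L) (X : mat2) : mat2 := map_mx ( *:%R c) X.

Lemma mat2_scaleA a b X : mat2_scale a (mat2_scale b X) = mat2_scale (a * b) X.
Proof. by apply/matrixP => i j; rewrite !mxE scalerA. Qed.

Lemma mat2_scale1 : left_id 1 mat2_scale.
Proof. by move=> X; apply/matrixP => i j; rewrite !mxE scale1r. Qed.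

Lemma mat2_scaleDr : right_distributive mat2_scale +%R.
Proof. by move=> c X Y; apply/matrixP => i j; rewrite !mxE scalerDr. Qed.

Lemma mat2_scaleDl X : {morph mat2_scale^~ X : a b / a + b}.
Proof. by move=> a b; apply/matrixP => i j; rewrite !mxE scalerDl. Qed.

HB.instance Definition _ := GRing.Zmodule_isLmodule.Build L mat2
  mat2_scaleA mat2_scale1 mat2_scaleDr mat2_scaleDl.

Lemma mat2_scaleAl (c : L) (X Y : mat2) : c *: (X * Y) = (c *: X) * Y.
Proof.
apply/matrixP => i j; rewrite !mxE scaler_sumr; apply: eq_bigr => k _.
by rewrite !mxE scalerAl.
Qed.

HB.instance Definition _ := GRing.Lmodule_isLalgebra.Build L mat2 mat2_scaleAl.

Lemma mat2_scaleAr (c : L) (X Y : mat2) : c *: (X * Y) = X * (c *: Y).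
Proof.
apply/matrixP => i j; rewrite !mxE scaler_sumr; apply: eq_bigr => k _.
by rewrite !mxE scalerAr.
Qed.

HB.instance Definition _ := GRing.Lalgebra_isAlgebra.Build L mat2 mat2_scaleAr.

Definition mat2_const (x : S) : mat2 := x%:M.

Lemma mat2_const_is_zmod_morphism : zmod_morphism mat2_const.
Proof. exact: raddfB. Qed.

HB.instance Definition _ :=
  GRing.isZmodMorphism.Build S mat2 mat2_const mat2_const_is_zmod_morphism.

Lemma mat2_const_is_monoid_morphism : monoid_morphism mat2_const.
Proof. by split=> // x y; rewrite /mat2_const scalar_mxM. Qed.

HB.instance Definition _ :=
  GRing.isMonoidMorphism.Build S mat2 mat2_const mat2_const_is_monoid_morphism.

Lemma mat2_const_is_scalable : scalable mat2_const.
Proof.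
by move=> c x; apply/matrixP => i j; rewrite !mxE scalerMnr.
Qed.

HB.instance Definition _ :=
  GRing.isScalable.Build L S mat2 *:%R mat2_const mat2_const_is_scalable.

End MatrixAlgebra.

(** [L] will be a ring of power series in which h is not invertible: identities are multiplied up
    and such factors cancelled. *)
Definition regular (L : pzRingType) (V : lmodType L) (c : L) : Prop :=
  forall x : V, c *: x = 0 -> x = 0.

(* [cl_up i] is an anticommuting variable theta_i and [cl_dn i] is d / d theta_i. *)
Record clifford (L : comNzRingType) (S : algType L) (n : nat) := Clifford {
  cl_alg : algType L;
  cl_in : {lrmorphism S -> cl_alg};
  cl_up : 'I_n -> cl_alg;
  cl_dn : 'I_n -> cl_alg;
  cl_in_inj : injective cl_in;
  cl_regular : forall c, regular S c -> regular cl_alg c;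
  cl_upC : forall i x, cl_up i * cl_in x = cl_in x * cl_up i;
  cl_dnC : forall i x, cl_dn i * cl_in x = cl_in x * cl_dn i;
  cl_up_up : forall i j, cl_up i * cl_up j = - (cl_up j * cl_up i);
  cl_dn_up : forall i j, cl_dn i * cl_up j = (i == j)%:R - cl_up j * cl_dn i
}.

Ltac mat2_simp :=
  rewrite /= ?(mulr1, mulr0, mul1r, mul0r, mulN1r, mulrN, mulNr,
    opprK, oppr0, addr0, add0r, expr0, expr1).

Ltac mat2_entries := rewrite !mxE !big_ord_recl !big_ord0 !mxE; mat2_simp.

(* Passing to 2x2 matrices adjoins one pair [up], [dn] as the off-diagonal units;
   the old generators [u] become [diag (u, - u)]. *)
Lemma clifford_exists (L : comNzRingType) (S : algType L) (n : nat) :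
  inhabited (clifford S n).
Proof.
elim: n => [|n [[E f u d finj reg uC dC uu du]]].
  constructor; apply: (@Clifford L S 0 S idfun (fun=> 0) (fun=> 0)) => //.
  - by case.
  - by case.
  - by case.
  - by case.
have I2 (P : 'I_2 -> Prop) : P 0 -> P 1 -> forall i, P i.
  by move=> h0 h1 [[|[|//]] hi]; [move: h0 | move: h1]; congr P; apply: val_inj.
have mat2P (X Y : mat2 E) : X 0 0 = Y 0 0 -> X 0 1 = Y 0 1 ->
    X 1 0 = Y 1 0 -> X 1 1 = Y 1 1 -> X = Y.
  by move=> h1 h2 h3 h4; apply/matrixP; elim/I2; elim/I2.
pose D (x : E) : mat2 E := \matrix_(i, j) (if i == j then (-1) ^+ i * x else 0).
pose E12 : mat2 E := delta_mx 0 1; pose E21 : mat2 E := delta_mx 1 0.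
pose up (i : 'I_n.+1) : mat2 E := if unlift ord_max i is Some k then D (u k) else E12.
pose dn (i : 'I_n.+1) : mat2 E := if unlift ord_max i is Some k then D (d k) else E21.
constructor.
pose g : {lrmorphism S -> mat2 E} := (@mat2_const L E) \o f.
have gE x : g x = mat2_const (f x) by [].
refine (@Clifford L S n.+1 (mat2 E : algType L) g up dn _ _ _ _ _ _).
- by move=> x y /(congr1 (fun X : mat2 E => X 0 0)); rewrite !mxE /= => /finj.
- move=> c /reg hc X /matrixP hX.
  by apply: mat2P; rewrite [RHS]mxE; apply: hc;
     [move: (hX 0 0) | move: (hX 0 1) | move: (hX 1 0) | move: (hX 1 1)]; rewrite !mxE.
- move=> i x; rewrite gE /up; case: unliftP => [k _|_]; apply: mat2P;
    by mat2_entries; rewrite ?uC.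
- move=> i x; rewrite gE /dn; case: unliftP => [k _|_]; apply: mat2P;
    by mat2_entries; rewrite ?dC.
- move=> i j; rewrite /up; case: (unliftP _ i) => [k _|_]; case: (unliftP _ j) => [m _|_];
    apply: mat2P;
    by mat2_entries => //; rewrite uu; mat2_simp.
- move=> i j; rewrite /up /dn.
  case: (unliftP _ i) => [k ->|->]; case: (unliftP _ j) => [m ->|->];
    rewrite ?(inj_eq lift_inj) ?eqxx ?(negPf (neq_lift _ _)) ?[lift _ _ == _]eq_sym
      ?(negPf (neq_lift _ _));
    rewrite -(rmorph_nat (@mat2_const L E));
    apply: mat2P; mat2_entries; rewrite ?subrr ?du //.
Qed.

(** * Alternating functions of lists *)

Section Alternating.

(** Adjacent transpositions generate all permutations. The predicate is generalised in the
    induction, so that the head can stay fixed while the tail is permuted. *)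
Lemma perm_swap_ind (T : eqType) (P : seq T -> Prop) :
    (forall s1 a b s2, P (s1 ++ a :: b :: s2) -> P (s1 ++ b :: a :: s2)) ->
  forall s t, perm_eq s t -> P s -> P t.
Proof.
move=> hP s; elim: s P hP => [|x s IH] P hP t.
  by rewrite perm_sym => /perm_nilP ->.
move=> pst; have xt : x \in t by rewrite -(perm_mem pst) mem_head.
case/splitPr: xt pst => t1 t2 pst Ps.
have {}pst : perm_eq s (t1 ++ t2).
  by move: pst; rewrite perm_sym perm_catC /= perm_cons perm_catC perm_sym.
(* First the tail is permuted behind [x], then [x] travels through [t1]. *)
have : P (x :: t1 ++ t2).
  by apply: (IH (fun s => P (x :: s))) pst Ps => s1 a b s2; apply: (hP (x :: s1)).
elim: t1 {pst IH Ps} P hP => //= y t1 IH P hP Pt.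
apply: (IH (fun s => P (y :: s))); last exact: (hP [::]).
by move=> s1 a b s2; apply: (hP (y :: s1)).
Qed.

Variables (T : Type) (V : zmodType) (G : seq T -> V).

Definition alternating :=
  forall s1 a b s2, G (s1 ++ a :: b :: s2) = - G (s1 ++ b :: a :: s2).

Hypothesis altG : alternating.

Lemma alt_swap s1 a s2 b s3 :
  G (s1 ++ a :: s2 ++ b :: s3) = - G (s1 ++ b :: s2 ++ a :: s3).
Proof.
elim: s2 s1 => [|c s2 IH] s1 /=; first exact: altG.
by have IHc := IH (rcons s1 c); rewrite !cat_rcons in IHc; rewrite altG IHc opprK altG.
Qed.

End Alternating.

(** Exchanging two equal entries gives [G s = - G s], and 2 can be cancelled. *)
Lemma alternating_dup (T : eqType) (V : zmodType) (G : seq T -> V) :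
    (forall x : V, x + x = 0 -> x = 0) -> alternating G ->
  forall s, ~~ uniq s -> G s = 0.
Proof.
move=> reg2 altG s nu; have [a [s1 [s2 [s3 ->]]]] :
    exists a s1 s2 s3, s = s1 ++ a :: s2 ++ a :: s3.
  elim: s {nu} (nu) => // x s IH; rewrite /= negb_and negbK => /orP [xs|/IH].
    by case/splitPr: xs => s2 s3; exists x, [::], s2, s3.
  by case=> a [s1 [s2 [s3 ->]]]; exists a, (x :: s1), s2, s3.
by apply: reg2; rewrite {1}(alt_swap altG) addNr.
Qed.

(** The sign is left open, since [two_copies] accepts either one. *)
Lemma alternating_perm_eq (T : eqType) (V : zmodType) (G : seq T -> V) :
  alternating G -> forall s t, perm_eq s t -> G t = G s \/ G t = - G s.
Proof.
move=> altG s t pst; apply: (perm_swap_ind (P := fun t => G t = G s \/ G t = - G s)) pst _.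
  by move=> s1 a b s2; rewrite altG => -[/eqP|/eqP]; rewrite eqr_oppLR ?opprK => /eqP ->; auto.
by left.
Qed.

Lemma alternating_tperm (T : Type) (V : zmodType) (G : seq T -> V) n
    (f : 'I_n -> T) (i j : 'I_n) : alternating G -> i != j ->
  G [seq f (tperm i j k) | k <- enum 'I_n] = - G [seq f k | k <- enum 'I_n].
Proof.
move=> altG; have := enum_uniq 'I_n; have := mem_enum 'I_n; move: (enum 'I_n) => s.
wlog: i j / (index i s <= index j s)%N => [wl ins us ne|ij ins us ne].
  case/orP: (leq_total (index i s) (index j s)) => le; first exact: wl.
  by rewrite tpermC; apply: wl; rewrite // eq_sym.
have si : i \in s by rewrite ins.
case/splitPr: si ij ins us => s1 s2 ij ins us.
have js : j \in s2.
  have := ins j; rewrite inE mem_cat inE eq_sym (negPf ne) /= => /orP[js|//].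
  move: ij us; rewrite !index_cat js cat_uniq /= => ij /and3P[_ /norP[is1 _] _].
  by move: ij; rewrite (negPf is1) /= eqxx addn0 leqNgt index_mem js.
case/splitPr: js ins us {ij} => s3 s4 ins us.
have {us} us : uniq (i :: j :: s1 ++ s3 ++ s4).
  by rewrite -(perm_uniq (s1 := s1 ++ i :: s3 ++ j :: s4)) //; apply/seq.permP => p;
    rewrite /= !count_cat /= !count_cat /=; lia.
have key : {in s1 ++ s3 ++ s4, (fun l => f (tperm i j l)) =1 f}.
  move=> k ks /=; move: us => /= /and3P[]; rewrite inE negb_or => /andP[_ hi] hj _.
  by rewrite tpermD //; [apply: contraNneq hi => -> | apply: contraNneq hj => ->].
have [k1 k3 k4] : [/\ {in s1, (fun l => f (tperm i j l)) =1 f}, {in s3, (fun l => f (tperm i j l)) =1 f} &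
    {in s4, (fun l => f (tperm i j l)) =1 f}].
  by split=> k ks; apply: key; rewrite !mem_cat ks ?orbT.
have -> : [seq f (tperm i j k) | k <- s1 ++ i :: s3 ++ j :: s4]
   = map f s1 ++ f j :: map f s3 ++ f i :: map f s4.
  by rewrite !map_cat /= map_cat /= tpermL tpermR (iffLR (eq_in_map _ _ _) k1) (iffLR (eq_in_map _ _ _) k3) (iffLR (eq_in_map _ _ _) k4).
by rewrite alt_swap // map_cat /= map_cat.
Qed.

Lemma alternating_perm (T : Type) (E : pzRingType) (G : seq T -> E) n
    (f : 'I_n -> T) (s : 'S_n) : alternating G ->
  G [seq f (s i) | i <- enum 'I_n] = (-1) ^+ s * G [seq f i | i <- enum 'I_n].
Proof.
move=> altG; have [ts -> dts] := prod_tpermP s.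
elim: ts dts f => [|t ts IH] /= dts f.
  by rewrite big_nil odd_perm1 mul1r; congr G; apply: eq_map => i; rewrite perm1.
case/andP: dts => dt /IH {}IH; rewrite big_cons odd_permM odd_tperm dt.
(* By [permM] the left factor acts first; the remaining transpositions are absorbed into the
   function, and the first one exchanges two positions. *)
pose g j := f ((\prod_(t0 <- ts) tperm t0.1 t0.2)%g j).
rewrite (eq_map (g := fun i => g (tperm t.1 t.2 i))) => [|i]; last by rewrite permM.
by rewrite alternating_tperm // IH signr_addb mulN1r mulNr.
Qed.

Section ShiftedProducts.
Variables (T : Type) (E : pzRingType) (F : nat -> T -> E).

(** The shift depends on the position in the list only. Thus rows or columns can be reordered while
    the arguments of the factors stay in place. *)
Fixpoint sprod (k : nat) (s : seq T) : E :=
  if s is i :: s' then F k i * sprod k.+1 s' else 1.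

Lemma sprod_cat k s t : sprod k (s ++ t) = sprod k s * sprod (k + size s) t.
Proof.
by elim: s k => [|i s IH] k /=; rewrite ?mul1r ?addn0 // IH mulrA addSnnS.
Qed.

Lemma sprod_map_enum n (f : 'I_n -> T) :
  sprod 0 [seq f i | i <- enum 'I_n] = \prod_(k < n) F k (f k).
Proof.
suff key (s : seq 'I_n) k : [seq val i | i <- s] = iota k (size s) ->
    sprod k [seq f i | i <- s] = \prod_(i <- s) F i (f i).
  by rewrite key ?val_enum_ord ?size_enum_ord // enumT.
elim: s k => [|i s IH] k; first by rewrite big_nil.
by rewrite big_cons /= => -[-> /IH ->].
Qed.

Lemma sprod_alternating :
    (forall k i j, F k i * F k.+1 j = - (F k j * F k.+1 i)) ->
  forall k, alternating (sprod k).
Proof.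
move=> altF k s1 a b s2; rewrite !sprod_cat /= [F _ a * _]mulrA altF.
by rewrite [F _ b * (_ * _)]mulrA mulNr mulrN.
Qed.

End ShiftedProducts.

Lemma anticomm_prod (E : pzRingType) (J : eqType) (u : E) (f : J -> E) (s : seq J) :
    {in s, forall j, u * f j = - (f j * u)} ->
  u * \prod_(k <- s) f k = (-1) ^+ size s * (\prod_(k <- s) f k * u).
Proof.
elim: s => [|j s IH] uf; first by rewrite !big_nil mulr1 !mul1r.
rewrite !big_cons mulrA uf ?mem_head // mulNr -[f j * u * _]mulrA IH => [|k ks].
  by rewrite /= exprS mulN1r mulNr; congr (- _); rewrite !mulrA commr_sign.
by apply: uf; rewrite inE ks orbT.
Qed.

(** * Top Grassmann products and determinants of noncommuting entries *)

Section Grassmann.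
Variables (n : nat) (E : nzRingType) (psi : 'I_n -> E).
Hypothesis reg2 : forall x : E, x + x = 0 -> x = 0.
Hypothesis psi_psi : forall i j, psi i * psi j = - (psi j * psi i).

Local Notation Psi := (\prod_(k < n) psi k).

Lemma sum_ffun_perm (V : zmodType) (H : {ffun 'I_n -> 'I_n} -> V) :
    (forall f : {ffun 'I_n -> 'I_n}, ~~ injectiveb f -> H f = 0) ->
  \sum_f H f = \sum_(s : 'S_n) H (pval s).
Proof.
move=> H0; rewrite (bigID (fun f : {ffun _} => injectiveb f)) /= addrC big1 ?add0r //.
rewrite (reindex (@pval _)) /=; last first.
  pose in_Sn := insubd (1%g : 'S_n).
  by exists in_Sn => /= f Uf; first apply: val_inj; apply: insubdK.
by apply: eq_bigl => s; rewrite (valP s).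
Qed.

Lemma alternating_prod_dup (F : nat -> 'I_n -> E) (f : {ffun 'I_n -> 'I_n}) :
    (forall k i j, F k i * F k.+1 j = - (F k j * F k.+1 i)) ->
  ~~ injectiveb f -> \prod_(k < n) F k (f k) = 0.
Proof.
move=> altF nf; rewrite -(sprod_map_enum F f).
exact: (alternating_dup reg2 (sprod_alternating altF 0)).
Qed.

Lemma alternating_prod_perm (F : nat -> 'I_n -> E) (s : 'S_n) :
    (forall k i j, F k i * F k.+1 j = - (F k j * F k.+1 i)) ->
  \prod_(k < n) F k (s k) = (-1) ^+ s * \prod_(k < n) F k k.
Proof.
move=> altF; rewrite -(sprod_map_enum F s) -(sprod_map_enum F id).
exact: (alternating_perm id s (sprod_alternating altF 0)).
Qed.

Lemma psi_dup (f : {ffun 'I_n -> 'I_n}) :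
  ~~ injectiveb f -> \prod_(k < n) psi (f k) = 0.
Proof. by apply: (alternating_prod_dup (F := fun=> psi)). Qed.

Lemma psi_perm (s : 'S_n) : \prod_(k < n) psi (s k) = (-1) ^+ s * Psi.
Proof. by apply: (alternating_prod_perm (F := fun=> psi)). Qed.

Lemma psi_prod_alternating : alternating (fun s : seq 'I_n => \prod_(k <- s) psi k).
Proof.
move=> s1 a b s2; rewrite !big_cat !big_cons /= [psi a * _]mulrA psi_psi.
by rewrite mulNr mulrN !mulrA.
Qed.

Lemma psi_Psi i : psi i * Psi = 0.
Proof.
have := alternating_dup reg2 psi_prod_alternating (s := i :: enum 'I_n).
by rewrite big_cons /index_enum -enumT /= mem_enum /= => ->.
Qed.

Lemma Psi_psi i : Psi * psi i = 0.
Proof.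
have := alternating_dup reg2 psi_prod_alternating (s := rcons (enum 'I_n) i).
by rewrite rcons_uniq mem_enum /= -cats1 big_cat big_seq1 /index_enum -enumT => ->.
Qed.

(** The variables are removed from the right one at a time. If [z * P * psi k = 0], then inserting 1
    = [dpsi k * psi k + psi k * dpsi k] after [z * P] leaves [z * P * dpsi k * psi k], and moving
    [dpsi k] to the far left costs only a sign. The exponent [b] records the parity of [z]. *)
Lemma Psi_cancel (dpsi : 'I_n -> E) (b : nat) (z : E) :
    (forall i j, dpsi i * psi j = (i == j)%:R - psi j * dpsi i) ->
    (forall i, dpsi i * z = (-1) ^+ b * (z * dpsi i)) ->
  z * Psi = 0 -> z = 0.
Proof.
move=> dp; rewrite /index_enum -enumT; have := enum_uniq 'I_n.
elim/last_ind: (enum _) b z => [|s k IH] b z; first by rewrite big_nil mulr1.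
rewrite rcons_uniq => /andP[ks us] dz; rewrite -cats1 big_cat big_seq1 /= mulrA => zs.
apply: (IH b) => //; have {ks} dP : dpsi k * \prod_(i <- s) psi i
    = (-1) ^+ size s * (\prod_(i <- s) psi i * dpsi k).
  apply: anticomm_prod => i si; rewrite dp (_ : (k == i) = false) ?sub0r //.
  by apply: contraNF ks => /eqP ->.
move: (\prod_(i <- s) psi i) dP zs => P dP zs.
have -> : z * P = z * P * (dpsi k * psi k + psi k * dpsi k).
  by rewrite dp eqxx subrK mulr1.
rewrite mulrDr [X in _ + X]mulrA zs mul0r addr0 mulrA.
have -> : z * P * dpsi k = (-1) ^+ (b + size s) * (dpsi k * (z * P)).
  have -> : dpsi k * (z * P) = (-1) ^+ b * ((-1) ^+ size s * (z * P * dpsi k)).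
    rewrite mulrA dz -[_ * (z * dpsi k) * P]mulrA -[z * dpsi k * P]mulrA dP [z * (_ * _)]mulrA commr_sign.
    by rewrite -!mulrA.
  by rewrite !mulrA -!exprD -addnA addnn -signr_odd odd_double mul1r.
by rewrite -[LHS]mulrA -[dpsi k * _ * _]mulrA zs !mulr0.
Qed.

(** The factors stand in the order of the rows, as in A(u); applied to a transposed array this is
    the column determinant. *)
Definition rdet (F : 'I_n -> 'I_n -> E) : E :=
  \sum_(s : 'S_n) (-1) ^+ s * \prod_(k < n) F k (s k).

Lemma rdet_comm (u : E) (F : 'I_n -> 'I_n -> E) :
  (forall i j, u * F i j = F i j * u) -> u * rdet F = rdet F * u.
Proof.
move=> uF; rewrite mulr_sumr mulr_suml; apply: eq_bigr => s _.
rewrite mulrA commr_sign -!mulrA; congr (_ * _).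
elim/big_ind: _ => [|v w hv hw|k _]; first by rewrite mulr1 mul1r.
  by rewrite mulrA hv -!mulrA hw.
exact: uF.
Qed.

Lemma prod_mul_comm (F G : 'I_n -> E) :
    (forall i j, G i * F j = F j * G i) ->
  \prod_(k < n) (F k * G k) = (\prod_(k < n) F k) * \prod_(k < n) G k.
Proof.
move=> FG; have GF (s : seq 'I_n) i : G i * \prod_(k <- s) F k = \prod_(k <- s) F k * G i.
  elim: s => [|j s IH]; first by rewrite !big_nil mulr1 mul1r.
  by rewrite !big_cons mulrA FG -!mulrA IH.
elim: (index_enum _) => [|i s IH]; first by rewrite !big_nil mulr1.
by rewrite !big_cons IH mulrA -(mulrA (F i)) GF !mulrA.
Qed.

(** Choices of columns with a repetition vanish by [psi_dup]. For the others the sign comes from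
    reordering the [psi], while the entries of [F] keep their order. *)
Lemma prod_sum_psi (F : 'I_n -> 'I_n -> E) :
    (forall i j k, psi i * F j k = F j k * psi i) ->
  \prod_(k < n) \sum_j psi j * F k j = rdet F * Psi.
Proof.
move=> FP; rewrite bigA_distr_bigA /= sum_ffun_perm => [|f nf].
  rewrite mulr_suml; apply: eq_bigr => s _.
  under eq_bigr => k _ do rewrite FP.
  rewrite pvalE prod_mul_comm // psi_perm.
  rewrite mulrA; congr (_ * _); rewrite -signr_odd.
  by case: (odd _); rewrite ?mulr1 ?mul1r ?mulN1r ?mulrN1.
under eq_bigr => k _ do rewrite FP.
by rewrite prod_mul_comm // psi_dup // mulr0.
Qed.

Lemma prod_mul_anticomm (F G : 'I_n -> E) (s : seq 'I_n) :
    (forall i j, G i * F j = - (F j * G i)) ->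
  \prod_(k <- s) (F k * G k)
  = (-1) ^+ 'C(size s, 2) * (\prod_(k <- s) F k * \prod_(k <- s) G k).
Proof.
move=> FG; elim: s => [|i s IH]; first by rewrite !big_nil bin0n !mul1r.
rewrite !big_cons /= binS bin1 IH exprD.
have := anticomm_prod (u := G i) (f := F) (s := s) (fun j _ => FG i j).
move: (\prod_(k <- s) F k) (\prod_(k <- s) G k) => P Q GP.
rewrite -mulrA [G i * _]mulrA commr_sign -[_ * G i * _]mulrA [G i * (P * Q)]mulrA GP.
by rewrite -!mulrA [F i * (_ * _)]mulrA commr_sign -!mulrA [F i * (_ * _)]mulrA commr_sign
  -!mulrA.
Qed.

(** Both products alternate, so permuting the indices costs the sign twice and all n! surviving
    terms agree. The power of -1 comes from separating the [F] from the [G]. *)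
Lemma prod_sum_alternating (F G : nat -> 'I_n -> E) :
    (forall k m i j, G k i * F m j = - (F m j * G k i)) ->
    (forall k i j, F k i * F k.+1 j = - (F k j * F k.+1 i)) ->
    (forall k i j, G k i * G k.+1 j = - (G k j * G k.+1 i)) ->
  \prod_(k < n) \sum_i F k i * G k i
  = (-1) ^+ 'C(n, 2) * ((\prod_(k < n) F k k) * \prod_(k < n) G k k) *+ n`!.
Proof.
move=> FG altF altG; rewrite bigA_distr_bigA /= sum_ffun_perm => [|f nf]; last first.
  by rewrite prod_mul_anticomm // (alternating_prod_dup altF) // mul0r mulr0.
rewrite -[n`!]card_Sn -sumr_const; apply: eq_bigr => s _.
rewrite pvalE prod_mul_anticomm // /index_enum -enumT size_enum_ord; congr (_ * _).
rewrite enumT (alternating_prod_perm (F := F)) // (alternating_prod_perm (F := G)) //.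
rewrite -mulrA [\prod_(k < n) F k k * _]mulrA commr_sign -mulrA mulrA -exprD addnn -signr_odd.
by rewrite odd_double mul1r.
Qed.

End Grassmann.

Lemma regular_eq (L : pzRingType) (V : lmodType L) (c : L) (x y : V) :
  regular V c -> c *: x = c *: y -> x = y.
Proof. by move=> reg /eqP; rewrite -subr_eq0 -scalerBr => /eqP/reg/eqP; rewrite subr_eq0 => /eqP. Qed.

Lemma regularM (L : comPzRingType) (V : lmodType L) (c d : L) :
  regular V c -> regular V d -> regular V (c * d).
Proof. by move=> hc hd x; rewrite -scalerA => /hc/hd. Qed.

Lemma regularN (L : pzRingType) (V : lmodType L) (c : L) :
  regular V c -> regular V (- c).
Proof. by move=> hc x; rewrite scaleNr => /eqP; rewrite oppr_eq0 => /eqP/hc. Qed.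

Lemma anticommM (E : pzRingType) (u v c : E) :
  u * v = - (v * u) -> u * c = c * u -> u * (v * c) = - (v * c * u).
Proof. by move=> uv uc; rewrite mulrA uv mulNr -[in LHS]mulrA uc mulrA. Qed.

Lemma anticomm2M (E : pzRingType) (u v c : E) :
  u * v = - (v * u) -> u * c = - (c * u) -> u * (v * c) = v * c * u.
Proof. by move=> uv uc; rewrite mulrA uv mulNr -[in LHS]mulrA uc mulrN opprK mulrA. Qed.

Lemma anticomm_sum (E : pzRingType) (J : finType) (u : E) (f g : J -> E) :
    (forall j, u * f j = - (f j * u)) -> (forall j, u * g j = g j * u) ->
  u * (\sum_j f j * g j) = - ((\sum_j f j * g j) * u).
Proof.
move=> uf ug; rewrite mulr_sumr mulr_suml -sumrN.
by apply: eq_bigr => j _; exact: anticommM.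
Qed.

Lemma anticomm2_sum (E : pzRingType) (J : finType) (u : E) (f g : J -> E) :
    (forall j, u * f j = - (f j * u)) -> (forall j, u * g j = - (g j * u)) ->
  u * (\sum_j f j * g j) = (\sum_j f j * g j) * u.
Proof.
move=> uf ug; rewrite mulr_sumr mulr_suml.
by apply: eq_bigr => j _; exact: anticomm2M.
Qed.

(** * Contraction with anticommuting coefficients *)

Section Contraction.
Variables (E : nzRingType) (J : finType).
Implicit Types (v w : J -> E) (f g : J -> E) (F G : J -> J -> E).

(** In [lc] and [bl] the coefficients stay to the left of the entries, so that [bl_swap] can
    exchange two indices of a quadratic relation without touching the order of the entries. *)
Definition lc w f : E := \sum_j w j * f j.
Definition bl v w F : E := \sum_j \sum_l v j * w l * F j l.

Lemma lcM v w f g : (forall i j, w i * f j = f j * w i) ->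
  lc v f * lc w g = bl v w (fun j l => f j * g l).
Proof.
move=> wf; rewrite /lc mulr_suml; apply: eq_bigr => j _; rewrite mulr_sumr.
by apply: eq_bigr => l _; rewrite !mulrA -(mulrA (v j)) -wf !mulrA.
Qed.

Lemma lcM_anti v w f g : (forall i j, w i * f j = - (f j * w i)) ->
  lc v f * lc w g = - bl v w (fun j l => f j * g l).
Proof.
move=> wf; rewrite /lc mulr_suml -sumrN; apply: eq_bigr => j _.
rewrite mulr_sumr -sumrN; apply: eq_bigr => l _.
by rewrite mulrA -[v j * f j * _]mulrA -[f j * _]opprK -wf mulrN mulNr !mulrA.
Qed.

Lemma eq_bl v w F G : (forall j l, F j l = G j l) -> bl v w F = bl v w G.
Proof. by move=> FG; apply: eq_bigr => j _; apply: eq_bigr => l _; rewrite FG. Qed.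

Lemma blD v w F G : bl v w (fun j l => F j l + G j l) = bl v w F + bl v w G.
Proof.
rewrite -big_split; apply: eq_bigr => j _; rewrite -big_split.
by apply: eq_bigr => l _; rewrite mulrDr.
Qed.

Lemma blN v w F : bl v w (fun j l => - F j l) = - bl v w F.
Proof.
rewrite -sumrN; apply: eq_bigr => j _; rewrite -sumrN.
by apply: eq_bigr => l _; rewrite mulrN.
Qed.

Lemma bl_swap v w F : (forall i j, v i * w j = - (w j * v i)) ->
  bl v w F = - bl w v (fun j l => F l j).
Proof.
move=> vw; rewrite /bl exchange_big -sumrN; apply: eq_bigr => j _; rewrite -sumrN.
by apply: eq_bigr => l _; rewrite vw mulNr.
Qed.

End Contraction.

Lemma blZ (L : comNzRingType) (E : algType L) (J : finType) (v w : J -> E) F (c : L) :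
  bl v w (fun j l => c *: F j l) = c *: bl v w F.
Proof.
rewrite scaler_sumr; apply: eq_bigr => j _; rewrite scaler_sumr.
by apply: eq_bigr => l _; rewrite scalerAr.
Qed.

(** * The Yangian of gl_n *)

(* [a p] stands for a(p / h), and [U] is the set of admissible points p. *)
Section GeneralLinear.
Variables (L : comNzRingType) (E : algType L) (h : L) (n : nat).
Variables (U : L -> Prop) (a : L -> 'I_n -> 'I_n -> E).
Hypothesis Uh : forall p, U p -> U (p + h).
Hypothesis hreg : regular E h.
Hypothesis natreg : forall k, regular E k.+1%:R.
Hypothesis AA : forall p q i j k l, U p -> U q ->
  (p - q) *: (a p i j * a q k l - a q k l * a p i j)
  = h *: (a p k j * a q i l - a q k j * a p i l).

Lemma reg2 (x : E) : x + x = 0 -> x = 0.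
Proof. by move=> xx; apply: (@natreg 1); rewrite scaler_nat. Qed.

Lemma Uhk p k : U p -> U (p + k%:R * h).
Proof.
move=> Up; elim: k => [|k IH]; first by rewrite mul0r addr0.
by rewrite -natr1 mulrDl mul1r addrA; exact: Uh.
Qed.

(** At arguments p and p + h the coefficients of [AA] agree up to sign and cancel. The left side is
    symmetric in [i], [k], the right side in [j], [l]: here 1 - P/(u-v) degenerates to 1 + P. *)
Lemma AAh p i j k l : U p ->
  a p i j * a (p + h) k l + a p k j * a (p + h) i l
  = a (p + h) k l * a p i j + a (p + h) k j * a p i l.
Proof.
move=> Up; have := AA i j k l Up (Uh Up); rewrite opprD addrA subrr add0r => H.
apply: (regular_eq hreg); apply/eqP; rewrite -subr_eq0; apply/eqP.
transitivity (h *: (a p k j * a (p + h) i l - a (p + h) k j * a p i l)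
  - (- h) *: (a p i j * a (p + h) k l - a (p + h) k l * a p i j)).
  by lin_ring L E.
by rewrite H subrr.
Qed.

Lemma AAhr p i j k l : U p ->
  a (p + h) i j * a p k l - a (p + h) k j * a p i l
  = a p k l * a (p + h) i j - a p k j * a (p + h) i l.
Proof.
move=> Up; have := AA i j k l (Uh Up) Up; rewrite addrAC subrr add0r => H.
apply: (regular_eq hreg); apply/eqP; rewrite -subr_eq0; apply/eqP.
transitivity (h *: (a (p + h) i j * a p k l - a p k l * a (p + h) i j)
  - h *: (a (p + h) k j * a p i l - a p k j * a (p + h) i l)).
  by lin_ring L E.
by rewrite H subrr.
Qed.

Section RowsColumns.
Variable (w : 'I_n -> E).
Hypothesis ww : forall i j, w i * w j = - (w j * w i).
Hypothesis wa : forall i p j k, w i * a p j k = a p j k * w i.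

Definition xrow p i := lc w (a p i).
Definition ycol p j := lc w ((a p)^~ j).

(** The coefficient of [w j * w l] in the sum of the two products is symmetric in [j], [l] by [AAh].
    The sum is doubled and one half has its indices exchanged, so that it cancels term by term. *)
Lemma xrow_alt p i k : U p -> xrow p i * xrow (p + h) k = - (xrow p k * xrow (p + h) i).
Proof.
move=> Up; apply/eqP; rewrite -subr_eq0 opprK; apply/eqP.
rewrite !lcM // -blD; apply: reg2; rewrite [X in X + _]bl_swap //.
rewrite -blN -blD /bl big1 // => j _; rewrite big1 // => l _.
by rewrite !AAh // [X in - X + _]addrC addNr mulr0.
Qed.

(** Columns alternate when the argument decreases, rows when it increases; this is why [Acol] runs
    through decreasing arguments. *)
Lemma ycol_alt p j l : U p -> ycol (p + h) j * ycol p l = - (ycol (p + h) l * ycol p j).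
Proof.
move=> Up; apply/eqP; rewrite -subr_eq0 opprK; apply/eqP.
rewrite !lcM // -blD; apply: reg2; rewrite [X in X + _]bl_swap //.
rewrite -blN -blD /bl big1 // => i _; rewrite big1 // => k _.
suff -> : - (a (p + h) k j * a p i l + a (p + h) k l * a p i j)
    + (a (p + h) i j * a p k l + a (p + h) i l * a p k j) = 0 by rewrite mulr0.
transitivity ((a (p + h) i j * a p k l - a (p + h) k j * a p i l)
   + (a (p + h) i l * a p k j - a (p + h) k l * a p i j)); first by lin_ring L E.
by rewrite !AAhr //; lin_ring L E.
Qed.

End RowsColumns.

(** * The quantum determinant as a product of the forms t(p) *)

Section Determinant.
Variables (phi psi dphi dpsi : 'I_n -> E).
Hypothesis phi_phi : forall i j, phi i * phi j = - (phi j * phi i).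
Hypothesis psi_psi : forall i j, psi i * psi j = - (psi j * psi i).
Hypothesis phi_psi : forall i j, phi i * psi j = - (psi j * phi i).
Hypothesis dphi_phi : forall i j, dphi i * phi j = (i == j)%:R - phi j * dphi i.
Hypothesis dpsi_psi : forall i j, dpsi i * psi j = (i == j)%:R - psi j * dpsi i.
Hypothesis dphi_psi : forall i j, dphi i * psi j = - (psi j * dphi i).
Hypothesis dpsi_phi : forall i j, dpsi i * phi j = - (phi j * dpsi i).
Hypothesis phi_a : forall i p j k, phi i * a p j k = a p j k * phi i.
Hypothesis psi_a : forall i p j k, psi i * a p j k = a p j k * psi i.
Hypothesis dphi_a : forall i p j k, dphi i * a p j k = a p j k * dphi i.
Hypothesis dpsi_a : forall i p j k, dpsi i * a p j k = a p j k * dpsi i.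

Local Notation x := (xrow psi).
Local Notation y := (ycol phi).

Definition tt p : E := lc phi (x p).

Lemma phi_x i p k : phi i * x p k = - (x p k * phi i).
Proof. by apply: anticomm_sum. Qed.

Lemma phi_y i p k : phi i * y p k = - (y p k * phi i).
Proof. by apply: anticomm_sum. Qed.

Lemma psi_y i p k : psi i * y p k = - (y p k * psi i).
Proof. by apply: anticomm_sum => // j; rewrite -[LHS]opprK -phi_psi. Qed.

Lemma tt_y p : tt p = \sum_j y p j * psi j.
Proof.
rewrite /tt /lc; under eq_bigr => i _ do rewrite /xrow /lc mulr_sumr.
rewrite exchange_big; apply: eq_bigr => j _; rewrite /ycol /lc mulr_suml.
by apply: eq_bigr => i _; rewrite psi_a mulrA.
Qed.

Lemma phi_tt i p : phi i * tt p = tt p * phi i.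
Proof. by apply: anticomm2_sum => // k; exact: phi_x. Qed.

Lemma dphi_tt i p : dphi i * tt p = tt p * dphi i + x p i.
Proof.
have dx k : dphi i * x p k = - (x p k * dphi i) by apply: anticomm_sum.
rewrite /tt /lc mulr_sumr mulr_suml.
under eq_bigr => k _ do rewrite mulrA dphi_phi mulrBl -[_ * dphi i * _]mulrA dx mulrN opprK mulrA.
rewrite big_split addrC; congr (_ + _); rewrite (bigD1 i) //= eqxx mul1r big1 ?addr0 // => k.
by rewrite eq_sym => /negPf ->; rewrite mul0r.
Qed.

Lemma dpsi_tt i p : dpsi i * tt p = tt p * dpsi i - y p i.
Proof.
have dy k : dpsi i * y p k = - (y p k * dpsi i) by apply: anticomm_sum.
rewrite tt_y mulr_sumr mulr_suml.
under eq_bigr => k _ do rewrite mulrA dy mulNr -mulrA dpsi_psi mulrBr opprB mulrA.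
rewrite big_split /= sumrN; congr (_ - _).
rewrite (bigD1 i) //= eqxx mulr1 big1 ?addr0 // => k.
by rewrite eq_sym => /negPf ->; rewrite mulr0.
Qed.

Lemma x_tt p k : U p -> x p k * tt (p + h) = tt p * x (p + h) k.
Proof.
move=> Up; rewrite /tt /lc mulr_sumr mulr_suml; apply: eq_bigr => i _.
by rewrite mulrA -[x p k * _]opprK -phi_x mulNr -mulrA xrow_alt // mulrN opprK mulrA.
Qed.

Lemma y_tt p l : U p -> y (p + h) l * tt p = tt (p + h) * y p l.
Proof.
move=> Up; rewrite !tt_y mulr_sumr mulr_suml; apply: eq_bigr => j _.
by rewrite mulrA ycol_alt // -[RHS]mulrA psi_y mulrN mulrA mulNr.
Qed.

Lemma tt_bl p q : tt p * tt q
  = - bl phi phi (fun i k => bl psi psi (fun j l => a p i j * a q k l)).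
Proof.
rewrite /tt lcM_anti => [|i k]; last exact: phi_x.
by congr (- _); apply: eq_bl => i k; rewrite lcM.
Qed.

(** Contracting [AA] with [phi] in the rows and [psi] in the columns turns its right side into - h
    times the commutator on the left, so that p - q + h annihilates the commutator. *)
Lemma ttC p q : U p -> U q -> regular E (p - q + h) -> tt p * tt q = tt q * tt p.
Proof.
move=> Up Uq reg; rewrite !tt_bl; congr (- _).
pose quad F := bl phi phi (fun i k => bl psi psi (F i k)).
pose F1 i k j l := a p i j * a q k l; pose F2 i k j l := a q k l * a p i j.
have -> : bl phi phi (fun i k => bl psi psi (fun j l => a q i j * a p k l)) = quad F2.
  rewrite bl_swap // -blN; apply: eq_bl => i k.
  by rewrite bl_swap // opprK.
have S1 : quad (fun i k j l => a p k j * a q i l) = - quad F1 by rewrite /quad bl_swap.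
have S2 : quad (fun i k j l => a q k j * a p i l) = - quad F2.
  by rewrite /quad -blN; apply: eq_bl => i k; rewrite bl_swap.
have H : (p - q) *: (quad F1 - quad F2)
    = h *: (quad (fun i k j l => a p k j * a q i l) - quad (fun i k j l => a q k j * a p i l)).
  rewrite /quad -!blN -!blD -!blZ; apply: eq_bl => i k.
  by rewrite -!blN -!blD -!blZ; apply: eq_bl => j l; exact: AA.
rewrite S1 S2 in H; rewrite -[X in X = _]/(quad F1); apply/eqP; rewrite -subr_eq0; apply/eqP; apply: reg.
transitivity ((p - q) *: (quad F1 - quad F2) - h *: (- quad F1 - - quad F2)).
  by lin_ring L E.
by rewrite H subrr.
Qed.

Definition tprod p m : E := \prod_(k < m) tt (p + k%:R * h).

Lemma phi_tprod i p m : phi i * tprod p m = tprod p m * phi i.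
Proof.
rewrite /tprod; elim/big_ind: _ => [|u v hu hv|k _]; first by rewrite mulr1 mul1r.
  by rewrite mulrA hu -!mulrA hv.
exact: phi_tt.
Qed.

Lemma tprodS p m : tprod p m.+1 = tprod p m * tt (p + m%:R * h).
Proof. by rewrite /tprod big_ord_recr. Qed.

Lemma tt_tprod p m k : U p -> (m <= k)%N ->
  tt (p + k%:R * h) * tprod p m = tprod p m * tt (p + k%:R * h).
Proof.
move=> Up; elim: m => [|m IH] mk; first by rewrite /tprod big_ord0 mulr1 mul1r.
rewrite tprodS mulrA IH 1?ltnW // -mulrA -[RHS]mulrA; congr (_ * _).
apply: ttC; try exact: Uhk.
(* The coefficient to cancel is a positive multiple of h. *)
have -> : p + k%:R * h - (p + m%:R * h) + h = (k - m).+1%:R * h.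
  by rewrite -natr1 natrB 1?ltnW //; ring.
exact: regularM.
Qed.

Lemma tprodSl p m : U p -> tprod p m.+1 = tt (p + m%:R * h) * tprod p m.
Proof. by move=> Up; rewrite tprodS tt_tprod. Qed.

Lemma tprod_x_tt p m k : U p ->
  tprod p m * x (p + m%:R * h) k * tt (p + m.+1%:R * h)
  = tprod p m.+1 * x (p + m.+1%:R * h) k.
Proof.
move=> Up; have -> : p + m.+1%:R * h = p + m%:R * h + h by rewrite -natr1; ring.
by rewrite tprodS -!mulrA x_tt //; exact: Uhk.
Qed.

(** [E1] is [AA] contracted with the column variables; applying the row variables from the left
    gives [E2], which is then rearranged. *)
Lemma tt_xrow v q k : U v -> U q ->
  h *: (tt v * x q k) = (v - q + h) *: (tt q * x v k) - (v - q) *: (x v k * tt q).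
Proof.
move=> Uv Uq.
have E1 i : (v - q) *: (x v k * x q i + x q i * x v k)
    = h *: (x v i * x q k - x q i * x v k).
  rewrite !lcM // [X in _ *: (_ + X) = _]bl_swap // -!blN -!blD -!blZ.
  by apply: eq_bl => j l; exact: AA.
have E2 : (v - q) *: (- (x v k * tt q) + tt q * x v k)
    = h *: (tt v * x q k - tt q * x v k).
  transitivity (\sum_i phi i * ((v - q) *: (x v k * x q i + x q i * x v k))).
    rewrite /tt /lc mulr_sumr -sumrN mulr_suml -big_split scaler_sumr.
    apply: eq_bigr => i _; rewrite -scalerAr mulrDr; congr (_ *: (_ + _)).
      by rewrite [RHS]mulrA [phi i * x v k]phi_x mulNr mulrA.
    by rewrite mulrA.
  rewrite /tt /lc !mulr_suml -sumrB scaler_sumr; apply: eq_bigr => i _.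
  by rewrite E1 -scalerAr mulrBr !mulrA.
transitivity (h *: (tt v * x q k - tt q * x v k) + h *: (tt q * x v k)); first by lin_ring L E.
by rewrite -E2; lin_ring L E.
Qed.

Lemma a_tt v q k l : U v -> U q ->
  (v - q) *: (a v k l * tt q - tt q * a v k l) = h *: (y v l * x q k - y q l * x v k).
Proof.
move=> Uv Uq.
have E1 : tt q = bl phi psi (a q).
  rewrite /tt /bl /lc; apply: eq_bigr => i _; rewrite /xrow /lc mulr_sumr.
  by apply: eq_bigr => j _; rewrite mulrA.
have E2 r s : y r l * x s k = bl phi psi (fun i j => a r i l * a s k j) by rewrite lcM.
have -> : a v k l * tt q - tt q * a v k l
    = bl phi psi (fun i j => a v k l * a q i j - a q i j * a v k l).
  rewrite E1 blD blN /bl mulr_sumr mulr_suml; congr (_ - _); apply: eq_bigr => i _.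
    rewrite mulr_sumr; apply: eq_bigr => j _.
    by rewrite !mulrA -phi_a -[_ * a v k l * psi j]mulrA -psi_a !mulrA.
  by rewrite mulr_suml; apply: eq_bigr => j _; rewrite mulrA.
rewrite !E2 -blN -blD -!blZ; apply: eq_bl => i j; rewrite AA //.
Qed.

(* Quantum minors of size m + 1 against one generator; for m + 1 = n the two
   terms on the right are multiples of [a v k l] times the determinant. *)
Lemma a_tprod p m v k l : U p -> U v ->
    (forall s, (s < m)%N -> regular E (v - p - s%:R * h)) ->
  (v - p - m%:R * h) *: (a v k l * tprod p m.+1 - tprod p m.+1 * a v k l)
  = (h * m.+1%:R) *: (y v l * (tprod p m * x (p + m%:R * h) k)
                     - y (p + m%:R * h) l * tprod p m * x v k).
Proof.
move=> Up; elim: m v k l => [|m IH] v k l Uv reg.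
  rewrite /tprod big_ord_recl !big_ord0 mul0r addr0 subr0 !mulr1 mul1r.
  by rewrite a_tt.
(* The induction hypothesis, contracted over its row index with [phi], tells how a column form
   passes the product. *)
have C w : U w -> (forall s, (s < m)%N -> regular E (w - p - s%:R * h)) ->
    (w - p - m%:R * h) *: (tprod p m.+1 * y w l)
    = (w - p - m%:R * h + h * m.+1%:R) *: (y w l * tprod p m.+1)
      - (h * m.+1%:R) *: (y (p + m%:R * h) l * tprod p m * tt w).
  move=> Uw regw.
  have E1 : \sum_i phi i * (a w i l * tprod p m.+1 - tprod p m.+1 * a w i l)
      = y w l * tprod p m.+1 - tprod p m.+1 * y w l.
    rewrite /ycol /lc mulr_suml mulr_sumr -sumrB; apply: eq_bigr => i _.
    by rewrite mulrBr !mulrA phi_tprod.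
  have E2 : \sum_i phi i * (y w l * (tprod p m * x (p + m%:R * h) i)
      - y (p + m%:R * h) l * tprod p m * x w i)
      = - (y w l * tprod p m.+1) + y (p + m%:R * h) l * tprod p m * tt w.
    rewrite tprodS /tt /lc !mulr_sumr -sumrN -big_split; apply: eq_bigr => i _ /=.
    rewrite mulrBr !mulrA !phi_y !mulNr -[_ * phi i * tprod p m]mulrA phi_tprod opprK.
    by rewrite -[_ * phi i * tprod p m]mulrA phi_tprod !mulrA.
  have H : (w - p - m%:R * h) *: (y w l * tprod p m.+1 - tprod p m.+1 * y w l)
      = (h * m.+1%:R) *: (- (y w l * tprod p m.+1) + y (p + m%:R * h) l * tprod p m * tt w).
    rewrite -E1 -E2 !scaler_sumr; apply: eq_bigr => i _.
    by rewrite !scalerAr IH.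
  apply/eqP; rewrite -subr_eq0; apply/eqP.
  transitivity ((h * m.+1%:R) *: (- (y w l * tprod p m.+1) + y (p + m%:R * h) l * tprod p m * tt w)
    - (w - p - m%:R * h) *: (y w l * tprod p m.+1 - tprod p m.+1 * y w l)).
    by lin_ring L E.
  by rewrite H subrr.
pose u := p + m.+1%:R * h.
have Uu : U u by exact: Uhk.
(* At the point [u] of the next factor the coefficient in [C] is h, which cancels. *)
have Cu : tprod p m.+1 * y u l = m.+2%:R *: (y u l * tprod p m.+1)
    - m.+1%:R *: (y (p + m%:R * h) l * tprod p m * tt u).
  apply: (regular_eq hreg).
  have regu s : (s < m)%N -> regular E (u - p - s%:R * h).
    move=> sm; have -> : u - p - s%:R * h = (m - s).+1%:R * h.
      by rewrite /u -!natr1 natrB 1?ltnW //; ring.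
    exact: regularM.
  have := C u Uu regu; have -> : u - p - m%:R * h = h by rewrite /u -natr1; ring.
  by move=> ->; rewrite -[m.+2%:R]natr1; lin_ring L E.
have Kt := tprod_x_tt m k Up.
have Cv := C v Uv.
have {}IH := IH v k l Uv.
have Dv := a_tt k l Uv Uu.
have Rv := tt_xrow k Uv Uu.
rewrite tprodS -/u; rewrite -/u in Kt.
have reg1 : regular E (v - p - m%:R * h) by exact: reg.
have regm s : (s < m)%N -> regular E (v - p - s%:R * h) by move=> sm; apply: reg; exact: ltnW.
move: (Cv regm) (IH regm) => {}Cv {}IH; apply: (regular_eq reg1).
have gE : v - p - m%:R * h = v - u + h by rewrite /u -natr1; ring.
have gE' : v - p - m.+1%:R * h = v - u by rewrite /u; ring.
rewrite gE gE' in Cv IH *; move: Kt Cu Cv IH Dv Rv.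
set X := tprod p m.+1; set t := tt u; set K := tprod p m * x _ k.
set H := y (p + m%:R * h) l * tprod p m; set av := a v k l; set yv := y v l.
set yu := y u l; set xv := x v k; set xu := x u k; set tv := tt v; set g := v - u.
move=> Kt Cu Cv IH Dv Rv; clearbody X t K H av yv yu xv xu tv g.
(* Leibniz rule for the commutator with [X * t]; the induction hypothesis comes with the factor g +
   h and [a_tt] with g. *)
transitivity (g *: ((g + h) *: (av * X - X * av) * t)
  + (g + h) *: (X * (g *: (av * t - t * av)))).
  rewrite -?(scalerAl, scalerAr) ?(mulrBl, mulrBr) !mulrA; lin_ring L E.
rewrite IH Dv.
transitivity ((g * (h * m.+1%:R)) *: (yv * (K * t)) - (g * (h * m.+1%:R)) *: (H * xv * t)
  + h *: ((g + h) *: (X * yv) * xu) - (h * (g + h)) *: (X * yu * xv)).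
  rewrite -?(scalerAl, scalerAr) ?(mulrBl, mulrBr) !mulrA; lin_ring L E.
rewrite Kt Cv Cu.
transitivity ((g * (h * m.+1%:R)) *: (yv * (X * xu)) - (g * (h * m.+1%:R)) *: (H * xv * t)
  + (h * (g + h + h * m.+1%:R)) *: (yv * X * xu) - (h * m.+1%:R) *: (H * (h *: (tv * xu)))
  - (h * (g + h) * m.+2%:R) *: (yu * X * xv) + (h * (g + h) * m.+1%:R) *: (H * t * xv)).
  rewrite -?(scalerAl, scalerAr) ?(mulrBl, mulrBr) -?(scalerAl, scalerAr) !mulrA; lin_ring L E.
rewrite Rv -?(scalerAl, scalerAr) ?(mulrBl, mulrBr) -?(scalerAl, scalerAr) !mulrA.
rewrite -[m.+2%:R]natr1; lin_ring L E.
Qed.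

Local Notation Phi := (\prod_(k < n) phi k).
Local Notation Psi := (\prod_(k < n) psi k).

(** By [x_tt] every term of the Leibniz rule equals the one in which the last factor is
    differentiated. *)
Lemma dphi_tprod k p m : U p ->
  dphi k * tprod p m.+1
  = tprod p m.+1 * dphi k + m.+1%:R *: (tprod p m * x (p + m%:R * h) k).
Proof.
move=> Up; elim: m => [|m IH].
  by rewrite /tprod big_ord_recl !big_ord0 mulr1 mul1r dphi_tt scale1r.
rewrite tprodS mulrA IH mulrDl -mulrA dphi_tt -scalerAl tprod_x_tt // mulrDr mulrA.
by rewrite -[m.+2%:R]natr1; lin_ring L E.
Qed.

Lemma dpsi_tprod l p m : U p ->
  dpsi l * tprod p m.+1
  = tprod p m.+1 * dpsi l - m.+1%:R *: (y (p + m%:R * h) l * tprod p m).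
Proof.
move=> Up; elim: m => [|m IH].
  by rewrite /tprod big_ord_recl !big_ord0 !mulr1 dpsi_tt scale1r.
have yt : tt (p + m.+1%:R * h) * y (p + m%:R * h) l = y (p + m.+1%:R * h) l * tt (p + m%:R * h).
  have -> : p + m.+1%:R * h = p + m%:R * h + h by rewrite -natr1; ring.
  by rewrite -y_tt //; exact: Uhk.
rewrite tprodSl // mulrA dpsi_tt mulrBl -[tt _ * dpsi l * _]mulrA IH mulrBr -scalerAr !mulrA yt.
rewrite -[y _ _ * tt _ * tprod _ _]mulrA -!tprodSl //.
by rewrite -[m.+2%:R]natr1; lin_ring L E.
Qed.

Hypothesis Uhm : forall p, U p -> U (p - h).

(** If p stands for the argument v, [Arow p] is A(v), with arguments v, ..., v + n - 1. [Acol]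
    starts from the largest argument and goes down, so that the two agree at base points differing
    by n - 1 shifts. *)
Definition Arow p := rdet (fun k j => a (p + k%:R * h) k j).
Definition Acol w := rdet (fun k i => a (w - k%:R * h) i k).

Lemma Uhkm p k : U p -> U (p - k%:R * h).
Proof.
move=> Up; elim: k => [|k IH]; first by rewrite mul0r subr0.
by rewrite -natr1 mulrDl mul1r opprD addrA; exact: Uhm.
Qed.

Lemma prod_xrow p : \prod_(k < n) x (p + k%:R * h) k = Arow p * Psi.
Proof. exact: (prod_sum_psi reg2). Qed.

Lemma prod_ycol w : \prod_(k < n) y (w - k%:R * h) k = Acol w * Phi.
Proof. exact: (prod_sum_psi reg2). Qed.

Lemma tprod_Arow p : U p ->
  tprod p n = (-1) ^+ 'C(n, 2) * (Phi * (Arow p * Psi)) *+ n`!.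
Proof.
move=> Up; rewrite -prod_xrow.
apply: (prod_sum_alternating reg2 (F := fun=> phi) (G := fun k => x (p + k%:R * h))) => //.
  by move=> k m i j; rewrite phi_x opprK.
move=> k i j; rewrite -natr1 mulrDl mul1r addrA; apply: xrow_alt => //; exact: Uhk.
Qed.

(** The factors commute by [tt_tprod], and the decreasing order is the one in which the column forms
    alternate. *)
Lemma tprod_down p m : U p ->
  tprod p m = \prod_(k < m) tt (p + m.-1%:R * h - k%:R * h).
Proof.
move=> Up; elim: m => [|m IH]; first by rewrite /tprod !big_ord0.
rewrite tprodSl // IH big_ord_recl mul0r subr0; congr (_ * _).
case: m {IH} => [|m]; first by rewrite !big_ord0.
by apply: eq_bigr => k _; congr tt; rewrite /= /bump leq0n -!natr1 ?natrD; ring.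
Qed.

Lemma tprod_Acol p : U p ->
  tprod p n = (-1) ^+ 'C(n, 2) * (Acol (p + n.-1%:R * h) * Phi * Psi) *+ n`!.
Proof.
move=> Up; rewrite -prod_ycol tprod_down //.
under eq_bigr => k _ do rewrite tt_y.
apply: (prod_sum_alternating reg2 (F := fun k => y (p + n.-1%:R * h - k%:R * h))
   (G := fun=> psi)) => //.
  by move=> k m i j; rewrite psi_y.
move=> k i j; set q := p + _ - _.
have -> : p + n.-1%:R * h - k.+1%:R * h = q - h by rewrite /q -natr1; ring.
rewrite -{1 3}[q](subrK h); apply: ycol_alt => //; apply: Uhm; apply: Uhkm; exact: Uhk.
Qed.

(** [Psi] is stripped off [z * Phi] first, where [dpsi] passes [Phi] with the sign (-1)^n; then
    [Phi] is stripped off [z]. Hence the two values of [b]. *)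
Lemma PhiPsi_cancel (z : E) :
    (forall i, dphi i * z = z * dphi i) -> (forall i, dpsi i * z = z * dpsi i) ->
  z * (Phi * Psi) = 0 -> z = 0.
Proof.
move=> dphi_z dpsi_z; rewrite mulrA => zP; apply: (Psi_cancel (b := 0) dphi_phi).
  by move=> i; rewrite mul1r.
apply: (Psi_cancel (b := n) dpsi_psi) => // i; rewrite mulrA dpsi_z -[z * dpsi i * _]mulrA.
have -> : dpsi i * Phi = (-1) ^+ n * (Phi * dpsi i).
  rewrite (anticomm_prod (fun j _ => dpsi_phi i j)).
  by rewrite /index_enum -enumT size_enum_ord.
by rewrite -!mulrA [z * (_ * _)]mulrA commr_sign -!mulrA.
Qed.

Hypothesis n_gt0 : (0 < n)%N.

Lemma phi_tprodn p i : U p -> phi i * tprod p n = 0.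
Proof.
move=> Up; rewrite tprod_Arow // mulrnAr [phi i * _]mulrA commr_sign -mulrA.
by rewrite [phi i * (_ * _)]mulrA (psi_Psi reg2 phi_phi) mul0r mulr0 mul0rn.
Qed.

Lemma tprodn_psi p i : U p -> tprod p n * psi i = 0.
Proof.
by move=> Up; rewrite tprod_Arow // mulrnAl -!mulrA (Psi_psi reg2 psi_psi) !mulr0 mul0rn.
Qed.

Lemma a_tprodn p v k l : U p -> U v ->
    (forall s, regular E (v - p - s%:R * h)) ->
  a v k l * tprod p n = tprod p n * a v k l.
Proof.
move=> Up Uv reg; have nE : n.-1.+1 = n by rewrite prednK.
have := a_tprod k l Up Uv (fun s (_ : (s < n.-1)%N) => reg s).
have := dphi_tprod k n.-1 Up; have := dpsi_tprod l n.-1 Up.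
rewrite !nE; set X := tprod p n; set K := tprod p _ * x _ k.
set H := y _ l * tprod p _; move=> dX1 dX2.
(* The commutator of [dphi k] with [X] is n [K]. Since [X] contains all the [phi], multiplying it by
   [phi i] leaves only the delta term of the Clifford relation. *)
have phiK i : phi i * (n%:R *: K) = (i == k)%:R * X.
  have -> : n%:R *: K = dphi k * X - X * dphi k by rewrite dX2 addrAC subrr add0r.
  rewrite mulrBr !mulrA phi_tprodn // mul0r subr0.
  have -> : phi i * dphi k = (i == k)%:R - dphi k * phi i.
    by rewrite dphi_phi [k == i]eq_sym opprB addrC subrK.
  by rewrite mulrBl -[_ * phi i * _]mulrA phi_tprodn // mulr0 subr0.
have psiH j : n%:R *: H * psi j = X * (j == l)%:R.
  have -> : n%:R *: H = X * dpsi l - dpsi l * X by rewrite dX1 opprB addrC subrK.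
  rewrite mulrBl -!mulrA tprodn_psi // mulr0 subr0 dpsi_psi mulrBr mulrA tprodn_psi //.
  by rewrite mul0r subr0 eq_sym.
have E1 : n%:R *: (y v l * K) = a v k l * X.
  rewrite scalerAr /ycol /lc mulr_suml (bigD1 k) //= big1 ?addr0 => [|i /negPf ik];
    rewrite phi_a -mulrA phiK ?eqxx ?mul1r // ik mul0r mulr0 //.
have E2 : n%:R *: (H * x v k) = X * a v k l.
  rewrite scalerAl /xrow /lc mulr_sumr (bigD1 l) //= big1 ?addr0 => [|j /negPf jl];
    rewrite mulrA psiH ?eqxx ?mulr1 // jl mulr0 mul0r //.
(* The right side of [a_tprod] has become h times the commutator itself; moved to the left it
   changes the coefficient to v - p - n h. *)
rewrite -scalerA [n%:R *: _]scalerBr E1 E2 => E3; apply/eqP; rewrite -subr_eq0; apply/eqP.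
apply: (reg n); transitivity ((v - p - n.-1%:R * h) *: (a v k l * X - X * a v k l)
   - h *: (a v k l * X - X * a v k l)); last by rewrite E3 subrr.
have -> : v - p - n%:R * h = v - p - n.-1%:R * h - h by rewrite -[in LHS]nE -natr1; ring.
by lin_ring L E.
Qed.

Lemma fact_regular : regular E n`!%:R.
Proof. by case: n`! (fact_gt0 n) => // m _; exact: natreg. Qed.

Lemma Arow_comm (u : E) p :
    (forall i j k, u * a (p + i%:R * h) j k = a (p + i%:R * h) j k * u) ->
  u * Arow p = Arow p * u.
Proof. by move=> hu; exact: rdet_comm. Qed.

Lemma tprodE p : U p ->
  tprod p n = (-1) ^+ 'C(n, 2) * (Arow p * (Phi * Psi) *+ n`!).
Proof.
move=> Up; rewrite tprod_Arow // -mulrnAr [Phi * _]mulrA.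
suff -> : Phi * Arow p = Arow p * Phi by rewrite -!mulrA.
elim/big_ind: _ => [|u w hu hw|i _]; first by rewrite mulr1 mul1r.
  by rewrite -mulrA hw mulrA hu mulrA.
exact: Arow_comm.
Qed.

Lemma tprod_cancel (z : E) :
    (forall i, dphi i * z = z * dphi i) -> (forall i, dpsi i * z = z * dpsi i) ->
  (-1) ^+ 'C(n, 2) * (z * (Phi * Psi) *+ n`!) = 0 -> z = 0.
Proof.
move=> ? ? /(congr1 ( *%R ((-1) ^+ 'C(n, 2)))); rewrite mulr0 signrMK -scaler_nat.
by move/fact_regular; exact: PhiPsi_cancel.
Qed.

Lemma a_Arow p v k l : U p -> U v ->
    (forall s, regular E (v - p - s%:R * h)) ->
  a v k l * Arow p = Arow p * a v k l.
Proof.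
move=> Up Uv /(a_tprodn k l Up Uv); rewrite tprodE // => H.
apply/eqP; rewrite -subr_eq0; apply/eqP; apply: tprod_cancel.
- by move=> i; apply: commrB; apply: commrM; rewrite /GRing.comm ?dphi_a ?Arow_comm.
- by move=> i; apply: commrB; apply: commrM; rewrite /GRing.comm ?dpsi_a ?Arow_comm.
have aPP : Phi * Psi * a v k l = a v k l * (Phi * Psi).
  have aP (w : 'I_n -> E) : (forall i, w i * a v k l = a v k l * w i) ->
      \prod_(i < n) w i * a v k l = a v k l * \prod_(i < n) w i.
    move=> wa; elim/big_ind: _ => [|u w' hu hw|i _]; rewrite ?mulr1 ?mul1r //.
    by rewrite -mulrA hw mulrA hu -mulrA.
  by rewrite -mulrA aP // mulrA aP // -mulrA.
move/eqP: H; rewrite -subr_eq0 => /eqP <-.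
rewrite [a v k l * ((-1) ^+ _ * _)]mulrA commr_sign -[_ * a v k l * (_ *+ _)]mulrA.
rewrite -[_ * a v k l]mulrA -mulrBr.
by congr (_ * _); rewrite mulrnAr mulrnAl -mulrnBl mulrBl -[Arow p * (_ * _) * _]mulrA aPP !mulrA.
Qed.

(** Both are, up to the same factor, the coefficient of the top form in [tprod p n]. *)
Lemma Acol_Arow p : U p -> Acol (p + n.-1%:R * h) = Arow p.
Proof.
move=> Up; have := tprodE Up; rewrite tprod_Acol // -mulrnAr -mulrA => H.
apply/eqP; rewrite -subr_eq0; apply/eqP; apply: tprod_cancel.
- by move=> i; rewrite mulrBr mulrBl; congr (_ - _); apply: rdet_comm.
- by move=> i; rewrite mulrBr mulrBl; congr (_ - _); apply: rdet_comm.
by rewrite mulrBl mulrnBl mulrBr H subrr.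
Qed.

End Determinant.
End GeneralLinear.

(** * Odd generators *)

Section TwoCopies.
Variables (n : nat) (E : nzRingType) (th th' dth dth' : 'I_n -> E).
Hypothesis dth_th : forall i j, dth i * th j = (i == j)%:R - th j * dth i.
Hypothesis dth'_th' : forall i j, dth' i * th' j = (i == j)%:R - th' j * dth' i.
Hypothesis dth'_th : forall i j, dth' i * th j = - (th j * dth' i).

(** Satisfied by the image of the original algebra in its extension. *)
Definition inert (z : E) : Prop :=
  forall i, [/\ th i * z = z * th i, th' i * z = z * th' i,
               dth i * z = z * dth i & dth' i * z = z * dth' i].

Lemma inertB u v : inert u -> inert v -> inert (u - v).
Proof.
move=> hu hv i; have [u1 u2 u3 u4] := hu i; have [v1 v2 v3 v4] := hv i.
by split; apply: commrB.
Qed.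

Lemma inertM u v : inert u -> inert v -> inert (u * v).
Proof.
move=> hu hv i; have [u1 u2 u3 u4] := hu i; have [v1 v2 v3 v4] := hv i.
by split; apply: commrM.
Qed.

Lemma inert_rdet (F : 'I_n -> 'I_n -> E) : (forall i j, inert (F i j)) -> inert (rdet F).
Proof. by move=> hF i; split; apply: rdet_comm => j k; case: (hF j k i). Qed.

Local Notation Th := (\prod_(k < n) th k).
Local Notation Th' := (\prod_(k < n) th' k).

Lemma inert_prod z : inert z -> z * Th = Th * z /\ z * Th' = Th' * z.
Proof.
move=> hz; split; elim/big_ind: _ => [|u w hu hw|i _]; rewrite ?mulr1 ?mul1r //;
  by [rewrite mulrA hu -!mulrA hw | case: (hz i)].
Qed.

(** Stripping [Th'] and then [Th] brings the commutation down from the forms to the determinants;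
    the open signs occur on both sides and cancel. *)
Lemma two_copies A A' g Z Z' : inert A -> inert A' -> inert g ->
    Z = A * Th \/ Z = - (A * Th) -> Z' = A' * Th' \/ Z' = - (A' * Th') ->
  Z * Z' * g = g * (Z * Z') -> A * A' * g = g * (A * A').
Proof.
move=> hA hA' hg hZ hZ' H.
have {H hZ hZ'} H : A * Th * (A' * Th') * g = g * (A * Th * (A' * Th')).
  case: hZ hZ' H => [->|->] [->|->]; rewrite ?(mulrN, mulNr) ?opprK //;
    by move=> /oppr_inj.
apply/eqP; rewrite -subr_eq0; apply/eqP.
apply: (Psi_cancel (b := 0) dth_th).
  move=> i; rewrite mul1r.
  by have [] := inertB (inertM (inertM hA hA') hg) (inertM hg (inertM hA hA')) i.
apply: (Psi_cancel (b := n) dth'_th') => [i|].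
  have [_ _ _ h4] := inertB (inertM (inertM hA hA') hg) (inertM hg (inertM hA hA')) i.
  rewrite mulrA h4 -[_ * dth' i * _]mulrA.
  rewrite (anticomm_prod (fun j _ => dth'_th i j)) /index_enum -enumT size_enum_ord.
  by rewrite [_ * ((-1) ^+ _ * _)]mulrA commr_sign -!mulrA.
have [_ gT'] := inert_prod hg; have [gT _] := inert_prod hg; have [A'T _] := inert_prod hA'.
have E1 : A * A' * g * Th * Th' = A * Th * (A' * Th') * g.
  rewrite -!mulrA; congr (_ * _).
  rewrite [g * (Th * _)]mulrA gT -mulrA gT' [A' * (Th * _)]mulrA A'T.
  by rewrite -!mulrA.
have E2 : g * (A * A') * Th * Th' = g * (A * Th * (A' * Th')).
  by rewrite -!mulrA; do 2!congr (_ * _); rewrite !mulrA A'T.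
by rewrite !mulrBl E1 E2 H subrr.
Qed.

End TwoCopies.

Section Centrality.
Variables (L : comNzRingType) (E : algType L) (h : L) (n : nat).
Variables (U : L -> Prop) (a : L -> 'I_n -> 'I_n -> E).
Hypothesis Uh : forall p, U p -> U (p + h).
Hypothesis Uhm : forall p, U p -> U (p - h).
Hypothesis UN : forall p, U p -> U (- p).
Hypothesis hreg : regular E h.
Hypothesis natreg : forall k, regular E k.+1%:R.
Hypothesis AA : forall p q i j k l, U p -> U q ->
  (p - q) *: (a p i j * a q k l - a q k l * a p i j)
  = h *: (a p k j * a q i l - a q k j * a p i l).
Variables (th th' dth dth' : 'I_n -> E).
Hypothesis th_th : forall i j, th i * th j = - (th j * th i).
Hypothesis th'_th' : forall i j, th' i * th' j = - (th' j * th' i).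
Hypothesis dth_th : forall i j, dth i * th j = (i == j)%:R - th j * dth i.
Hypothesis dth'_th' : forall i j, dth' i * th' j = (i == j)%:R - th' j * dth' i.
Hypothesis dth'_th : forall i j, dth' i * th j = - (th j * dth' i).
Local Notation inert := (inert th th' dth dth').
Hypothesis inert_a : forall p i j, inert (a p i j).

Local Notation dup0 := (alternating_dup (reg2 natreg)).

Lemma inert_th z i : inert z -> th i * z = z * th i.
Proof. by move=> /(_ i)[]. Qed.

Lemma inert_th' z i : inert z -> th' i * z = z * th' i.
Proof. by move=> /(_ i)[]. Qed.

Lemma th_a i p j k : th i * a p j k = a p j k * th i.
Proof. exact: inert_th. Qed.

Lemma th'_a i p j k : th' i * a p j k = a p j k * th' i.
Proof. exact: inert_th'. Qed.

Lemma inert_Arow p : inert (Arow h a p).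
Proof. by apply: inert_rdet. Qed.

Lemma rem_enum (k : 'I_n) :
  [/\ perm_eq (k :: rem k (enum 'I_n)) (enum 'I_n), uniq (k :: rem k (enum 'I_n)),
     size (rem k (enum 'I_n)) = n.-1 & forall r, r != k -> r \in rem k (enum 'I_n)].
Proof.
have prest : perm_eq (enum 'I_n) (k :: rem k (enum 'I_n)) by apply: perm_to_rem; rewrite mem_enum.
split; first by rewrite perm_sym.
- by rewrite -(perm_uniq prest) enum_uniq.
- by move/(congr1 predn): (perm_size prest); rewrite size_enum_ord.
by move=> r rk; have := perm_mem prest r; rewrite mem_enum in_cons (negPf rk) /= => <-.
Qed.

Lemma sprod_commute (T : eqType) (y : nat -> T -> E) (g : E) m s :
  (forall j, {in s, forall i, y j i * g = g * y j i}) -> sprod y m s * g = g * sprod y m s.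
Proof.
elim: s m => [|i s IH] m yg /=; first by rewrite mulr1 mul1r.
rewrite -mulrA IH => [|j r rs]; last by rewrite yg // inE rs orbT.
by rewrite mulrA yg ?mem_head // mulrA.
Qed.

(** * An element that moves a single row *)

Section OddRows.
Variables (c : L -> 'I_n -> 'I_n -> E) (g : E) (k : 'I_n).
Hypothesis inert_c : forall p i j, inert (c p i j).
Hypothesis inert_g : inert g.
Hypothesis a_g : forall p i j,
  a p i j * g - g * a p i j = - ((i == k)%:R * c p k j *+ 2).
Hypothesis junction : forall p j l, U p ->
  \sum_r (a p r j * c (- p) r l + c p r j * a (- p) r l) = 0.

Local Notation x := (xrow a th).
Local Notation x' := (xrow a th').

Lemma lc_g (t : 'I_n -> E) p i : (forall j, t j * g = g * t j) ->
  xrow a t p i * g - g * xrow a t p i = - ((i == k)%:R * lc t (c p k) *+ 2).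
Proof.
move=> tg; transitivity (\sum_j t j * (a p i j * g - g * a p i j)).
  rewrite /xrow /lc mulr_suml [g * _]mulr_sumr -sumrB; apply: eq_bigr => j _.
  by rewrite mulrBr !mulrA tg.
rewrite /lc mulr_sumr -sumrMnl -sumrN; apply: eq_bigr => j _; rewrite a_g mulrN mulrnAr.
by case: (i == k); rewrite ?mul1r // !mul0r !mulr0.
Qed.

Variable u : L.
Hypothesis Uu : U u.
Local Notation w := (u + n.-1%:R * h).

Let F s := x (u + s%:R * h).
Let F' s := x' (- w + s%:R * h).

Lemma F_alt m : alternating (sprod F m).
Proof.
apply: sprod_alternating => s i j; rewrite /F -natr1 mulrDl mul1r addrA.
exact: (xrow_alt Uh hreg natreg AA th_th th_a _ _ (Uhk Uh s Uu)).
Qed.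

Lemma F'_alt m : alternating (sprod F' m).
Proof.
apply: sprod_alternating => s i j; rewrite /F' -natr1 mulrDl mul1r addrA.
exact: (xrow_alt Uh hreg natreg AA th'_th' th'_a _ _ (Uhk Uh s (UN (Uhk Uh _ Uu)))).
Qed.

(** [w] is the last argument of the first determinant and [- w] the first argument of the second.
    [junction] is a sum over all rows; between the remaining factors [R] and [R'] only row [k]
    survives, because any other row would be repeated. *)
Lemma Arow_oddrow : Arow h a u * Arow h a (- w) * g = g * (Arow h a u * Arow h a (- w)).
Proof.
have Uw : U w by exact: Uhk.
have [prest urest srest Krest] := rem_enum k; set rest := rem k _ in prest urest srest Krest.
have krest i : i \in rest -> i != k.
  by move=> ir; apply: contraTneq ir => ->; case/andP: urest.
pose R := sprod F 0 rest; pose R' := sprod F' 1 rest.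
have Rx r : R * x w r = sprod F 0 (rcons rest r).
  by rewrite -cats1 sprod_cat /= mulr1 srest add0n.
have xR' r : x' (- w) r * R' = sprod F' 0 (r :: rest) by congr (_ * _); rewrite /F' mul0r addr0.
have Rx0 r : r != k -> R * x w r = 0.
  by move=> rk; rewrite Rx; apply: dup0 (F_alt 0) _ _; rewrite rcons_uniq Krest.
have xR0 r : r != k -> x' (- w) r * R' = 0.
  by move=> rk; rewrite xR'; apply: dup0 (F'_alt 0) _ _; rewrite /= Krest.
have xg i p : i != k -> x p i * g = g * x p i.
  move=> /negPf ik; apply/eqP; rewrite -subr_eq0 lc_g ?ik ?mul0r ?mul0rn ?oppr0 // => j.
  exact: inert_th.
have x'g i p : i != k -> x' p i * g = g * x' p i.
  move=> /negPf ik; apply/eqP; rewrite -subr_eq0 lc_g ?ik ?mul0r ?mul0rn ?oppr0 // => j.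
  exact: inert_th'.
have Rg : R * g = g * R by apply: sprod_commute => j i /krest; exact: xg.
have R'g : R' * g = g * R' by apply: sprod_commute => j i /krest; exact: x'g.
pose z r := lc th (c w r); pose z' r := lc th' (c (- w) r).
have J0 : \sum_r (x w r * z' r + z r * x' (- w) r) = 0.
  have E1 r : x w r * z' r + z r * x' (- w) r
      = bl th th' (fun j l => a w r j * c (- w) r l + c w r j * a (- w) r l).
    by rewrite blD !lcM // => i j; exact: inert_th'.
  rewrite (eq_bigr _ (fun r _ => E1 r)) /bl exchange_big big1 // => j _.
  rewrite exchange_big big1 // => l _; by rewrite -mulr_sumr junction // mulr0.
have J1 : R * (x w k * z' k + z k * x' (- w) k) * R' = 0.
  have := congr1 (fun X => R * X * R') J0; rewrite mulr0 mul0r mulr_sumr mulr_suml.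
  rewrite (bigD1 k) //= big1 ?addr0 // => r rk.
  by rewrite mulrDr mulrDl !mulrA Rx0 // !mul0r add0r -!mulrA xR0 // !mulr0.
have Zsign t G D : alternating G -> G (enum 'I_n) = D -> perm_eq t (enum 'I_n) ->
    G t = D \/ G t = - D :> E.
  by move=> altG <- pt; apply: alternating_perm_eq => //; rewrite perm_sym.
apply: (two_copies dth_th dth'_th' dth'_th (Z := R * x w k) (Z' := x' (- w) k * R')) => //;
  try exact: inert_Arow.
- rewrite Rx; apply: Zsign (F_alt 0) _ _; last by rewrite perm_rcons.
  rewrite -[enum _]map_id sprod_map_enum.
  exact: (prod_xrow h natreg th_th th_a).
- rewrite xR'; apply: Zsign (F'_alt 0) _ _; last by [].
  rewrite -[enum _]map_id sprod_map_enum.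
  exact: (prod_xrow h natreg th'_th' th'_a).
apply/eqP; rewrite -subr_eq0; apply/eqP.
(* [R] and [R'] do not contain row [k] and commute with [g], which leaves the Leibniz rule on the
   two middle factors. *)
transitivity (R * (x w k * (x' (- w) k * g - g * x' (- w) k)
    + (x w k * g - g * x w k) * x' (- w) k) * R').
  have -> : R * x w k * (x' (- w) k * R') * g = R * (x w k * (x' (- w) k * g)) * R'.
    by rewrite -!mulrA R'g.
  have -> : g * (R * x w k * (x' (- w) k * R')) = R * (g * (x w k * x' (- w) k)) * R'.
    by rewrite !mulrA Rg.
  rewrite -mulrBl -mulrBr; congr (_ * _ * _).
  by rewrite mulrBr mulrBl !mulrA addrA subrK.
rewrite !lc_g ?eqxx ?mul1r; try by move=> j; first [exact: inert_th | exact: inert_th'].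
have key (X A B Y : E) :
    R * (X * - (A *+ 2) + - (B *+ 2) * Y) * R' = - (R * (X * A + B * Y) * R' *+ 2).
  by rewrite !(mulrN, mulNr, mulrnAl, mulrnAr) -opprD -mulrnDl !(mulrN, mulNr, mulrnAl, mulrnAr).
by rewrite key J1 mul0rn oppr0.
Qed.

End OddRows.

(** * An element that moves two columns *)

Section OddColumns.
Variables (b : L -> 'I_n -> 'I_n -> E) (g : E) (k l : 'I_n).
Hypothesis UD : forall p, U p -> U (p + p).
Hypothesis Ureg : forall p, U p -> regular E p.
Hypothesis kl : k != l.
Hypothesis inert_b : forall p i j, inert (b p i j).
Hypothesis inert_g : inert g.
Hypothesis a_g : forall p i j, a p i j * g - g * a p i j
  = (j == k)%:R * b p i l - (j == l)%:R * b p i k.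
Hypothesis AB : forall p q i j k l, U p -> U q ->
  (p * p - q * q) *: (a p i j * b q k l - b q k l * a p i j)
  = (h * (p + q)) *: (a p k j * b q i l - a q k j * b p i l)
    + ((j == l)%:R * h * (p - q)) *: \sum_r (b q k r * a p i r - a q k r * b p i r).

Local Notation y := (ycol a th).
Local Notation y' := (ycol a th').
Local Notation be := (ycol b th).
Local Notation be' := (ycol b th').

(** In [AB] at [q = - p] both p^2 - q^2 and p + q vanish; only the sum is left, with the regular
    factor 2 p h. *)
Lemma AB_junction p i j : U p ->
  \sum_r (b (- p) i r * a p j r - a (- p) i r * b p j r) = 0.
Proof.
move=> Up; have := AB j k i k Up (UN Up).
rewrite mulrNN subrr scale0r subrr mulr0 scale0r add0r eqxx mul1r opprK => /esym.
exact: (regularM hreg (Ureg (UD Up))).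
Qed.


Lemma bl_sum (v w : 'I_n -> E) (G : 'I_n -> 'I_n -> 'I_n -> E) :
  bl v w (fun i j => \sum_r G r i j) = \sum_r bl v w (G r).
Proof.
rewrite /bl [RHS]exchange_big; apply: eq_bigr => i _.
rewrite exchange_big; apply: eq_bigr => j _; exact: mulr_sumr.
Qed.

Lemma th_b i p j m : th i * b p j m = b p j m * th i.
Proof. exact: inert_th. Qed.

Lemma th'_b i p j m : th' i * b p j m = b p j m * th' i.
Proof. exact: inert_th'. Qed.

Section OneCopy.
Variable t : 'I_n -> E.
Hypothesis t_t : forall i j, t i * t j = - (t j * t i).
Hypothesis t_a : forall i p j m, t i * a p j m = a p j m * t i.
Hypothesis t_b : forall i p j m, t i * b p j m = b p j m * t i.
Local Notation y := (ycol a t).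
Local Notation be := (ycol b t).

Definition ybsum p := \sum_r y (p + h) r * be p r.
Definition bysum p := \sum_r be (p + h) r * y p r.

(** This is [AB] at the arguments p and q = p + h, contracted with [t]. There p^2 - q^2 = - h (2p +
    h), and the factor - h cancels. *)
Lemma yb_by p j m : U p ->
  (p + h + p) *: (y (p + h) j * be p m + be (p + h) m * y p j)
  = ((j == m)%:R * h) *: (ybsum p - bysum p).
Proof.
move=> Up; pose q := p + h; have Uq : U q by exact: Uh.
have E1 i r : (q + p) *: (a p i j * b q r m - b q r m * a p i j)
    = - (q + p) *: (a p r j * b q i m - a q r j * b p i m)
      + ((j == m)%:R * h) *: \sum_s (b q r s * a p i s - a q r s * b p i s).
  apply: (regular_eq (regularN hreg)).
  transitivity ((p * p - q * q) *: (a p i j * b q r m - b q r m * a p i j)).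
    by rewrite scalerA; congr (_ *: _); rewrite /q; ring.
  rewrite AB // [RHS]scalerDr !scalerA; congr (_ *: _ + _ *: _); rewrite /q; ring.
have E2 : (q + p) *: (- (y p j * be q m) - be q m * y p j)
    = - (q + p) *: (y p j * be q m - y q j * be p m)
      + ((j == m)%:R * h) *: (bysum p - ybsum p).
  rewrite /ybsum /bysum -sumrB (eq_bigr (fun r =>
     bl t t (fun i k => b q i r * a p k r - a q i r * b p k r))) => [|r _].
    rewrite -bl_sum !lcM; try by move=> ? ?; first [exact: t_a | exact: t_b].
    rewrite [X in - X - _]bl_swap // opprK -!blN -!blD -!blZ -blD.
    by apply: eq_bl => i m'; rewrite E1.
  by rewrite blD blN !lcM // => ? ?; first [exact: t_a | exact: t_b].
apply/eqP; rewrite -subr_eq0; apply/eqP; rewrite -/q.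
transitivity (- (q + p) *: (y p j * be q m - y q j * be p m)
      + ((j == m)%:R * h) *: (bysum p - ybsum p) 
      - (q + p) *: (- (y p j * be q m) - be q m * y p j)); first by lin_ring L E.
by rewrite -E2 subrr.
Qed.

Lemma yb_by_sum p : U p ->
  (p + h + p) *: (ybsum p + bysum p) = (n%:R * h) *: (ybsum p - bysum p).
Proof.
move=> Up; rewrite {1}/ybsum {1}/bysum -big_split scaler_sumr.
rewrite (eq_bigr (fun=> h *: (ybsum p - bysum p))) => [|r _].
  by rewrite sumr_const card_ord -scaler_nat scalerA.
by rewrite yb_by // eqxx mul1r.
Qed.

(** [T * bysum p] is eliminated between the diagonal case l of [yb_by] and the sum of all diagonal
    cases; only the columns k and l survive in [T * ybsum p]. The left side is what the commutator
    of [y (p + h) k * y p l] with [g] gives after [T]. *)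
Lemma yb_right p T : U p -> regular E (p + h + p) ->
    (forall r, r != k -> r != l -> T * y (p + h) r = 0) ->
  (p + h + p + n%:R * h) *: (T * (be (p + h) l * y p l - y (p + h) k * be p k))
  = - (p + h + p + n%:R * h - 2%:R * h)
    *: (T * (y (p + h) k * be p k + y (p + h) l * be p l)).
Proof.
move=> Up reg T0.
have E0 : T * ybsum p = T * y (p + h) k * be p k + T * y (p + h) l * be p l.
  rewrite /ybsum mulr_sumr (bigD1 k) //= (bigD1 l) 1?eq_sym //= big1 ?addr0 ?mulrA // => r.
  by case/andP=> rk rl; rewrite mulrA T0 // mul0r.
have := congr1 ( *%R T) (yb_by l l Up); have := congr1 ( *%R T) (yb_by_sum Up).
rewrite eqxx mul1r -!scalerAr !(mulrDr, mulrN) !mulrA E0 => e2 e1.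
set s := p + h + p in reg e1 e2 *; apply: (regular_eq reg).
move: e1 e2; set X0 := T * _ k * _; set X1 := T * _ l * _; set X2 := T * _ * _.
set B := T * bysum p; move=> e1 e2; apply/eqP; rewrite -subr_eq0; apply/eqP.
transitivity ((s + n%:R * h) *: (s *: (X1 + X2) - h *: (X0 + X1 - B))
   - h *: (s *: (X0 + X1 + B) - (n%:R * h) *: (X0 + X1 - B))).
  by lin_ring L E.
by rewrite e1 e2 !subrr !scaler0 subrr.
Qed.

(** The mirror image of [yb_right]: the other columns are killed from the right, and it is
    [ybsum p * T] that is eliminated. *)
Lemma yb_left p T : U p -> regular E (p + h + p) ->
    (forall r, r != k -> r != l -> y p r * T = 0) ->
  (p + h + p - n%:R * h) *: ((be (p + h) l * y p l - y (p + h) k * be p k) * T)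
  = (p + h + p - n%:R * h + 2%:R * h)
    *: ((be (p + h) k * y p k + be (p + h) l * y p l) * T).
Proof.
move=> Up reg T0.
have E0 : bysum p * T = be (p + h) k * y p k * T + be (p + h) l * y p l * T.
  rewrite /bysum mulr_suml (bigD1 k) //= (bigD1 l) 1?eq_sym //= big1 ?addr0 // => r.
  by case/andP=> rk rl; rewrite -mulrA T0 // mulr0.
have := congr1 ( *%R^~ T) (yb_by k k Up); have := congr1 ( *%R^~ T) (yb_by_sum Up).
rewrite eqxx mul1r -!scalerAl !(mulrDl, mulNr) E0 => e2 e1.
set s := p + h + p in reg e1 e2 *; apply: (regular_eq reg).
move: e1 e2; set X0 := be _ k * _ * _; set X1 := be _ l * _ * _; set X2 := y _ k * _ * _.
set Y := ybsum p * T; move=> e1 e2; apply/eqP; rewrite -subr_eq0; apply/eqP.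
transitivity (- (s - n%:R * h) *: (s *: (X2 + X0) - h *: (Y - (X0 + X1)))
   - h *: (s *: (Y + (X0 + X1)) - (n%:R * h) *: (Y - (X0 + X1)))).
  by lin_ring L E.
by rewrite e1 e2 !subrr !scaler0 subrr.
Qed.

End OneCopy.

Variable u : L.
Hypothesis Uu : U u.
Local Notation w := (u + n.-1%:R * h).

Let F s := y (w - s%:R * h).
Let F' s := y' (- u - s%:R * h).

Lemma col_alt (t : 'I_n -> E) v m : (forall i j, t i * t j = - (t j * t i)) ->
    (forall i p j r, t i * a p j r = a p j r * t i) -> U v ->
  alternating (sprod (fun s => ycol a t (v - s%:R * h)) m).
Proof.
move=> t_t t_a Uv; apply: sprod_alternating => s i j.
have -> : v - s%:R * h = v - s.+1%:R * h + h by rewrite -natr1; ring.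
exact: (ycol_alt Uh hreg natreg AA t_t t_a _ _ (Uhkm Uhm _ Uv)).
Qed.

Lemma Uw : U w. Proof. exact: Uhk. Qed.

Lemma Fcol_alt m : alternating (sprod F m).
Proof. exact: (col_alt _ th_th th_a Uw). Qed.

Lemma F'col_alt m : alternating (sprod F' m).
Proof. exact: (col_alt _ th'_th' th'_a (UN Uu)). Qed.

Lemma col_g (t : 'I_n -> E) p j : (forall j, t j * g = g * t j) ->
  ycol a t p j * g - g * ycol a t p j
  = (j == k)%:R * ycol b t p l - (j == l)%:R * ycol b t p k.
Proof.
move=> tg; transitivity (\sum_i t i * (a p i j * g - g * a p i j)).
  rewrite /ycol /lc mulr_suml [g * _]mulr_sumr -sumrB; apply: eq_bigr => i _.
  by rewrite mulrBr !mulrA tg.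
rewrite /ycol /lc !mulr_sumr -sumrB; apply: eq_bigr => i _; rewrite a_g mulrBr.
by case: (j == k); case: (j == l); rewrite ?mul1r ?mul0r ?mulr0.
Qed.

(* The columns k and l are placed last in the first product and first in the second;
   then [Z, g] is a multiple of [P], [Z', g] of [P'], and [PZ] matches the two. *)
Lemma Acol_oddcol : Acol h a w * Acol h a (- u) * g = g * (Acol h a w * Acol h a (- u)).
Proof.
have [prest1 urest1 srest1 Krest1] := rem_enum k.
have lrest1 : l \in rem k (enum 'I_n) by apply: Krest1; rewrite eq_sym.
pose rest := rem l (rem k (enum 'I_n)).
have prest : perm_eq [:: k, l & rest] (enum 'I_n).
  by apply: perm_trans prest1; rewrite perm_cons perm_sym perm_to_rem.
have urest : uniq [:: k, l & rest] by rewrite (perm_uniq prest) enum_uniq.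
have srest : n = (size rest).+2 by have := perm_size prest; rewrite size_enum_ord.
have Krest r : r != k -> r != l -> r \in rest.
  by move=> rk rl; have := perm_mem prest r; rewrite mem_enum !in_cons (negPf rk) (negPf rl).
have krest i : i \in rest -> i != k /\ i != l.
  move=> ir; split; apply: contraTneq ir => ->; move: urest; rewrite /= inE negb_or.
    by case/andP=> /andP[_ ->].
  by case/and3P.
(* The first product ends with the arguments u + h and u, the second begins with - u and - u - h;
   the junction is between u and - u. *)
have wE : w - (size rest)%:R * h = u + h.
  by rewrite [in n.-1]srest /= -natr1; ring.
pose T := sprod F 0 rest; pose T' := sprod F' 2 rest.
have TyE r m : T * y (u + h) r * y u m = sprod F 0 (rest ++ [:: r; m]).
  rewrite sprod_cat add0n /= mulr1 mulrA {2 3}/F wE.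
  by have -> : w - (size rest).+1%:R * h = u by rewrite [in n.-1]srest /=; ring.
have yTE r m : y' (- u) r * (y' (- u - h) m * T') = sprod F' 0 [:: r, m & rest].
  by congr (_ * (_ * _)); rewrite /F' ?mul0r ?subr0 ?mul1r.
have Ty0 r : r != k -> r != l -> T * y (u + h) r = 0.
  move=> rk rl; have -> : T * y (u + h) r = sprod F 0 (rcons rest r).
    by rewrite -cats1 sprod_cat add0n /= mulr1 {2}/F wE.
  by apply: dup0 (Fcol_alt 0) _ _; rewrite rcons_uniq Krest.
have yT0 r : r != k -> r != l -> y' (- u - h) r * T' = 0.
  move=> rk rl; have -> : y' (- u - h) r * T' = sprod F' 1 (r :: rest).
    by congr (_ * _); rewrite /F' mul1r.
  by apply: dup0 (F'col_alt 1) _ _; rewrite /= Krest.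
have Tyy r m : ~~ uniq [:: r, m & rest] -> T * y (u + h) r * y u m = 0.
  move=> nu; rewrite TyE; apply: dup0 (Fcol_alt 0) _ _.
  by rewrite -(perm_uniq (s1 := [:: r, m & rest])) // (perm_catC [:: r; m]).
have yyT r m : ~~ uniq [:: r, m & rest] -> y' (- u) r * (y' (- u - h) m * T') = 0.
  by move=> nu; rewrite yTE; apply: dup0 (F'col_alt 0) _ _.
pose Z := T * y (u + h) k * y u l; pose Z' := y' (- u) k * (y' (- u - h) l * T').
have nodup r m : ~~ [|| (r == k) && (m == l) | (r == l) && (m == k)] ->
    ~~ uniq [:: r, m & rest].
  case: (eqVneq r m) => [->|rm]; first by rewrite /= inE eqxx.
  case: (eqVneq r k) => [rk|rk]; last case: (eqVneq r l) => [rl|rl] /=.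
  - case: (eqVneq m l) => //= ml _; rewrite [m \in rest]Krest ?andbF //.
    by rewrite -rk eq_sym.
  - case: (eqVneq m k) => //= mk _; rewrite [m \in rest]Krest ?andbF //.
    by rewrite -rl eq_sym.
  by move=> _; rewrite inE [r \in rest]Krest // orbT.
have Zlk : T * y (u + h) l * y u k = - Z.
  by rewrite TyE /Z TyE (Fcol_alt 0).
have Z'lk : y' (- u) l * (y' (- u - h) k * T') = - Z'.
  by rewrite yTE /Z' yTE -[[:: l, k & rest]]cat0s (F'col_alt 0).
pose P := T * (y (u + h) k * be u k + y (u + h) l * be u l).
pose P' := (be' (- u) k * y' (- u - h) k + be' (- u) l * y' (- u - h) l) * T'.
have J : \sum_r (be u r * y' (- u) r - y u r * be' (- u) r) = 0.
  have E1 r : be u r * y' (- u) r - y u r * be' (- u) r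
      = bl th th' (fun i j => b u i r * a (- u) j r - a u i r * b (- u) j r).
    by rewrite blD blN !lcM // => i j; first [exact: th'_a | exact: th'_b].
  rewrite (eq_bigr _ (fun r _ => E1 r)) -bl_sum /bl big1 // => i _; rewrite big1 // => j _.
  by have := AB_junction i j (UN Uu); rewrite opprK => ->; rewrite mulr0.
have Jsum A B : \sum_r (A * (be u r * (y' (- u) r * B)) - A * (y u r * (be' (- u) r * B))) = 0.
  transitivity (A * (\sum_r (be u r * y' (- u) r - y u r * be' (- u) r)) * B).
    rewrite mulr_sumr mulr_suml.
    by apply: eq_bigr => r _; rewrite mulrBr mulrBl !mulrA.
  by rewrite J mulr0 mul0r.
(* In [Jsum] only [r = k] avoids a repeated column in the first sum, and only [r = l] in the
   second. *)
have PZk : T * y (u + h) k * be u k * Z' = Z * (be' (- u) l * (y' (- u - h) l * T')).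
  apply/eqP; rewrite -subr_eq0; apply/eqP.
  rewrite -[RHS](Jsum (T * y (u + h) k) (y' (- u - h) l * T')) sumrB; congr (_ - _).
    rewrite (bigD1 k) //= big1 ?addr0 ?mulrA // => r rk.
    by rewrite yyT ?mulr0 // nodup // (negPf rk) (negPf (_ : l != k)) ?andbF // eq_sym.
  rewrite (bigD1 l) //= big1 ?addr0 ?mulrA // => r rl.
  by rewrite mulrA Tyy ?mul0r // nodup // (negPf kl) (negPf rl) andbF.
(* The same with the two columns exchanged, under which [Z] and [Z'] both change sign. *)
have PZl : T * y (u + h) l * be u l * Z' = Z * (be' (- u) k * (y' (- u - h) k * T')).
  apply: oppr_inj; rewrite -[LHS]mulrN -[RHS]mulNr -Zlk -Z'lk.
  apply/eqP; rewrite -subr_eq0; apply/eqP.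
  rewrite -[RHS](Jsum (T * y (u + h) l) (y' (- u - h) k * T')) sumrB; congr (_ - _).
    rewrite (bigD1 l) //= big1 ?addr0 ?mulrA // => r rl.
    by rewrite yyT ?mulr0 // nodup // (negPf rl) (negPf kl) andbF.
  rewrite (bigD1 k) //= big1 ?addr0 ?mulrA // => r rk.
  by rewrite mulrA Tyy ?mul0r // nodup // (negPf rk) (negPf (_ : l != k)) ?andbF // eq_sym.
have PZ : P * Z' = Z * P'.
  by rewrite /P mulrDr ![T * (_ * _)]mulrA mulrDl PZk PZl /P' mulrDl mulrDr addrC -!mulrA.
pose s := u + h + u.
have Us : U (s + n%:R * h).
  have -> : s + n%:R * h = u + u + n.+1%:R * h by rewrite /s -natr1; ring.
  by apply: Uhk => //; apply: UD.
have regs : regular E s.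
  by apply: Ureg; have -> : s = u + u + 1%:R * h by [rewrite /s; ring]; apply: Uhk => //; apply: UD.
have Zg : (s + n%:R * h) *: (Z * g - g * Z) = - (s + n%:R * h - 2%:R * h) *: P.
  rewrite -(yb_right th_th th_a th_b Uu regs Ty0); congr (_ *: _).
  have Tg : T * g = g * T.
    apply: sprod_commute => j r /krest[/negPf rk /negPf rl]; apply/eqP; rewrite -subr_eq0.
    by rewrite col_g ?rk ?rl ?mul0r ?subr0 // => i; exact: inert_th.
  transitivity (T * ((y (u + h) k * g - g * y (u + h) k) * y u l
     + y (u + h) k * (y u l * g - g * y u l))).
    rewrite mulrDr mulrBl mulrBr !mulrA !mulrBr !mulrA Tg [RHS]addrC addrA subrK.
    by rewrite /Z.
  rewrite !col_g; try by move=> i; exact: inert_th.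
  by rewrite !eqxx [l == k]eq_sym (negPf kl) !mul0r !mul1r subr0 sub0r mulrN.
(* At the point - u - h the quantity 2p + h is - s. So the coefficients match those of [Zg] up to
   the sign on the right, and the two contributions cancel by [PZ]. *)
have Z'g : (s + n%:R * h) *: (Z' * g - g * Z') = (s + n%:R * h - 2%:R * h) *: P'.
  have Uuh : U (- u - h) by apply: Uhm; exact: UN.
  have uE : - u - h + h = - u by rewrite subrK.
  have sE : - u - h + h + (- u - h) = - s by rewrite /s; ring.
  have := yb_left th'_th' th'_a th'_b Uuh _ yT0; rewrite sE uE => /(_ (regularN regs)) H.
  have {}H : (s + n%:R * h) *: ((be' (- u) l * y' (- u - h) l - y' (- u) k * be' (- u - h) k) * T')
     = (s + n%:R * h - 2%:R * h) *: P'.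
    apply: oppr_inj; rewrite -!scaleNr /P'; transitivity ((- s - n%:R * h) *: ((be' (- u) l * y' (- u - h) l - y' (- u) k * be' (- u - h) k) * T')).
      by congr (_ *: _); ring.
    by rewrite H; congr (_ *: _); ring.
  rewrite -H; congr (_ *: _).
  have T'g : T' * g = g * T'.
    apply: sprod_commute => j r /krest[/negPf rk /negPf rl]; apply/eqP; rewrite -subr_eq0.
    by rewrite col_g ?rk ?rl ?mul0r ?subr0 // => i; exact: inert_th'.
  transitivity (((y' (- u) k * g - g * y' (- u) k) * y' (- u - h) l
     + y' (- u) k * (y' (- u - h) l * g - g * y' (- u - h) l)) * T').
    rewrite mulrDl !mulrBl mulrBr !mulrBl !mulrA [RHS]addrC addrA subrK.
    by rewrite /Z' -!mulrA T'g.
  rewrite !col_g; try by move=> i; exact: inert_th'.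
  by rewrite !eqxx [l == k]eq_sym (negPf kl) !mul0r !mul1r subr0 sub0r mulrN.
have Zsign t G D : alternating G -> G (enum 'I_n) = D -> perm_eq t (enum 'I_n) ->
    G t = D \/ G t = - D :> E.
  by move=> altG <- pt; apply: alternating_perm_eq => //; rewrite perm_sym.
apply: (two_copies dth_th dth'_th' dth'_th (Z := Z) (Z' := Z')) => //;
  try by apply: inert_rdet.
- rewrite /Z TyE; apply: Zsign (Fcol_alt 0) _ _; last by rewrite (perm_catC rest [:: k; l]).
  rewrite -[enum _]map_id sprod_map_enum.
  exact: (prod_ycol h natreg th_th th_a).
- rewrite /Z' yTE; apply: Zsign (F'col_alt 0) _ _; last by [].
  rewrite -[enum _]map_id sprod_map_enum.
  exact: (prod_ycol h natreg th'_th' th'_a).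
apply/eqP; rewrite -subr_eq0; apply/eqP; apply: (Ureg Us).
transitivity ((s + n%:R * h) *: (Z * g - g * Z) * Z' + Z * ((s + n%:R * h) *: (Z' * g - g * Z'))).
  rewrite -scalerAl -scalerAr -scalerDr; congr (_ *: _).
  by rewrite mulrBl mulrBr !mulrA [RHS]addrC addrA subrK.
by rewrite Zg Z'g -scalerAl -scalerAr PZ scaleNr addNr.
Qed.

End OddColumns.
End Centrality.

(** * Blocks of size one *)

Section RankOne.
Variables (L : comNzRingType) (E : algType L) (h : L) (al be : L -> E) (u v : L).
Hypothesis alC : forall p q, p = u \/ p = - u -> q = v \/ q = - u ->
  al p * al q = al q * al p.
Hypothesis AB : forall p q, p = u \/ p = - u -> q = v \/ q = - u ->
  (p * p - q * q) *: (al p * be q - be q * al p)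
  = (h * (p + q)) *: (al p * be q - al q * be p) + (h * (p - q)) *: (be q * al p - al q * be p).

(** Moving [be v] across [al u] and then across [al (- u)] leaves one extra term each, with [be u]
    and [be (- u)]. They cancel by [J], which is [AB] at the arguments u and - u. *)
Lemma rank_one_odd : regular E (h * (u + u)) -> regular E ((u - v - h) * (u + v)) ->
  al u * al (- u) * be v = be v * (al u * al (- u)).
Proof.
move=> regu reguv; have uu : u = u \/ u = - u by left.
have nu : - u = u \/ - u = - u by right.
have vv : v = v \/ v = - u by left.
have nv : - u = v \/ - u = - u by right.
have J : be (- u) * al u = al (- u) * be u.
  apply/eqP; rewrite -subr_eq0; apply/eqP; apply: regu; have := AB uu nv.
  by rewrite mulrNN subrr scale0r subrr mulr0 scale0r add0r opprK => <-.
have e1 := AB uu vv; have e2 := AB nu vv.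
apply: (regular_eq reguv).
have {}e1 : ((u - v - h) * (u + v)) *: (al u * be v)
    = ((u - v) * (u + v + h)) *: (be v * al u) - (h * (u + u)) *: (al v * be u).
  apply/eqP; rewrite -subr_eq0; apply/eqP.
  transitivity ((u * u - v * v) *: (al u * be v - be v * al u)
     - ((h * (u + v)) *: (al u * be v - al v * be u) + (h * (u - v)) *: (be v * al u - al v * be u))).
    by lin_ring L E.
  by rewrite e1 subrr.
have {}e2 : ((u - v) * (u + v + h)) *: (al (- u) * be v)
    = ((u - v - h) * (u + v)) *: (be v * al (- u)) + (h * (u + u)) *: (al v * be (- u)).
  apply/eqP; rewrite -subr_eq0; apply/eqP.
  transitivity ((- u * - u - v * v) *: (al (- u) * be v - be v * al (- u))
     - ((h * (- u + v)) *: (al (- u) * be v - al v * be (- u))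
       + (h * (- u - v)) *: (be v * al (- u) - al v * be (- u)))).
    by lin_ring L E.
  by rewrite e2 subrr.
have uC : al u * al (- u) = al (- u) * al u by exact: alC.
rewrite uC -mulrA scalerAr e1 mulrBr -!scalerAr [al (- u) * (be v * al u)]mulrA.
rewrite [_ *: (al (- u) * be v * al u)]scalerAl e2 mulrDl -!scalerAl.
rewrite -!mulrA J !mulrA -(alC nu vv).
by lin_ring L E.
Qed.

End RankOne.

(** * Power series and affine points *)

Section PowerSeriesRing.
Variable A : nzRingType.

(** A copy of the sequences used in the statement, so that [ps_mul] itself becomes a ring
    multiplication. *)
Definition fps : Type := nat -> A.
HB.instance Definition _ := gen_eqMixin fps.
HB.instance Definition _ := gen_choiceMixin fps.
Implicit Types f g k : fps.

Definition fps_add f g : fps := fun m => f m + g m.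
Definition fps_opp f : fps := fun m => - f m.
Definition fps_zero : fps := fun=> 0.

Lemma fps_addA : associative fps_add.
Proof. by move=> f g k; apply/funext => m; exact: addrA. Qed.

Lemma fps_addC : commutative fps_add.
Proof. by move=> f g; apply/funext => m; exact: addrC. Qed.

Lemma fps_add0 : left_id fps_zero fps_add.
Proof. by move=> f; apply/funext => m; exact: add0r. Qed.

Lemma fps_addN : left_inverse fps_zero fps_opp fps_add.
Proof. by move=> f; apply/funext => m; exact: addNr. Qed.

HB.instance Definition _ :=
  GRing.isZmodule.Build fps fps_addA fps_addC fps_add0 fps_addN.

Definition fps_mul : fps -> fps -> fps := @ps_mul A.
Definition fps_one : fps := @ps_one A.

(** A coefficient depends on truncations only; associativity is thus inherited from polynomials. *)
Lemma fps_mul_poly f g m n : (m < n)%N ->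
  fps_mul f g m = ((\poly_(i < n) f i) * \poly_(i < n) g i)`_m.
Proof.
move=> mn; rewrite coefM; apply: eq_bigr => i _.
by rewrite !coef_poly (leq_ltn_trans _ mn) ?(leq_ltn_trans _ mn) ?leq_subr // -ltnS.
Qed.

Lemma eq_coefM_poly (p q p' q' : {poly A}) m :
    (forall i, (i <= m)%N -> p`_i = p'`_i) -> (forall i, (i <= m)%N -> q`_i = q'`_i) ->
  (p * q)`_m = (p' * q')`_m.
Proof.
move=> hp hq; rewrite !coefM; apply: eq_bigr => i _.
by rewrite hp ?hq ?leq_subr // -ltnS.
Qed.

Lemma fps_mulA : associative fps_mul.
Proof.
move=> f g k; apply/funext => m; rewrite !(fps_mul_poly _ _ (ltnSn m)).
pose t (f : fps) := \poly_(i < m.+1) f i.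
have tM f1 f2 i : (i <= m)%N -> (t (fps_mul f1 f2))`_i = (t f1 * t f2)`_i.
  by move=> im; rewrite coef_poly ltnS im (@fps_mul_poly _ _ _ m.+1).
rewrite -/(t f) -/(t k) -/(t (fps_mul g k)) -/(t (fps_mul f g)).
rewrite (eq_coefM_poly (p' := t f) (q' := t g * t k)) // => [|i im]; last exact: tM.
by rewrite mulrA; apply: eq_coefM_poly => // i im; rewrite tM.
Qed.

Lemma fps_mul1l : left_id fps_one fps_mul.
Proof.
move=> f; apply/funext => m; rewrite /fps_mul /ps_mul big_ord_recl mul1r subn0 big1 ?addr0 //.
by move=> i _; rewrite /fps_one /ps_one mul0r.
Qed.

Lemma fps_mul1r : right_id fps_one fps_mul.
Proof.
move=> f; apply/funext => m; rewrite /fps_mul /ps_mul big_ord_recr /= subnn mulr1.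
rewrite big1 ?add0r // => i _; rewrite /fps_one /ps_one subn_eq0 leqNgt ltn_ord mulr0 //.
Qed.

Lemma fps_mulDl : left_distributive fps_mul fps_add.
Proof.
move=> f g k; apply/funext => m; rewrite /fps_add /fps_mul /ps_mul -big_split.
by apply: eq_bigr => i _; rewrite mulrDl.
Qed.

Lemma fps_mulDr : right_distributive fps_mul fps_add.
Proof.
move=> f g k; apply/funext => m; rewrite /fps_add /fps_mul /ps_mul -big_split.
by apply: eq_bigr => i _; rewrite mulrDr.
Qed.

Lemma fps_one_neq0 : fps_one != 0.
Proof.
apply/eqP => /(congr1 (fun f : fps => f 0%N)) /eqP.
by rewrite /fps_one /ps_one eqxx oner_eq0.
Qed.

HB.instance Definition _ := GRing.Zmodule_isNzRing.Build fps
  fps_mulA fps_mul1l fps_mul1r fps_mulDl fps_mulDr fps_one_neq0.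

Lemma fpsD f g m : (f + g) m = f m + g m. Proof. by []. Qed.
Lemma fpsN f m : (- f) m = - f m. Proof. by []. Qed.
Lemma fps0 m : (0 : fps) m = 0. Proof. by []. Qed.
Lemma fps1 m : (1 : fps) m = (m == 0%N)%:R. Proof. by []. Qed.
Lemma fpsM f g m : (f * g) m = \sum_(r < m.+1) f r * g (m - r)%N. Proof. by []. Qed.

Lemma fps_sum (I : Type) (s : seq I) (P : pred I) (F : I -> fps) m :
  (\sum_(i <- s | P i) F i) m = \sum_(i <- s | P i) F i m.
Proof. by elim/big_rec2: _ => // i x y _ <-. Qed.

Definition fps_const (x : A) : fps := fun m => if m is 0 then x else 0.

Lemma fps_constM x f m : (fps_const x * f) m = x * f m.
Proof.
rewrite fpsM big_ord_recl subn0 big1 ?addr0 // => i _.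
by rewrite /fps_const /= mul0r.
Qed.

Lemma fps_Mconst x f m : (f * fps_const x) m = f m * x.
Proof.
rewrite fpsM big_ord_recr /= subnn big1 ?add0r // => i _.
by move: (ltn_ord i); rewrite -subn_gt0 /fps_const; case: (m - i)%N; rewrite ?mulr0.
Qed.

Lemma fps_const_is_zmod_morphism : zmod_morphism fps_const.
Proof. by move=> x y; apply/funext => m; rewrite fpsD fpsN; case: m => [|m] //=; rewrite subr0. Qed.

HB.instance Definition _ :=
  GRing.isZmodMorphism.Build A fps fps_const fps_const_is_zmod_morphism.

Lemma fps_const_is_monoid_morphism : monoid_morphism fps_const.
Proof.
split; first by apply/funext => -[|m].
by move=> x y; apply/funext => m; rewrite fps_constM; case: m => //= m; rewrite mulr0.
Qed.

HB.instance Definition _ :=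
  GRing.isMonoidMorphism.Build A fps fps_const fps_const_is_monoid_morphism.

End PowerSeriesRing.

Section CommutativePowerSeries.
Variable K : comNzRingType.

Lemma fps_mulC : @commutative (fps K) (fps K) *%R.
Proof.
move=> f g; apply/funext => m; rewrite !fpsM (reindex_inj rev_ord_inj) /=.
by apply: eq_bigr => i _; rewrite mulrC subSS subKn // -ltnS.
Qed.

HB.instance Definition _ := GRing.PzRing_hasCommutativeMul.Build (fps K) fps_mulC.

End CommutativePowerSeries.

Section PowerSeriesAlgebra.
Variables (K : fieldType) (A : algType K).

Definition fps_in (c : fps K) : fps A := fun m => (c m)%:A.

Lemma fps_in_is_zmod_morphism : zmod_morphism fps_in.
Proof. by move=> c d; apply/funext => m; rewrite /fps_in scalerBl. Qed.

HB.instance Definition _ :=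
  GRing.isZmodMorphism.Build (fps K) (fps A) fps_in fps_in_is_zmod_morphism.

Lemma fps_in_is_monoid_morphism : monoid_morphism fps_in.
Proof.
split; first by apply/funext => -[|m]; rewrite /fps_in fps1 ?scale1r ?scale0r.
move=> c d; apply/funext => m; rewrite /fps_in !fpsM scaler_suml.
by apply: eq_bigr => i _; rewrite -scalerAl mul1r scalerA.
Qed.

HB.instance Definition _ :=
  GRing.isMonoidMorphism.Build (fps K) (fps A) fps_in fps_in_is_monoid_morphism.

(** The scalars are series as well, since the points p, q and h of the abstract sections will be
    elements of [fps K]. *)
Definition fps_scale (c : fps K) (f : fps A) : fps A := fps_in c * f.

Lemma fps_scaleA c d f : fps_scale c (fps_scale d f) = fps_scale (c * d) f.
Proof. by rewrite /fps_scale rmorphM mulrA. Qed.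

Lemma fps_scale1 : left_id 1 fps_scale.
Proof. by move=> f; rewrite /fps_scale rmorph1 mul1r. Qed.

Lemma fps_scaleDr : right_distributive fps_scale +%R.
Proof. by move=> c f g; rewrite /fps_scale mulrDr. Qed.

Lemma fps_scaleDl f : {morph fps_scale^~ f : c d / c + d}.
Proof. by move=> c d; rewrite /fps_scale rmorphD mulrDl. Qed.

HB.instance Definition _ := GRing.Zmodule_isLmodule.Build (fps K) (fps A)
  fps_scaleA fps_scale1 fps_scaleDr fps_scaleDl.

Lemma fps_scaleE (c : fps K) (f : fps A) m :
  (c *: f) m = \sum_(r < m.+1) c r *: f (m - r)%N.
Proof. by apply: eq_bigr => i _; rewrite /fps_in -scalerAl mul1r. Qed.

Lemma fps_scaleAl (c : fps K) (f g : fps A) : c *: (f * g) = (c *: f) * g.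
Proof. exact: mulrA. Qed.

HB.instance Definition _ := GRing.Lmodule_isLalgebra.Build (fps K) (fps A) fps_scaleAl.

Lemma fps_in_comm (c : fps K) (f : fps A) : fps_in c * f = f * fps_in c.
Proof.
apply/funext => m; rewrite !fpsM (reindex_inj rev_ord_inj) /=.
apply: eq_bigr => i _; rewrite subSS subKn -1?ltnS // /fps_in.
by rewrite -scalerAl mul1r -scalerAr mulr1.
Qed.

Lemma fps_scaleAr (c : fps K) (f g : fps A) : c *: (f * g) = f * (c *: g).
Proof. by rewrite /GRing.scale /= /fps_scale !mulrA fps_in_comm. Qed.

HB.instance Definition _ := GRing.Lalgebra_isAlgebra.Build (fps K) (fps A) fps_scaleAr.

End PowerSeriesAlgebra.

(** * Substitution of series without constant term *)

Section Substitution.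
Variable K : fieldType.
Implicit Types z w : fps K.

Lemma fps_order_mul z w i j m : (forall t, (t < i)%N -> z t = 0) ->
  (forall t, (t < j)%N -> w t = 0) -> (m < i + j)%N -> (z * w) m = 0.
Proof.
move=> hz hw mij; rewrite fpsM big1 // => t _.
case: (ltnP t i) => it; first by rewrite hz // mul0r.
by rewrite hw ?mulr0 //; have := ltn_ord t; lia.
Qed.

Lemma fps_order_exp z r m : z 0%N = 0 -> (m < r)%N -> (z ^+ r) m = 0.
Proof.
move=> z0; elim: r m => // r IH m mr; rewrite exprS.
by apply: (fps_order_mul (i := 1) (j := r)); rewrite ?add1n // => -[].
Qed.

Lemma fps_order_exp2 z w r s m : z 0%N = 0 -> w 0%N = 0 -> (m < r + s)%N ->
  (z ^+ r * w ^+ s) m = 0.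
Proof. by move=> z0 w0; apply: fps_order_mul => t; exact: fps_order_exp. Qed.

(* The series [f] in u^-1 with u^-1 replaced by [z]; the truncation is exact only
   for [z 0 = 0]. *)
Definition ps_sub (V : lmodType K) z (f : nat -> V) (m : nat) : V :=
  \sum_(r < m.+1) (z ^+ r) m *: f r.

(** A double series in u^-1 and v^-1 with [z] and [w] substituted; as for [ps_sub], the truncation
    is exact only if both constant terms are 0. *)
Definition ev2 (V : lmodType K) z w (Y : nat -> nat -> V) (m : nat) : V :=
  \sum_(r < m.+1) \sum_(s < m.+1) (z ^+ r * w ^+ s) m *: Y r s.

Lemma sum_widen (V : nmodType) (F : nat -> V) m n : (m <= n)%N ->
  (forall i, (m <= i)%N -> F i = 0) -> \sum_(i < m) F i = \sum_(i < n) F i.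
Proof.
move=> mn F0; rewrite (big_ord_widen n F mn) [RHS](bigID (fun i : 'I_n => (i < m)%N)) /=.
by rewrite [X in _ = _ + X]big1 ?addr0 // => i; rewrite -leqNgt; exact: F0.
Qed.

(** Lengthening the sum adds zeros only, so one bound can serve several coefficients at once. *)
Lemma ps_subE (V : lmodType K) z (f : nat -> V) m n : z 0%N = 0 -> (m < n)%N ->
  ps_sub z f m = \sum_(r < n) (z ^+ r) m *: f r.
Proof.
move=> z0 mn; apply: (sum_widen (F := fun r => (z ^+ r) m *: f r)) => // i mi.
by rewrite fps_order_exp // scale0r.
Qed.

Lemma ev2E (V : lmodType K) z w (Y : nat -> nat -> V) m n n' :
    z 0%N = 0 -> w 0%N = 0 -> (m < n)%N -> (m < n')%N ->
  ev2 z w Y m = \sum_(r < n) \sum_(s < n') (z ^+ r * w ^+ s) m *: Y r s.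
Proof.
move=> z0 w0 mn mn'.
transitivity (\sum_(r < m.+1) \sum_(s < n') (z ^+ r * w ^+ s) m *: Y r s).
  apply: eq_bigr => r _.
  apply: (sum_widen (F := fun s => (z ^+ r * w ^+ s) m *: Y r s)) => // s ms.
  by rewrite fps_order_exp2 ?scale0r // ltn_addl.
apply: (sum_widen (F := fun r => \sum_(s < n') (z ^+ r * w ^+ s) m *: Y r s)) => // r mr.
by rewrite big1 // => s _; rewrite fps_order_exp2 ?scale0r // ltn_addr.
Qed.

Section Algebra.
Variable A : algType K.
Implicit Types f g : fps A.

Lemma ps_subM2 z w f g : z 0%N = 0 -> w 0%N = 0 ->
  (ps_sub z f : fps A) * (ps_sub w g : fps A) = ev2 z w (fun r s => f r * g s) :> fps A.
Proof.
move=> z0 w0; apply/funext => m; rewrite fpsM.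
under eq_bigr => i _.
  rewrite (@ps_subE _ z f i m.+1) // (@ps_subE _ w g (m - i) m.+1) ?ltnS ?leq_subr //.
  rewrite mulr_suml; under eq_bigr => r _ do rewrite mulr_sumr.
  over.
rewrite exchange_big; apply: eq_bigr => r _; rewrite exchange_big; apply: eq_bigr => s _.
rewrite fpsM scaler_suml; apply: eq_bigr => i _.
by rewrite -scalerAl -scalerAr scalerA.
Qed.

Lemma ps_subM2r z w f g : z 0%N = 0 -> w 0%N = 0 ->
  (ps_sub w g : fps A) * (ps_sub z f : fps A) = ev2 z w (fun r s => g s * f r) :> fps A.
Proof.
move=> z0 w0; rewrite ps_subM2 //; apply/funext => m; rewrite /ev2 exchange_big.
by apply: eq_bigr => r _; apply: eq_bigr => s _; rewrite mulrC.
Qed.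

Lemma ps_subD z f g : ps_sub z (f + g) = (ps_sub z f : fps A) + ps_sub z g :> fps A.
Proof.
apply/funext => m; rewrite fpsD -big_split; apply: eq_bigr => r _.
by rewrite fpsD scalerDr.
Qed.

Lemma ps_subN z f : ps_sub z (- f) = - (ps_sub z f : fps A) :> fps A.
Proof.
apply/funext => m; rewrite fpsN -sumrN; apply: eq_bigr => r _.
by rewrite fpsN scalerN.
Qed.

Lemma ps_sub_const z x : ps_sub z (fps_const x) = fps_const x :> fps A.
Proof.
apply/funext => m; rewrite /ps_sub big_ord_recl expr0 fps1 big1 ?addr0 => [|i _].
  by case: m => [|m]; rewrite ?scale1r ?scale0r.
by rewrite scaler0.
Qed.

Lemma ps_subM z f g : z 0%N = 0 ->
  ps_sub z (f * g) = (ps_sub z f : fps A) * (ps_sub z g : fps A) :> fps A.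
Proof.
move=> z0; rewrite ps_subM2 //; apply/funext => m; rewrite /ps_sub /ev2.
(* The convolution as a sum over a square, so that sums can be exchanged; terms with r + s > m
   disappear because [z] has no constant term. *)
have fgE (t : 'I_m.+1) : (f * g) t
    = \sum_(r < m.+1) \sum_(s < m.+1) if (t == r + s :> nat)%N then f r * g s else 0.
  pose F r := if (r <= t)%N then f r * g (t - r)%N else 0.
  transitivity (\sum_(r < t.+1) F r).
    by rewrite fpsM; apply: eq_bigr => r _; rewrite /F -ltnS ltn_ord.
  rewrite (sum_widen (n := m.+1)) // => [|r tr]; last by rewrite /F leqNgt tr.
  apply: eq_bigr => r _; rewrite /F; case: leqP => rt.
    have tm : (t - r < m.+1)%N by rewrite (leq_ltn_trans (leq_subr _ _)).
    rewrite (bigD1 (Ordinal tm)) //= subnKC // eqxx big1 ?addr0 // => s.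
    by rewrite -val_eqE /= => sr; case: eqP => // ts; move: sr; rewrite ts addKn eqxx.
  by rewrite big1 // => s _; case: eqP => // ts; move: rt; rewrite ts ltnNge leq_addr.
under eq_bigr => t _ do rewrite fgE scaler_sumr.
rewrite exchange_big; apply: eq_bigr => r _.
under eq_bigr => t _ do rewrite scaler_sumr.
rewrite exchange_big; apply: eq_bigr => s _; rewrite -exprD.
case: (ltnP (r + s) m.+1) => rs.
  rewrite (bigD1 (Ordinal rs)) //= eqxx big1 ?addr0 // => t.
  by rewrite -val_eqE /= => /negPf ->; rewrite scaler0.
rewrite fps_order_exp // scale0r big1 // => t _; case: eqP => [ts|_]; last exact: scaler0.
by have := ltn_ord t; rewrite ts ltnNge rs.
Qed.

Lemma ps_sub1 z : ps_sub z (1 : fps A) = 1 :> fps A.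
Proof. by rewrite -(rmorph1 (@fps_const A)) ps_sub_const. Qed.

Lemma ps_sub_prod z (I : Type) (s : seq I) (F : I -> fps A) : z 0%N = 0 ->
  ps_sub z (\prod_(i <- s) F i) = \prod_(i <- s) (ps_sub z (F i) : fps A) :> fps A.
Proof.
move=> z0; elim: s => [|i s IH]; first by rewrite !big_nil ps_sub1.
by rewrite !big_cons ps_subM // IH.
Qed.

Lemma ps_sub_sum z (I : Type) (s : seq I) (F : I -> fps A) :
  ps_sub z (\sum_(i <- s) F i) = \sum_(i <- s) (ps_sub z (F i) : fps A) :> fps A.
Proof.
elim: s => [|i s IH]; last by rewrite !big_cons ps_subD IH.
by rewrite !big_nil -(rmorph0 (@fps_const A)) ps_sub_const.
Qed.

End Algebra.

Lemma ps_subX z w r : z 0%N = 0 ->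
  ps_sub z (w ^+ r : nat -> K^o) = (ps_sub z (w : nat -> K^o) : fps K) ^+ r :> fps K.
Proof.
move=> z0; elim: r => [|r IH]; first exact: (@ps_sub1 K^o).
by rewrite !exprS -IH; exact: (@ps_subM K^o).
Qed.

Lemma ps_sub_comp (A : algType K) z w (f : fps A) : z 0%N = 0 -> w 0%N = 0 ->
  ps_sub w (ps_sub z f) = ps_sub (ps_sub w (z : nat -> K^o) : fps K) f.
Proof.
move=> z0 w0; apply/funext => m; rewrite {1}/ps_sub.
under eq_bigr => t _ do rewrite (@ps_subE _ z f t m.+1) // scaler_sumr.
rewrite exchange_big; apply: eq_bigr => r _.
rewrite -ps_subX // scaler_suml; apply: eq_bigr => t _.
by rewrite scalerA.
Qed.

(** Iterated multiplication by a series is its power in the ring [fps K]. *)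
Lemma ps_affineE (A : algType K) (al ka : K) (f : nat -> A) m :
  ps_affine al ka f m = ps_sub (affine_inv al ka) f m.
Proof.
apply: eq_bigr => r _; congr (_ m *: _).
by elim: (r : nat) => // t IH; rewrite iterS IH exprS.
Qed.

End Substitution.

(** * Affine arguments and evaluation of two-variable relations *)

Section AffinePoints.
Variable K : fieldType.

(* h = u^-1; the argument al u + ka is represented by its product [pt al ka] with h. *)
Definition hX : fps K := fun m => (m == 1%N)%:R.

Definition pt (al ka : K) : fps K := fps_const al + fps_const ka * hX.

Lemma hXM (f : fps K) m : (hX * f) m = if m is m'.+1 then f m' else 0.
Proof.
case: m => [|m]; first by rewrite fpsM big_ord1 mul0r.
rewrite fpsM big_ord_recl mul0r add0r big_ord_recl /= mul1r subn1 /= big1 ?addr0 // => i _.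
by rewrite mul0r.
Qed.

Lemma hXZ (A : algType K) (f : fps A) m : (hX *: f) m.+1 = f m.
Proof.
rewrite fps_scaleE big_ord_recl scale0r add0r big_ord_recl /= scale1r subn1 /= big1 ?addr0 // => i _.
by rewrite scale0r.
Qed.

Lemma ptE0 al ka : pt al ka 0%N = al.
Proof. by rewrite /pt fpsD fps_constM mulr0 addr0. Qed.

Lemma ptE1 al ka : pt al ka 1%N = ka.
Proof. by rewrite /pt fpsD fps_constM mulr1 add0r. Qed.

Lemma pt_inv al ka : al != 0 -> pt al ka * affine_inv al ka = hX.
Proof.
move=> al0; apply/funext => -[|m].
  by rewrite fpsM big_ord1 mulr0.
rewrite /pt mulrDl -mulrA fpsD !fps_constM hXM.
by rewrite affine_invP // /hX.
Qed.

Lemma regular_unit (A : algType K) (c : fps K) : c 0%N != 0 -> regular (fps A) c.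
Proof.
move=> c0 f cf; apply/funext => m; elim/ltn_ind: m => m IH.
have := congr1 (fun g : fps A => g m) cf; rewrite /= fps_scaleE fps0 big_ord_recl subn0 big1.
  by rewrite addr0 => /eqP; rewrite scaler_eq0 (negPf c0) => /eqP.
by move=> i _; rewrite IH ?scaler0 //= /bump leq0n; have := ltn_ord i; lia.
Qed.

Lemma regular_hX (A : algType K) : regular (fps A) hX.
Proof. by move=> f hf; apply/funext => m; rewrite -hXZ hf. Qed.

(** The nonzero constant term makes [p] regular and h / p a series; shifts by h and the change of
    sign stay within these points. *)
Definition Upt (p : fps K) : Prop := exists2 al, al != 0 & exists ka, p = pt al ka.

Lemma Upt_reg (A : algType K) p : Upt p -> regular (fps A) p.
Proof. by case=> al al0 [ka ->]; apply: regular_unit; rewrite ptE0. Qed.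

Lemma Upt_h p : Upt p -> Upt (p + hX).
Proof.
case=> al al0 [ka ->]; exists al => //; exists (ka + 1).
by rewrite /pt -addrA rmorphD rmorph1 mulrDl mul1r.
Qed.

Lemma Upt_hm p : Upt p -> Upt (p - hX).
Proof.
case=> al al0 [ka ->]; exists al => //; exists (ka - 1).
by rewrite /pt -addrA rmorphB rmorph1 mulrBl mul1r.
Qed.

Lemma Upt_N p : Upt p -> Upt (- p).
Proof.
case=> al al0 [ka ->]; exists (- al); first by rewrite oppr_eq0.
by exists (- ka); rewrite /pt !rmorphN mulNr opprD.
Qed.

Lemma Upt_D p : (2%:R : K) != 0 -> Upt p -> Upt (p + p).
Proof.
move=> two0 [al al0 [ka ->]]; exists (al + al).
  by rewrite -mulr2n -mulr_natl mulf_neq0.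
by exists (ka + ka); rewrite /pt !rmorphD mulrDl addrACA.
Qed.

(** The series h / p, that is (al u + ka)^-1. Reading al and ka off from the coefficients makes it a
    function of [p]. *)
Definition pt_inv_of (p : fps K) : fps K := affine_inv (p 0%N) (p 1%N).

Lemma pt_invE p : Upt p -> p * pt_inv_of p = hX.
Proof. by case=> al al0 [ka ->]; rewrite /pt_inv_of ptE0 ptE1 pt_inv. Qed.

Section Relation.
Variable A : algType K.
Implicit Types X : int -> int -> A.

(** No positive powers of u or v; otherwise the index shifts below would bring new terms into the
    sums. *)
Definition vanish X := (forall n s, X (Negz n) s = 0) /\ (forall r n, X r (Negz n) = 0).

Definition ev p q X : fps A :=
  ev2 (pt_inv_of p) (pt_inv_of q) (fun r s : nat => X r%:Z s%:Z).

Definition shiftl X : int -> int -> A := fun r s => X (r - 1) s.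
Definition shiftr X : int -> int -> A := fun r s => X r (s - 1).

Lemma ev_shiftl p q X : vanish X ->
  pt_inv_of p *: ev p q X = ev p q (shiftl X).
Proof.
move=> [X0 _]; rewrite /ev /shiftl /shiftr; apply/funext => m; set z := pt_inv_of p; set w := pt_inv_of q.
transitivity (\sum_(r < m.+1) \sum_(s < m.+1) (z ^+ r.+1 * w ^+ s) m *: X r%:Z s%:Z).
  rewrite fps_scaleE.
  under eq_bigr => i _.
    rewrite (@ev2E _ _ z w _ (m - i) m.+1 m.+1) ?ltnS ?leq_subr // scaler_sumr.
    under eq_bigr => r _ do rewrite scaler_sumr.
    over.
  rewrite exchange_big; apply: eq_bigr => r _; rewrite exchange_big; apply: eq_bigr => s _.
  rewrite exprS -mulrA fpsM scaler_suml; apply: eq_bigr => i _; exact: scalerA.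
rewrite (@ev2E _ _ z w _ m m.+2 m.+1) // [RHS]big_ord_recl.
rewrite [X in _ = X + _]big1 ?add0r => [|s _]; last by rewrite (X0 0%N) scaler0.
apply: eq_bigr => r _; apply: eq_bigr => s _; congr (_ *: X _ _).
by rewrite lift0; lia.
Qed.

Lemma ev_shiftr p q X : vanish X ->
  pt_inv_of q *: ev p q X = ev p q (shiftr X).
Proof.
move=> [_ X0]; rewrite /ev /shiftl /shiftr; apply/funext => m; set z := pt_inv_of p; set w := pt_inv_of q.
transitivity (\sum_(r < m.+1) \sum_(s < m.+1) (z ^+ r * w ^+ s.+1) m *: X r%:Z s%:Z).
  rewrite fps_scaleE.
  under eq_bigr => i _.
    rewrite (@ev2E _ _ z w _ (m - i) m.+1 m.+1) ?ltnS ?leq_subr // scaler_sumr.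
    under eq_bigr => r _ do rewrite scaler_sumr.
    over.
  rewrite exchange_big; apply: eq_bigr => r _; rewrite exchange_big; apply: eq_bigr => s _.
  rewrite exprS mulrCA fpsM scaler_suml; apply: eq_bigr => i _; exact: scalerA.
rewrite (@ev2E _ _ z w _ m m.+1 m.+2) //; apply: eq_bigr => r _; rewrite [RHS]big_ord_recl (X0 _ 0%N).
rewrite scaler0 add0r; apply: eq_bigr => s _; congr (_ *: X _ _).
by rewrite lift0; lia.
Qed.

Lemma vanish_shiftl X : vanish X -> vanish (shiftl X).
Proof.
by move=> [X1 X2]; split=> // n s; rewrite /shiftl ?X2 // (_ : Negz n - 1 = Negz n.+1) ?X1 //; lia.
Qed.

Lemma vanish_shiftr X : vanish X -> vanish (shiftr X).
Proof.
by move=> [X1 X2]; split=> // r n; rewrite /shiftr ?X1 // (_ : Negz n - 1 = Negz n.+1) ?X2 //; lia.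
Qed.

Lemma evD p q X Y : ev p q (fun r s => X r s + Y r s) = ev p q X + ev p q Y.
Proof.
apply/funext => m; rewrite fpsD -big_split; apply: eq_bigr => r _; rewrite -big_split.
by apply: eq_bigr => s _; rewrite scalerDr.
Qed.

Lemma evN p q X : ev p q (fun r s => - X r s) = - ev p q X.
Proof.
apply/funext => m; rewrite fpsN -sumrN; apply: eq_bigr => r _; rewrite -sumrN.
by apply: eq_bigr => s _; rewrite scalerN.
Qed.

Lemma evZ p q (c : K) X : ev p q (fun r s => c *: X r s) = fps_const c *: ev p q X.
Proof.
apply/funext => m; rewrite fps_scaleE big_ord_recl subn0 [X in _ + X]big1 ?addr0 => [|i _].
  rewrite scaler_sumr; apply: eq_bigr => r _; rewrite scaler_sumr.
  by apply: eq_bigr => s _; rewrite !scalerA mulrC.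
by rewrite scale0r.
Qed.

Lemma ev_sum p q (I : finType) (F : I -> int -> int -> A) :
  ev p q (fun r s => \sum_i F i r s) = \sum_i ev p q (F i).
Proof.
apply/funext => m; rewrite fps_sum [RHS]exchange_big; apply: eq_bigr => r _.
rewrite exchange_big; apply: eq_bigr => s _; exact: scaler_sumr.
Qed.

Lemma eq_ev p q X Y : (forall r s : nat, X r%:Z s%:Z = Y r%:Z s%:Z) -> ev p q X = ev p q Y.
Proof.
by move=> XY; apply/funext => m; apply: eq_bigr => r _; apply: eq_bigr => s _; rewrite XY.
Qed.

(* [X], [P], [Q] carry the contributions of 1, P, Q to the RTT relation multiplied
   by u^2 - v^2; the points stand for u = p / h, v = q / h. *)
Lemma ev_relation p q X P Q : Upt p -> Upt q -> vanish X -> vanish P -> vanish Q ->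
    (forall r s, X (r + 2) s - X r (s + 2) - P (r + 1) s - P r (s + 1)
       + Q (r + 1) s - Q r (s + 1) = 0) ->
  (p * p - q * q) *: ev p q X = (hX * (p + q)) *: ev p q P - (hX * (p - q)) *: ev p q Q.
Proof.
move=> Up Uq vX vP vQ rel; set z := pt_inv_of p; set w := pt_inv_of q.
have pz : p * z = hX by exact: pt_invE.
have qw : q * w = hX by exact: pt_invE.
(* The relation multiplied by u^-2 v^-2, so that only the inverse arguments [z] and [w] occur. *)
have H : (w * w) *: ev p q X - (z * z) *: ev p q X - (z * (w * w)) *: ev p q P
   - (z * (z * w)) *: ev p q P + (z * (w * w)) *: ev p q Q - (z * (z * w)) *: ev p q Q = 0.
  rewrite -!scalerA !ev_shiftr ?ev_shiftl; try by
    do ?[exact: vX | exact: vP | exact: vQ | apply: vanish_shiftl | apply: vanish_shiftr].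
  rewrite -!evN -!evD; apply/funext => m; apply: big1 => r _; apply: big1 => s _.
  have := rel (r%:Z - 2) (s%:Z - 2); rewrite !subrK /shiftl /shiftr.
  have -> : r%:Z - 1 - 1 = r%:Z - 2 by lia.
  have -> : s%:Z - 1 - 1 = s%:Z - 2 by lia.
  have -> : r%:Z - 2 + 1 = r%:Z - 1 by lia.
  have -> : s%:Z - 2 + 1 = s%:Z - 1 by lia.
  by move=> ->; rewrite scaler0.
(* Since p z = q w = h, multiplying [H] by p^2 q^2 gives h^2 times the claim. *)
have reg : regular (fps A) (hX * hX) by exact: (regularM (@regular_hX A) (@regular_hX A)).
apply: (regular_eq reg).
apply/eqP; rewrite -subr_eq0; apply/eqP.
transitivity ((p * p * q * q) *: ((w * w) *: ev p q X - (z * z) *: ev p q X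
   - (z * (w * w)) *: ev p q P - (z * (z * w)) *: ev p q P
   + (z * (w * w)) *: ev p q Q - (z * (z * w)) *: ev p q Q)); last by rewrite H scaler0.
have E1 : p * p * q * q * (w * w) = hX * hX * (p * p) by rewrite -qw; ring.
have E2 : p * p * q * q * (z * z) = hX * hX * (q * q) by rewrite -pz; ring.
have E3 : p * p * q * q * (z * (w * w)) = hX * hX * hX * p.
  by rewrite -{1 2}qw -pz; ring.
have E4 : p * p * q * q * (z * (z * w)) = hX * hX * hX * q.
  by rewrite -{1 2}pz -qw; ring.
rewrite !(scalerDr, scalerN) !scalerA E1 E2 E3 E4; lin_ring (fps K) (fps A).
Qed.

(** Without a contribution of Q all terms share the factor u + v. It must be divided out before
    evaluating, because p + q is zero at [q = - p]. *)
Lemma ev_relation1 p q X P : Upt p -> Upt q -> vanish X -> vanish P ->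
    (forall r s, X (r + 2) s - X r (s + 2) - P (r + 1) s - P r (s + 1) = 0) ->
  (p - q) *: ev p q X = hX *: ev p q P.
Proof.
move=> Up Uq vX vP rel; set z := pt_inv_of p; set w := pt_inv_of q.
have pz : p * z = hX by exact: pt_invE.
have qw : q * w = hX by exact: pt_invE.
(* The relation is divisible by u + v: [W (r + 1) s = - W r (s + 1)], and [W]
   vanishes for s < -1. *)
pose W r s := X (r + 1) s - X r (s + 1) - P r s.
have WS r s : W r s = - W (r + 1) (s - 1).
  apply/eqP; rewrite -subr_eq0 opprK; apply/eqP; rewrite -[RHS](rel r (s - 1)) /W subrK.
  have -> : r + 1 + 1 = r + 2 by lia.
  have -> : s - 1 + 2 = s + 1 by lia.
  lin_ring K A.
have W0 n r s : (s + 1 < n%:Z)%R -> W r s = 0.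
  elim: n r s => [|n IH] r s sn; last by rewrite WS IH ?oppr0 //; lia.
  case: vX vP => [_ X0] [_ P0]; have [m ->] : exists m, s = Negz m.+1.
    by exists (`|s|.-2)%N; lia.
  by rewrite /W X0 P0 (_ : Negz m.+1 + 1 = Negz m) ?X0 ?subrr ?subr0 //; lia.
have rel1 r s : X (r + 1) s - X r (s + 1) - P r s = 0.
  by apply: (W0 (`|s| + 2)%N); lia.
have H : w *: ev p q X - z *: ev p q X - (z * w) *: ev p q P = 0.
  rewrite -scalerA !ev_shiftr ?ev_shiftl; try by
    do ?[exact: vX | exact: vP | apply: vanish_shiftl | apply: vanish_shiftr].
  rewrite -!evN -!evD; apply/funext => m; apply: big1 => r _; apply: big1 => s _.
  by have := rel1 (r%:Z - 1) (s%:Z - 1); rewrite !subrK /shiftl /shiftr => ->; rewrite scaler0.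
apply: (regular_eq (@regular_hX A)); apply/eqP; rewrite -subr_eq0; apply/eqP.
transitivity ((p * q) *: (w *: ev p q X - z *: ev p q X - (z * w) *: ev p q P));
  last by rewrite H scaler0.
have E1 : p * q * w = hX * p by rewrite -qw; ring.
have E2 : p * q * z = hX * q by rewrite -pz; ring.
have E3 : p * q * (z * w) = hX * hX by rewrite -{1}pz -qw; ring.
rewrite !(scalerDr, scalerN) !scalerA E1 E2 E3; lin_ring (fps K) (fps A).
Qed.

End Relation.
End AffinePoints.

(** * Components of the defining relations *)

Section RTTComponents.
Variables (K : fieldType) (A : superAlgType K) (N : nat).
Variable t : sidx N -> sidx N -> int -> A.
Hypothesis ht : forall i j r, hom (bar i (+) bar j) (t i j r).
Implicit Types R X Y : tens2 A N.

Local Notation sgn b := ((-1) ^+ nat_of_bool b).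

Definition rtt_left R r s : tens2 A N :=
  tens2_mul (tens2_mul R (T1coef t r)) (T2coef t s).
Definition rtt_right R r s : tens2 A N :=
  tens2_mul (tens2_mul (T2coef t s) (T1coef t r)) R.

Lemma tens2_mul_hom d (x y : A) (a b j k l : sidx N) : hom d x ->
  \sum_(e : bool) sgn (((bar a (+) bar j) && (bar k (+) bar b (+) e))
      (+) ((bar b (+) bar l) && e)) *: (part e x * y)
  = sgn (((bar a (+) bar j) && (bar k (+) bar b (+) d)) (+) ((bar b (+) bar l) && d)) *: (x * y).
Proof.
move=> hx; rewrite big_bool !(part_hom _ hx).
by case: d {hx}; rewrite /= mul0r scaler0 ?addr0 ?add0r.
Qed.

Definition scalar_tens R := forall i j k l, hom false (R i j k l).

Lemma even2_T1 r : even2 (T1coef t r).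
Proof.
move=> i j k l; rewrite /T1coef; case: (k =P l) => [->|_].
  by rewrite mul1r /idx_deg -addbA addbb addbF; exact: ht.
by rewrite mul0r; exact: hom0.
Qed.

(** The entries of [R] are even, and T_1 and T_2 are each diagonal in one tensor factor; only two
    column indices of [R] remain to be summed. *)
Lemma rtt_leftE R r s i j k l : scalar_tens R -> even2 R ->
  rtt_left R r s i j k l = \sum_a \sum_b
    sgn (((bar b (+) bar l) && (bar i (+) bar j (+) bar k (+) bar b))
      (+) ((bar a (+) bar j) && (bar k (+) bar b)))
    *: (R i a k b * t a j r * t b l s).
Proof.
move=> sR eR.
have E1 i' j' k' l' : tens2_mul R (T1coef t r) i' j' k' l'
    = \sum_a sgn ((bar a (+) bar j') && (bar k' (+) bar l')) *: (R i' a k' l' * t a j' r).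
  apply: eq_bigr => a _; rewrite (bigD1 l') //= [X in _ + X]big1 ?addr0 => [|b bl].
    by rewrite (tens2_mul_hom _ _ _ _ _ _ (sR i' a k' l')) /T1coef eqxx mul1r addbF andbF addbF.
  by rewrite big1 // => d _; rewrite /T1coef (negPf bl) mul0r mulr0 scaler0.
rewrite /rtt_left {1}/tens2_mul (bigD1 j) //= [X in _ + X]big1 ?addr0 => [|a aj]; last first.
  rewrite big1 // => b _; rewrite big1 // => d _.
  by rewrite /T2coef (negPf aj) mul0r mulr0 scaler0.
rewrite [RHS]exchange_big; apply: eq_bigr => b _.
rewrite (tens2_mul_hom _ _ _ _ _ _ (even2_mul eR (@even2_T1 r) i j k b)).
rewrite /T2coef eqxx mul1r addbb /= E1 mulr_suml scaler_sumr.
apply: eq_bigr => a _; rewrite -scalerAl scalerA -signr_addb; congr (_ *: _).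
Qed.

Lemma rtt_rightE R r s i j k l :
  rtt_right R r s i j k l = \sum_a \sum_b
    sgn (((bar a (+) bar j) && (bar i (+) bar a))
      (+) ((bar b (+) bar l) && (bar k (+) bar b (+) bar i (+) bar a)))
    *: (t k b s * t i a r * R a j b l).
Proof.
have E1 i' j' k' l' : tens2_mul (T2coef t s) (T1coef t r) i' j' k' l'
    = t k' l' s * t i' j' r.
  rewrite /tens2_mul (bigD1 i') //= [X in _ + X]big1 ?addr0 => [|a ai]; last first.
    rewrite big1 // => b _; rewrite big1 // => d _.
    by rewrite /T2coef [i' == a]eq_sym (negPf ai) mul0r linear0 mul0r scaler0.
  rewrite (bigD1 l') //= [X in _ + X]big1 ?addr0 => [|b bl]; last first.
    by rewrite big1 // => d _; rewrite /T1coef (negPf bl) mul0r mulr0 scaler0.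
  rewrite /T2coef eqxx mul1r.
  by rewrite (tens2_mul_hom _ _ _ _ _ _ (ht k' l' s)) /T1coef eqxx mul1r addbb andbF addbb scale1r.
rewrite /rtt_right {1}/tens2_mul; apply: eq_bigr => a _; apply: eq_bigr => b _.
rewrite E1 (tens2_mul_hom _ _ _ _ _ _ (homM (ht k b s) (ht i a r))).
by congr (sgn _ *: _); do !case: (bar _).
Qed.

Lemma scalar_tens_1 : scalar_tens (@tens2_1 K A N).
Proof. by move=> i j k l; exact: hom_nat. Qed.

Lemma scalar_tens_P : scalar_tens (@tens2_P K A N).
Proof. by move=> i j k l; exact: (homM (hom_nat _ _) (hom_sign _ _)). Qed.

Lemma scalar_tens_Q : scalar_tens (@tens2_Q K A N).
Proof. by move=> i j k l; exact: (homM (hom_nat _ _) (hom_sign _ _)). Qed.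

Lemma tens2_mulDl X Y Z i j k l :
  tens2_mul (fun i j k l => X i j k l + Y i j k l) Z i j k l
  = tens2_mul X Z i j k l + tens2_mul Y Z i j k l.
Proof.
rewrite -big_split; apply: eq_bigr => a _; rewrite -big_split; apply: eq_bigr => b _.
rewrite -big_split; apply: eq_bigr => d _ /=.
by rewrite linearD mulrDl scalerDr.
Qed.

Lemma tens2_mulNl X Z i j k l :
  tens2_mul (fun i j k l => - X i j k l) Z i j k l = - tens2_mul X Z i j k l.
Proof.
rewrite -sumrN; apply: eq_bigr => a _; rewrite -sumrN; apply: eq_bigr => b _.
rewrite -sumrN; apply: eq_bigr => d _.
by rewrite linearN mulNr scalerN.
Qed.

Lemma tens2_mulDr X Y Z i j k l :
  tens2_mul Z (fun i j k l => X i j k l + Y i j k l) i j k l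
  = tens2_mul Z X i j k l + tens2_mul Z Y i j k l.
Proof.
rewrite -big_split; apply: eq_bigr => a _; rewrite -big_split; apply: eq_bigr => b _.
rewrite -big_split; apply: eq_bigr => d _ /=.
by rewrite mulrDr scalerDr.
Qed.

Lemma tens2_mulNr X Z i j k l :
  tens2_mul Z (fun i j k l => - X i j k l) i j k l = - tens2_mul Z X i j k l.
Proof.
rewrite -sumrN; apply: eq_bigr => a _; rewrite -sumrN; apply: eq_bigr => b _.
rewrite -sumrN; apply: eq_bigr => d _.
by rewrite mulrN scalerN.
Qed.

Lemma tens2_mul0l Z i j k l : tens2_mul (fun _ _ _ _ : sidx N => 0 : A) Z i j k l = 0.
Proof.
rewrite /tens2_mul big1 // => a _; rewrite big1 // => b _; rewrite big1 // => d _.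
by rewrite linear0 mul0r scaler0.
Qed.

Lemma tens2_mul0r Z i j k l : tens2_mul Z (fun _ _ _ _ : sidx N => 0 : A) i j k l = 0.
Proof.
rewrite /tens2_mul big1 // => a _; rewrite big1 // => b _; rewrite big1 // => d _.
by rewrite mulr0 scaler0.
Qed.

Lemma tens2_funext X Y : (forall i j k l, X i j k l = Y i j k l) -> X = Y.
Proof. by move=> XY; do 4!apply/funext => ?. Qed.

Definition rtt_comm R r s i j k l : A :=
  rtt_left R r s i j k l - rtt_right R r s i j k l.

Lemma rtt_commD X Y r s i j k l :
  rtt_comm (fun i j k l => X i j k l + Y i j k l) r s i j k l
  = rtt_comm X r s i j k l + rtt_comm Y r s i j k l.
Proof.
rewrite /rtt_comm /rtt_left /rtt_right tens2_mulDr.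
rewrite (tens2_funext (tens2_mulDl X Y (T1coef t r))) tens2_mulDl; lin_ring K A.
Qed.

Lemma rtt_commN X r s i j k l :
  rtt_comm (fun i j k l => - X i j k l) r s i j k l = - rtt_comm X r s i j k l.
Proof.
rewrite /rtt_comm /rtt_left /rtt_right tens2_mulNr.
rewrite (tens2_funext (tens2_mulNl X (T1coef t r))) tens2_mulNl; lin_ring K A.
Qed.

Lemma rtt_comm0 r s i j k l : rtt_comm (fun _ _ _ _ : sidx N => 0 : A) r s i j k l = 0.
Proof.
rewrite /rtt_comm /rtt_left /rtt_right tens2_mul0r.
by rewrite (tens2_funext (tens2_mul0l (T1coef t r))) tens2_mul0l subrr.
Qed.

Local Notation C1 := (rtt_comm (@tens2_1 K A N)).
Local Notation CP := (rtt_comm (@tens2_P K A N)).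
Local Notation CQ := (rtt_comm (@tens2_Q K A N)).

Lemma rtt_relE r s i j k l : rtt_rel t r s i j k l
  = C1 (r + 2) s i j k l - C1 r (s + 2) i j k l - CP (r + 1) s i j k l
    - CP r (s + 1) i j k l + CQ (r + 1) s i j k l - CQ r (s + 1) i j k l.
Proof.
have H : rtt_rel t r s i j k l
    = \sum_(a < 3) \sum_(b < 3) rtt_comm (@Rcoef K A N a b) (r + a%:Z) (s + b%:Z) i j k l by [].
rewrite H !big_ord_recl !big_ord0 /= !rtt_comm0 /bump /= !addr0 !add0r.
rewrite !rtt_commD !rtt_commN; lin_ring K A.
Qed.

Lemma sum_delta2 (I J : finType) (V : zmodType) (F : I -> J -> V) i0 j0 :
    (forall i j, ~~ ((i == i0) && (j == j0)) -> F i j = 0) ->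
  \sum_i \sum_j F i j = F i0 j0.
Proof.
move=> F0; rewrite (bigD1 i0) //= [X in _ + X]big1 ?addr0 => [|i ii]; last first.
  by rewrite big1 // => j _; rewrite F0 // (negPf ii).
by rewrite (bigD1 j0) //= big1 ?addr0 // => j jj; rewrite F0 // (negPf jj) andbF.
Qed.

Lemma rtt_comm1E r s i j k l : C1 r s i j k l
  = sgn ((bar i (+) bar j) && (bar k (+) bar l)) *: (t i j r * t k l s) - t k l s * t i j r.
Proof.
rewrite /rtt_comm rtt_leftE; [|exact: scalar_tens_1|exact: even2_1].
rewrite rtt_rightE (sum_delta2 (i0 := i) (j0 := k)) => [|a b]; last first.
  by rewrite /tens2_1 [i == a]eq_sym [k == b]eq_sym => /negPf ->; rewrite !mul0r scaler0.
rewrite (sum_delta2 (i0 := j) (j0 := l)) => [|a b]; last first.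
  by rewrite /tens2_1 => /negPf ->; rewrite mulr0 scaler0.
rewrite /tens2_1 !eqxx mul1r mulr1; congr (_ *: _ - _).
  by do !case: (bar _).
by rewrite -[RHS]scale1r; congr (_ *: _); do !case: (bar _).
Qed.

Lemma signEl (b c : bool) (x y : A) :
  sgn b *: ((-1) ^+ nat_of_bool c * x * y) = sgn (b (+) c) *: (x * y).
Proof.
by case: b c => [] []; rewrite /= ?expr0 ?expr1 ?mul1r ?mulN1r ?mulNr ?scale1r ?scaleN1r ?opprK.
Qed.

Lemma signEr (b c : bool) (x : A) :
  sgn b *: (x * (-1) ^+ nat_of_bool c) = sgn (b (+) c) *: x.
Proof.
by case: b c => [] []; rewrite /= ?expr0 ?expr1 ?mulr1 ?mulrN1 ?scale1r ?scaleN1r ?opprK.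
Qed.

Lemma rtt_commPE r s i j k l : CP r s i j k l
  = sgn (((bar i (+) bar l) && (bar j (+) bar k)) (+) ((bar k (+) bar j) && (bar k (+) bar i))
      (+) bar k) *: (t k j r * t i l s)
    - sgn (((bar l (+) bar j) && (bar i (+) bar l))
        (+) ((bar j (+) bar l) && (bar k (+) bar j (+) bar i (+) bar l)) (+) bar j)
      *: (t k j s * t i l r).
Proof.
rewrite /rtt_comm rtt_leftE; [|exact: scalar_tens_P|exact: even2_P].
rewrite rtt_rightE (sum_delta2 (i0 := k) (j0 := i)) => [|a b]; last first.
  by rewrite /tens2_P [k == a]eq_sym => /negPf ->; rewrite !mul0r scaler0.
rewrite (sum_delta2 (i0 := l) (j0 := j)) => [|a b]; last first.
  by rewrite /tens2_P [l == a]eq_sym andbC => /negPf ->; rewrite mul0r mulr0 scaler0.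
rewrite /tens2_P !eqxx !mul1r; congr (_ - _).
  rewrite signEl; congr (sgn _ *: _).
  by do !case: (bar _).
rewrite signEr; congr (sgn _ *: _).
Qed.

Lemma rtt_commQE r s i j k l : CQ r s i j k l
  = (if k == sneg i then \sum_a
       sgn (((~~ bar a (+) bar l) && (bar j (+) bar a)) (+) ((bar a (+) bar j) && (bar i (+) bar a))
         (+) (bar i && bar a) (+) bar i (+) bar a) *: (t a j r * t (sneg a) l s) else 0)
    - (if l == sneg j then \sum_a
       sgn (((bar a (+) bar j) && (bar i (+) bar a)) (+)
         ((bar a (+) bar j) && ~~ (bar k (+) bar i))
         (+) (bar a && bar j) (+) bar a (+) bar j) *: (t k (sneg a) s * t i a r) else 0).
Proof.
rewrite /rtt_comm rtt_leftE; [|exact: scalar_tens_Q|exact: even2_Q].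
rewrite rtt_rightE; congr (_ - _).
  case: eqP => [->|ki]; last first.
    rewrite big1 // => a _; rewrite big1 // => b _.
    by rewrite /tens2_Q; case: eqP => // _; rewrite !mul0r scaler0.
  apply: eq_bigr => a _; rewrite (bigD1 (sneg a)) //= big1 ?addr0 => [|b ba]; last first.
    by rewrite /tens2_Q (negPf ba) andbF !mul0r scaler0.
  rewrite /tens2_Q !eqxx mul1r signEl; congr (sgn _ *: _).
  by rewrite /bar /sneg /=; case: i.1; case: j.1; case: a.1; case: l.1.
case: eqP => [->|lj]; last first.
  rewrite big1 // => a _; rewrite big1 // => b _.
  by rewrite /tens2_Q; case: (l =P _) => // _; rewrite andbF mul0r mulr0 scaler0.
apply: eq_bigr => a _; rewrite (bigD1 (sneg a)) //= big1 ?addr0 => [|b ba]; last first.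
  by rewrite /tens2_Q (negPf ba) mul0r mulr0 scaler0.
rewrite /tens2_Q !eqxx mul1r signEr; congr (sgn _ *: _).
by rewrite /bar /sneg /=; case: i.1; case: j.1; case: a.1; case: k.1.
Qed.

End RTTComponents.

Lemma sum_only (V : nmodType) (I : finType) (F : I -> V) i0 :
  (forall i, i != i0 -> F i = 0) -> \sum_i F i = F i0.
Proof. by move=> F0; rewrite (bigD1 i0) //= big1 ?addr0. Qed.

(** * The defining relations in terms of the four blocks *)

Section RTTAlgebra.
Variables (K : fieldType) (A : superAlgType K) (N : nat).
Variable t : sidx N -> sidx N -> int -> A.
Hypothesis ht : forall i j r, hom (bar i (+) bar j) (t i j r).
Hypothesis t0 : forall i j, t i j 0 = (i == j)%:R.
Hypothesis t_neg : forall i j n, t i j (Negz n) = 0.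
Hypothesis rtt0 : forall r s i j k l, rtt_rel t r s i j k l = 0.

Definition nspos (k : 'I_N) : sidx N := sneg (spos k).

Local Notation a i j r := (t (spos i) (spos j) r).
Local Notation b i j r := (t (spos i) (nspos j) r).
Local Notation c i j r := (t (nspos i) (spos j) r).
Local Notation d i j r := (t (nspos i) (nspos j) r).

Local Notation C1 := (rtt_comm t (@tens2_1 K A N)).
Local Notation CP := (rtt_comm t (@tens2_P K A N)).
Local Notation CQ := (rtt_comm t (@tens2_Q K A N)).

Lemma sum_sidx (V : zmodType) (F : sidx N -> V) :
  \sum_i F i = \sum_k (F (spos k) + F (nspos k)).
Proof.
rewrite big_split (eq_bigr (fun i : sidx N => F (i.1, i.2))) => [|[] //].
by rewrite -(pair_bigA _ (fun e k => F (e, k))) /= big_bool addrC.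
Qed.

Lemma spos_eq k l : (spos k == spos l :> sidx N) = (k == l).
Proof. by apply/eqP/eqP => [[]|->]. Qed.

Lemma nspos_eq k l : (nspos k == nspos l) = (k == l).
Proof. by apply/eqP/eqP => [[]|->]. Qed.

Lemma commAA1 r s i j k l : C1 r s (spos i) (spos j) (spos k) (spos l)
  = a i j r * a k l s - a k l s * a i j r.
Proof. by rewrite rtt_comm1E // scale1r. Qed.

Lemma commAAP r s i j k l : CP r s (spos i) (spos j) (spos k) (spos l)
  = a k j r * a i l s - a k j s * a i l r.
Proof. by rewrite rtt_commPE // !scale1r. Qed.

Lemma commAAQ r s i j k l : CQ r s (spos i) (spos j) (spos k) (spos l) = 0.
Proof. by rewrite rtt_commQE // subrr. Qed.

Lemma commAB1 r s i j k l : C1 r s (spos i) (spos j) (spos k) (nspos l)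
  = a i j r * b k l s - b k l s * a i j r.
Proof. by rewrite rtt_comm1E // scale1r. Qed.

Lemma commABP r s i j k l : CP r s (spos i) (spos j) (spos k) (nspos l)
  = a k j r * b i l s - a k j s * b i l r.
Proof. by rewrite rtt_commPE // !scale1r. Qed.

Lemma commABQ r s i j k l : CQ r s (spos i) (spos j) (spos k) (nspos l)
  = - ((j == l)%:R * \sum_p (b k p s * a i p r - a k p s * b i p r)).
Proof.
rewrite rtt_commQE // (_ : (spos k == _) = false) // sub0r; congr (- _).
rewrite (_ : (_ == sneg _) = (j == l)); last by rewrite nspos_eq eq_sym.
case: eqP => _; rewrite ?mul0r // mul1r sum_sidx; apply: eq_bigr => p _.
by rewrite /= scale1r scaleN1r.
Qed.

Lemma commAC1 r s i j k l : C1 r s (spos i) (spos j) (nspos k) (spos l)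
  = a i j r * c k l s - c k l s * a i j r.
Proof. by rewrite rtt_comm1E // scale1r. Qed.

Lemma commACP r s i j k l : CP r s (spos i) (spos j) (nspos k) (spos l)
  = c k j r * a i l s - c k j s * a i l r.
Proof. by rewrite rtt_commPE // !scale1r. Qed.

Lemma commACQ r s i j k l : CQ r s (spos i) (spos j) (nspos k) (spos l)
  = (i == k)%:R * \sum_p (a p j r * c p l s + c p j r * a p l s).
Proof.
rewrite rtt_commQE // (_ : (spos l == _) = false) // subr0.
rewrite (_ : (_ == sneg _) = (i == k)); last by rewrite nspos_eq eq_sym.
case: eqP => _; rewrite ?mul0r // mul1r sum_sidx; apply: eq_bigr => p _.
by rewrite /= !scale1r.
Qed.

Lemma commBC1 r s i j k l : C1 r s (spos i) (nspos j) (nspos k) (spos l)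
  = - (b i j r * c k l s + c k l s * b i j r).
Proof. by rewrite rtt_comm1E // /= scaleN1r -opprD. Qed.

(** At s = 0 the second matrix is the identity and the products collapse; this is the case that
    enters [rtt_first]. *)
Lemma commBCP r i j k l : CP r 0 (spos i) (nspos j) (nspos k) (spos l)
  = - ((i == l)%:R * d k j r) + (k == j)%:R * a i l r.
Proof.
rewrite rtt_commPE // /= !t0 spos_eq nspos_eq !scaleN1r opprK.
by congr (- _ + _); rewrite -?commr_nat.
Qed.

Lemma commBCQ r i j k l : CQ r 0 (spos i) (nspos j) (nspos k) (spos l)
  = - ((i == k)%:R * d l j r) + (j == l)%:R * a i k r.
Proof.
rewrite rtt_commQE // (_ : (nspos k == sneg _) = (i == k)); last by rewrite eq_sym nspos_eq.
rewrite (_ : (spos l == sneg _) = (j == l)); last by rewrite eq_sym spos_eq.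
congr (_ + _).
  case: eqP => _; rewrite ?mul0r ?oppr0 // mul1r (bigD1 (nspos l)) //= big1 => [|x xl].
    by rewrite t0 eqxx mulr1 addr0 scaleN1r.
  rewrite t0 (_ : (sneg x == spos l) = false) ?mulr0 ?scaler0 //.
  by apply/negP => /eqP e; case/eqP: xl; case: x e => [[] x] [] // ->.
case: eqP => _; rewrite ?mul0r ?oppr0 // mul1r (bigD1 (spos k)) //= big1 => [|x xl].
  by rewrite t0 eqxx mul1r addr0 scaleN1r opprK.
rewrite t0 (_ : (nspos k == sneg x) = false) ?mul0r ?scaler0 //.
by apply/negP => /eqP e; case/eqP: xl; case: x e => [[] x] [] // ->.
Qed.

(** This is the coefficient of v^1 in the relation, s = -1: negative indices vanish, and the term
    with T^(1) comes from - v^2. *)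
Lemma rtt_first r i j k l : C1 r 1 i j k l = - CP r 0 i j k l - CQ r 0 i j k l.
Proof.
have vC R i' j' k' l' r' n : even2 R -> scalar_tens R ->
    rtt_comm t R r' (Negz n) i' j' k' l' = 0.
  move=> eR sR; rewrite /rtt_comm rtt_leftE // rtt_rightE //.
  rewrite !big1 ?subrr // => x _; rewrite big1 // => y _; rewrite t_neg.
    by rewrite !mul0r scaler0.
  by rewrite mulr0 scaler0.
have e1 := @even2_1 K A N; have eP := @even2_P K A N; have eQ := @even2_Q K A N.
have s1 := @scalar_tens_1 K A N; have sP := @scalar_tens_P K A N.
have sQ := @scalar_tens_Q K A N.
have := rtt0 r (-1) i j k l; rewrite rtt_relE //.
rewrite (_ : -1 + 2 = 1) // (_ : -1 + 1 = 0) // (_ : -1 = Negz 0) // !vC // => H.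
apply/eqP; rewrite -subr_eq0; apply/eqP; rewrite -[RHS]oppr0 -H; lin_ring K A.
Qed.

(** For [k = l] the right side is 0, so only the off-diagonal b_kl^(1) produce further
    generators. *)
Lemma commAB_first r i j k l : a i j r * b k l 1 - b k l 1 * a i j r
  = (k == j)%:R * b i l r - (j == l)%:R * b i k r.
Proof.
rewrite -commAB1 rtt_first commABP commABQ.
have b0 x y : b x y 0 = 0 by rewrite t0.
rewrite !b0 mulr0 sub0r t0 spos_eq opprK; congr (_ - _).
case: eqP => _; rewrite ?mul0r ?oppr0 // !mul1r.
rewrite -[b i k r]opprK; congr (- _).
rewrite (@sum_only A 'I_N (fun p => b k p 0 * a i p r - a k p 0 * b i p r) k) => [|p pk]; last first.
  by rewrite b0 t0 spos_eq eq_sym (negPf pk) !mul0r subrr.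
by rewrite b0 t0 eqxx mul0r mul1r sub0r.
Qed.

Lemma commAC_first r i j k : a i j r * c k k 1 - c k k 1 * a i j r
  = - ((i == k)%:R * c k j r *+ 2).
Proof.
rewrite -commAC1 rtt_first commACP commACQ.
have c0 x y : c x y 0 = 0 by rewrite t0.
rewrite c0 mul0r subr0 t0 spos_eq (commr_nat (c k j r)) mulr2n opprD; congr (- _ - _).
congr (_ * _); rewrite (@sum_only A 'I_N (fun p => a p j r * c p k 0 + c p j r * a p k 0) k) => [|p pk]; last first.
  by rewrite c0 t0 spos_eq (negPf pk) !mulr0 addr0.
by rewrite c0 t0 eqxx mulr0 mulr1 add0r.
Qed.

Lemma commBC_first r j k : b k j r * c k k 1 + c k k 1 * b k j r
  = (k == j)%:R * a k k r *+ 2 - d k j r *+ 2.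
Proof.
rewrite -[LHS]opprK -commBC1 rtt_first commBCP commBCQ !eqxx !mul1r (eq_sym j); lin_ring K A.
Qed.

Definition Tpt (p : fps K) (i j : sidx N) : fps A :=
  ps_sub (pt_inv_of p) (fun r : nat => t i j r%:Z).

Local Notation aE p i j := (Tpt p (spos i) (spos j)).
Local Notation bE p i j := (Tpt p (spos i) (nspos j)).
Local Notation cE p i j := (Tpt p (nspos i) (spos j)).

Lemma Tpt_mul p q i j k l :
  Tpt p i j * Tpt q k l = ev p q (fun r s => t i j r * t k l s).
Proof. exact: ps_subM2. Qed.

Lemma Tpt_mulr p q i j k l :
  Tpt q k l * Tpt p i j = ev p q (fun r s => t k l s * t i j r).
Proof. exact: ps_subM2r. Qed.

Lemma vanish_mul i j k l : vanish (fun r s => t i j r * t k l s).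
Proof. by split=> *; rewrite t_neg ?mul0r ?mulr0. Qed.

Lemma vanish_mulr i j k l : vanish (fun r s => t k l s * t i j r).
Proof. by split=> *; rewrite t_neg ?mul0r ?mulr0. Qed.

Lemma vanishD (X Y : int -> int -> A) : vanish X -> vanish Y -> vanish (fun r s => X r s + Y r s).
Proof. by move=> [X1 X2] [Y1 Y2]; split=> *; rewrite ?X1 ?Y1 ?X2 ?Y2 addr0. Qed.

Lemma vanishN (X : int -> int -> A) : vanish X -> vanish (fun r s => - X r s).
Proof. by move=> [X1 X2]; split=> *; rewrite ?X1 ?X2 oppr0. Qed.

Lemma vanish_sum (F : 'I_N -> int -> int -> A) : (forall p, vanish (F p)) ->
  vanish (fun r s => \sum_p F p r s).
Proof.
by move=> F0; split=> *; apply: big1 => p _; case: (F0 p) => [F1 F2]; rewrite ?F1 ?F2.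
Qed.

Lemma vanishM (x : A) (X : int -> int -> A) : vanish X -> vanish (fun r s => x * X r s).
Proof. by move=> [X1 X2]; split=> *; rewrite ?X1 ?X2 mulr0. Qed.

Lemma ev_nat p q (n : nat) (X : int -> int -> A) :
  ev p q (fun r s => n%:R * X r s) = n%:R * ev p q X.
Proof.
rewrite (@eq_ev _ _ p q _ (fun r s => n%:R *: X r s)) => [|r s]; last by rewrite scaler_nat mulr_natl.
by rewrite evZ rmorph_nat scaler_nat mulr_natl.
Qed.

Lemma relAA p q i j k l : Upt p -> Upt q ->
  (p - q) *: (aE p i j * aE q k l - aE q k l * aE p i j)
  = hX K *: (aE p k j * aE q i l - aE q k j * aE p i l).
Proof.
move=> Up Uq; rewrite Tpt_mul Tpt_mulr -evN -evD.
rewrite Tpt_mul Tpt_mulr -evN -evD.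
apply: ev_relation1 => //.
- by apply: vanishD; [exact: vanish_mul|apply: vanishN; exact: vanish_mulr].
- by apply: vanishD; [exact: vanish_mul|apply: vanishN; exact: vanish_mulr].
move=> r s; have := rtt0 r s (spos i) (spos j) (spos k) (spos l).
by rewrite rtt_relE // !commAA1 !commAAP !commAAQ subr0 addr0.
Qed.

Lemma relAB p q i j k l : Upt p -> Upt q ->
  (p * p - q * q) *: (aE p i j * bE q k l - bE q k l * aE p i j)
  = (hX K * (p + q)) *: (aE p k j * bE q i l - aE q k j * bE p i l)
    + ((j == l)%:R * hX K * (p - q)) *: \sum_r (bE q k r * aE p i r - aE q k r * bE p i r).
Proof.
move=> Up Uq; rewrite Tpt_mul Tpt_mulr -evN -evD.
rewrite Tpt_mul Tpt_mulr -evN -evD.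
have sE : \sum_r (bE q k r * aE p i r - aE q k r * bE p i r)
    = ev p q (fun r s => \sum_x (b k x s * a i x r - a k x s * b i x r)).
  rewrite ev_sum; apply: eq_bigr => x _.
  by rewrite evD evN !Tpt_mulr.
rewrite sE -mulrA -[(_%:R * _) *: _]scalerA scaler_nat -mulr_natl -scalerAr -ev_nat -[X in _ = _ + X]opprK -scalerN -evN.
apply: ev_relation => //.
- by apply: vanishD; [exact: vanish_mul|apply: vanishN; exact: vanish_mulr].
- by apply: vanishD; [exact: vanish_mul|apply: vanishN; exact: vanish_mulr].
- apply: vanishN; apply: vanishM; apply: vanish_sum => x.
  by apply: vanishD; [exact: vanish_mulr|apply: vanishN; exact: vanish_mulr].
move=> r s; have := rtt0 r s (spos i) (spos j) (spos k) (nspos l).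
by rewrite rtt_relE // !commAB1 !commABP !commABQ.
Qed.

Lemma relAC p q i j k l : Upt p -> Upt q ->
  (p * p - q * q) *: (aE p i j * cE q k l - cE q k l * aE p i j)
  = (hX K * (p + q)) *: (cE p k j * aE q i l - cE q k j * aE p i l)
    - ((i == k)%:R * hX K * (p - q)) *: \sum_r (aE p r j * cE q r l + cE p r j * aE q r l).
Proof.
move=> Up Uq; rewrite Tpt_mul Tpt_mulr -evN -evD.
rewrite Tpt_mul Tpt_mulr -evN -evD.
have sE : \sum_r (aE p r j * cE q r l + cE p r j * aE q r l)
    = ev p q (fun r s => \sum_x (a x j r * c x l s + c x j r * a x l s)).
  rewrite ev_sum; apply: eq_bigr => x _.
  by rewrite evD !Tpt_mul.
rewrite sE -mulrA -[(_%:R * _) *: _]scalerA scaler_nat -mulr_natl -scalerAr -ev_nat.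
apply: ev_relation => //.
- by apply: vanishD; [exact: vanish_mul|apply: vanishN; exact: vanish_mulr].
- by apply: vanishD; [exact: vanish_mul|apply: vanishN; exact: vanish_mulr].
- apply: vanishM; apply: vanish_sum => x.
  by apply: vanishD; exact: vanish_mul.
move=> r s; have := rtt0 r s (spos i) (spos j) (nspos k) (spos l).
by rewrite rtt_relE // !commAC1 !commACP !commACQ.
Qed.

(** In [relAC] at [q = - p] with equal row indices only the contribution of Q is left, with the
    regular factor 2 p h. *)
Lemma junctionAC p j l : (0 < N)%N -> (2%:R : K) != 0 -> Upt p ->
  \sum_r (aE p r j * cE (- p) r l + cE p r j * aE (- p) r l) = 0.
Proof.
move=> N0 two0 Up; pose k := Ordinal N0.
have reg : regular (fps A) (hX K * (p + p)).
  by apply: regularM; [exact: regular_hX|apply: Upt_reg; exact: Upt_D].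
apply: reg; have := relAC k j k l Up (Upt_N Up).
rewrite mulrNN !subrr mulr0 !scale0r sub0r opprK eqxx mul1r => /esym/eqP.
by rewrite oppr_eq0 => /eqP.
Qed.

End RTTAlgebra.

Lemma rdet_morph (S E : nzRingType) (f : {rmorphism S -> E}) n (F : 'I_n -> 'I_n -> S) :
  f (rdet F) = rdet (fun i j => f (F i j)).
Proof.
rewrite rmorph_sum; apply: eq_bigr => s _.
by rewrite rmorphM rmorph_sign rmorph_prod.
Qed.

(** * Removal of the auxiliary variables *)

Section GrassmannFree.
Variables (L : comNzRingType) (S : algType L) (h : L) (n : nat).
Variables (U : L -> Prop) (a : L -> 'I_n -> 'I_n -> S).
Hypothesis Uh : forall p, U p -> U (p + h).
Hypothesis Uhm : forall p, U p -> U (p - h).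
Hypothesis UN : forall p, U p -> U (- p).
Hypothesis hreg : regular S h.
Hypothesis natreg : forall k, regular S k.+1%:R.
Hypothesis AA : forall p q i j k l, U p -> U q ->
  (p - q) *: (a p i j * a q k l - a q k l * a p i j)
  = h *: (a p k j * a q i l - a q k j * a p i l).

Section Copies.
Variable cl : clifford S (n + n).
Local Notation E := (cl_alg cl).
(** The two halves of 2n variables are used as row and column variables of t(p), or as the two sets
    in [two_copies]. *)
Let th i : E := cl_up cl (lshift n i).
Let th' i : E := cl_up cl (rshift n i).
Let dth i : E := cl_dn cl (lshift n i).
Let dth' i : E := cl_dn cl (rshift n i).
Let f : {lrmorphism S -> E} := cl_in cl.
Let aE p i j : E := f (a p i j).

Let th_th i j : th i * th j = - (th j * th i). Proof. exact: cl_up_up. Qed.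
Let th_th' i j : th i * th' j = - (th' j * th i). Proof. exact: cl_up_up. Qed.
Let th'_th' i j : th' i * th' j = - (th' j * th' i). Proof. exact: cl_up_up. Qed.
Let dth_th i j : dth i * th j = (i == j)%:R - th j * dth i.
Proof. by rewrite /dth /th cl_dn_up (inj_eq (@lshift_inj _ _)). Qed.
Let dth'_th' i j : dth' i * th' j = (i == j)%:R - th' j * dth' i.
Proof. by rewrite /dth' /th' cl_dn_up (inj_eq (@rshift_inj _ _)). Qed.
Let dth_th' i j : dth i * th' j = - (th' j * dth i).
Proof. by rewrite /dth /th' cl_dn_up eq_lrshift sub0r. Qed.
Let dth'_th i j : dth' i * th j = - (th j * dth' i).
Proof. by rewrite /dth' /th cl_dn_up eq_rlshift sub0r. Qed.

Let inert_f x : inert th th' dth dth' (f x).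
Proof. by move=> i; split; rewrite ?cl_upC ?cl_dnC. Qed.

Let hregE : regular E h. Proof. exact: cl_regular. Qed.
Let natregE k : regular E k.+1%:R. Proof. exact/cl_regular/natreg. Qed.
Let AAE p q i j k l : U p -> U q ->
  (p - q) *: (aE p i j * aE q k l - aE q k l * aE p i j)
  = h *: (aE p k j * aE q i l - aE q k j * aE p i l).
Proof. by move=> Up Uq; rewrite -!rmorphM -!rmorphB -!linearZ /= AA. Qed.

Lemma a_Arow_cl p v k l : (0 < n)%N -> U p -> U v ->
    (forall s, regular S (v - p - s%:R * h)) ->
  a v k l * Arow h a p = Arow h a p * a v k l.
Proof.
move=> n0 Up Uv reg; apply: (@cl_in_inj _ _ _ cl); rewrite !rmorphM rdet_morph.
apply: (a_Arow Uh hregE natregE AAE th_th th'_th' th_th' dth_th dth'_th' dth_th' dth'_th);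
  try by [move=> i q j m; have [] := inert_f (a q j m) i | ].
by move=> s; apply: cl_regular.
Qed.

Lemma Acol_Arow_cl p : U p -> Acol h a (p + n.-1%:R * h) = Arow h a p.
Proof.
move=> Up; apply: (@cl_in_inj _ _ _ cl); rewrite !rdet_morph.
apply: (Acol_Arow Uh hregE natregE AAE th_th th'_th' th_th' dth_th dth'_th' dth'_th);
  try by [move=> i q j m; have [] := inert_f (a q j m) i | ].
Qed.

Lemma Arow_oddrow_cl (c : L -> 'I_n -> 'I_n -> S) (g : S) (k : 'I_n) u :
    (forall p i j, a p i j * g - g * a p i j = - ((i == k)%:R * c p k j *+ 2)) ->
    (forall p j l, U p -> \sum_r (a p r j * c (- p) r l + c p r j * a (- p) r l) = 0) ->
    U u ->
  Arow h a u * Arow h a (- (u + n.-1%:R * h)) * g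
  = g * (Arow h a u * Arow h a (- (u + n.-1%:R * h))).
Proof.
move=> ag junc Uu; apply: (@cl_in_inj _ _ _ cl); rewrite !rmorphM !rdet_morph.
apply: (Arow_oddrow Uh UN hregE natregE AAE th_th th'_th' dth_th dth'_th' dth'_th
  (fun p i j => inert_f (a p i j)) (c := fun p i j => f (c p i j)) (k := k)
  (fun p i j => inert_f (c p i j)) (inert_f g)) => //.
  move=> p i j; rewrite -!rmorphM -rmorphB ag.
  by rewrite rmorphN rmorphMn rmorphM rmorph_nat.
move=> p j l Up; rewrite -[RHS](rmorph0 f) -(junc p j l Up) rmorph_sum.
by apply: eq_bigr => r _; rewrite rmorphD !rmorphM.
Qed.

Lemma Acol_oddcol_cl (b : L -> 'I_n -> 'I_n -> S) (g : S) (k l : 'I_n) u :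
    (forall p, U p -> U (p + p)) -> (forall p, U p -> regular S p) -> k != l ->
    (forall p i j, a p i j * g - g * a p i j
       = (j == k)%:R * b p i l - (j == l)%:R * b p i k) ->
    (forall p q i j k l, U p -> U q ->
      (p * p - q * q) *: (a p i j * b q k l - b q k l * a p i j)
      = (h * (p + q)) *: (a p k j * b q i l - a q k j * b p i l)
      + ((j == l)%:R * h * (p - q)) *: \sum_r (b q k r * a p i r - a q k r * b p i r)) ->
    U u ->
  Acol h a (u + n.-1%:R * h) * Acol h a (- u) * g
  = g * (Acol h a (u + n.-1%:R * h) * Acol h a (- u)).
Proof.
move=> UD Ureg kl ag AB Uu; apply: (@cl_in_inj _ _ _ cl); rewrite !rmorphM !rdet_morph.
apply: (Acol_oddcol Uh Uhm UN hregE natregE AAE th_th th'_th' dth_th dth'_th' dth'_th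
  (fun p i j => inert_f (a p i j)) (b := fun p i j => f (b p i j)) UD _ kl
  (fun p i j => inert_f (b p i j)) (inert_f g)) => //.
- by move=> p /Ureg; exact: cl_regular.
- move=> p i j; rewrite -!rmorphM -rmorphB ag.
  by rewrite rmorphB !rmorphM !rmorph_nat.
move=> p q i j k' l' Up Uq; rewrite -!rmorphM -!rmorphB -linearZ AB //.
rewrite linearD /= !linearZ /= rmorph_sum; congr (_ + _ *: _).
by apply: eq_bigr => r _; rewrite rmorphB !rmorphM.
Qed.

End Copies.

Lemma a_Arow_free p v k l : (0 < n)%N -> U p -> U v ->
    (forall s, regular S (v - p - s%:R * h)) ->
  a v k l * Arow h a p = Arow h a p * a v k l.
Proof. case: (clifford_exists S (n + n)) => cl; exact: a_Arow_cl cl _ _ _ _. Qed.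

Lemma Acol_Arow_free p : U p -> Acol h a (p + n.-1%:R * h) = Arow h a p.
Proof. case: (clifford_exists S (n + n)) => cl; exact: Acol_Arow_cl cl _. Qed.

End GrassmannFree.

(** * The centralizer of A(u) A(1-N-u) *)

(** The first n values of [c] are distinct, so their Vandermonde matrix is invertible; its inverse
    recovers each [D r]. *)
Lemma vandermonde_cancel (K : fieldType) (V : lmodType K) (c : nat -> K) n (D : nat -> V) :
    injective c -> (forall k, \sum_(r < n) c k ^+ r *: D r = 0) ->
  forall r, (r < n)%N -> D r = 0.
Proof.
move=> cI H r rn; pose M := Vandermonde n (\row_(j < n) c j).
have uM : M \in unitmx.
  rewrite unitmxE det_Vandermonde unitfE; apply/prodf_neq0 => i _.
  apply/prodf_neq0 => j ij; rewrite !mxE subr_eq0 (inj_eq cI) gtn_eqF //.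
have E (s : 'I_n) : \sum_(k < n) invmx M k (Ordinal rn) * M s k = (s == Ordinal rn)%:R.
  have := congr1 (fun X : 'M_n => X s (Ordinal rn)) (mulmxV uM); rewrite !mxE => <-.
  by apply: eq_bigr => k _; rewrite mulrC.
transitivity (\sum_(s < n) (\sum_(k < n) invmx M k (Ordinal rn) * M s k) *: D s).
  rewrite (bigD1 (Ordinal rn)) //= E eqxx scale1r big1 ?addr0 // => s sr.
  by rewrite E (negPf sr) scale0r.
under eq_bigr => s _ do rewrite scaler_suml.
rewrite exchange_big big1 // => k _.
transitivity (invmx M k (Ordinal rn) *: \sum_(r < n) c k ^+ r *: D r).
  by rewrite scaler_sumr; apply: eq_bigr => s _; rewrite scalerA !mxE.
by rewrite H scaler0.
Qed.

Lemma ord_unique n (k : 'I_n) : (forall i, i = k) -> n = 1%N.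
Proof.
move=> uk; have := card_ord n.
by rewrite (eq_card (B := pred1 k)) ?card1 // => i; rewrite !inE (uk i) eqxx.
Qed.

Lemma rdet_unique (E : nzRingType) n (k : 'I_n) (F : 'I_n -> 'I_n -> E) :
  (forall i, i = k) -> rdet F = F k k.
Proof.
move=> uk; have n1 := ord_unique uk; subst n; rewrite /rdet (bigD1 1%g) //= [X in _ + X]big1 => [|s s1].
  by rewrite odd_perm1 addr0 mul1r big_ord1 perm1 (uk ord0).
by case/eqP: s1; apply/permP => i; rewrite (uk (s i)) perm1 (uk i).
Qed.

Section Centralizer.
Variables (K : fieldType) (A : superAlgType K) (N : nat).
Variable t : sidx N -> sidx N -> int -> A.
Hypothesis ht : forall i j r, hom (bar i (+) bar j) (t i j r).
Hypothesis t0 : forall i j, t i j 0 = (i == j)%:R.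
Hypothesis t_neg : forall i j n, t i j (Negz n) = 0.
Hypothesis rtt0 : forall r s i j k l, rtt_rel t r s i j k l = 0.
Hypothesis natK : forall k, k.+1%:R != 0 :> K.
Hypothesis N_gt0 : (0 < N)%N.

Local Notation h := (hX K).
Local Notation aE p i j := (Tpt t p (spos i) (spos j)).
Local Notation bE p i j := (Tpt t p (spos i) (nspos j)).
Local Notation cE p i j := (Tpt t p (nspos i) (spos j)).

Let natreg k : regular (fps A) k.+1%:R.
Proof.
apply: regular_unit; rewrite -(rmorph_nat (@fps_const K)); exact: natK.
Qed.

Let Uh := @Upt_h K.
Let Uhm := @Upt_hm K.
Let UN := @Upt_N K.
Let hreg := @regular_hX K A.

Local Notation aT := (fun p i j => aE p i j).

Let AA p q i j k l : Upt p -> Upt q ->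
  (p - q) *: (aT p i j * aT q k l - aT q k l * aT p i j)
  = h *: (aT p k j * aT q i l - aT q k j * aT p i l).
Proof. exact: relAA. Qed.

Definition base_pt : fps K := pt 1 0.
Local Notation u := base_pt.

(** 1 - N - u is minus the last argument u + N - 1 of the first determinant. *)
Definition AA_series : fps A :=
  Arow h aT u * Arow h aT (- (u + N.-1%:R * h)).

(** For fixed [y] all coefficients are treated together; such [y] form a subalgebra, so that
    generators suffice. *)
Definition centralized (y : A) : Prop := forall m, AA_series m * y = y * AA_series m.

Lemma centralizedB x y : centralized x -> centralized y -> centralized (x - y).
Proof. by move=> hx hy m; rewrite mulrBr mulrBl hx hy. Qed.

Lemma centralizedD x y : centralized x -> centralized y -> centralized (x + y).
Proof. by move=> hx hy m; rewrite mulrDr mulrDl hx hy. Qed.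

Lemma centralizedM x y : centralized x -> centralized y -> centralized (x * y).
Proof. by move=> hx hy m; rewrite mulrA hx -[LHS]mulrA hy mulrA. Qed.

Lemma centralized2 x : centralized (x *+ 2) -> centralized x.
Proof.
move=> hx m; apply/eqP; rewrite -subr_eq0.
have /eqP : (2%:R : K) *: (AA_series m * x - x * AA_series m) = 0.
  by rewrite scaler_nat mulrnBl -mulrnAr -mulrnAl hx subrr.
by rewrite scaler_eq0 (negPf (natK 1)).
Qed.

Lemma centralized_const x :
  AA_series * fps_const x = fps_const x * AA_series -> centralized x.
Proof. by move=> H m; have := congr1 (fun f : fps A => f m) H; rewrite fps_Mconst fps_constM. Qed.

Lemma ps_sub_pt (be : K) i j m : Tpt t (pt be 0) i j m = be^-1 ^+ m *: t i j m%:Z.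
Proof.
rewrite /Tpt; have -> : pt_inv_of (pt be 0) = fps_const be^-1 * h.
  rewrite /pt_inv_of ptE0 ptE1; apply/funext => -[|k]; rewrite fps_constM ?mulr0 //.
  by rewrite /affine_inv mul0r oppr0; case: k => [|k]; rewrite ?expr0 // exprS mul0r !mulr0.
have E r k : ((fps_const be^-1 * h) ^+ r) k = (k == r)%:R * be^-1 ^+ r.
  elim: r k => [|r IH] k; first by rewrite expr0 fps1 mulr1.
  rewrite exprS -mulrA fps_constM hXM; case: k => [|k]; first by rewrite mulr0 mul0r.
  by rewrite IH eqSS exprS mulrCA.
rewrite /ps_sub (bigD1 ord_max) // big1 => [|r rm]; first by apply: etrans (addr0 _) _; rewrite E eqxx mul1r.
by move: rm; rewrite -val_eqE eq_sym E => /negPf ->; rewrite mul0r scale0r.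
Qed.

(** In order m + r the hypothesis says that the sum over s of (k+2)^-s [D s] is 0, where [D s] is
    the commutator of the coefficients of orders m + r - s and s. Varying k separates the terms, and
    s = r is the claim. *)
Lemma centralized_points i j :
    (forall k, AA_series * Tpt t (pt k.+2%:R 0) i j = Tpt t (pt k.+2%:R 0) i j * AA_series) ->
  forall r : nat, centralized (t i j r%:Z).
Proof.
move=> H r m; apply/eqP; rewrite -subr_eq0; apply/eqP.
pose D s := AA_series (m + r - s)%N * t i j s%:Z - t i j s%:Z * AA_series (m + r - s)%N.
have D0 : D r = 0.
  apply: (@vandermonde_cancel K A (fun k => k.+2%:R^-1) (m + r).+1 D) => [k k'|k|].
  - move/invr_inj => /eqP; rewrite -subr_eq0; wlog kk : k k' / (k <= k')%N.
      move=> W; case/orP: (leq_total k k') => [|kk]; first exact: W.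
      by rewrite -opprB oppr_eq0 => /(W _ _ kk) ->.
    rewrite -opprB oppr_eq0 -natrB // subSS subSS; case E : (k' - k)%N => [|d].
      by move=> _; apply/eqP; rewrite eqn_leq kk -subn_eq0 E.
    by rewrite (negPf (natK d)).
  - have /eqP := congr1 (fun f : fps A => f (m + r)%N) (H k); rewrite -subr_eq0 => /eqP.
    apply: etrans; rewrite [X in _ = _ - X]fpsM; have -> : (AA_series * Tpt t (pt k.+2%:R 0) i j) (m + r)%N
      = \sum_(s < (m + r).+1) AA_series (m + r - s)%N * Tpt t (pt k.+2%:R 0) i j s.
      rewrite fpsM (reindex_inj rev_ord_inj) /=; apply: eq_bigr => s _.
      by rewrite subSS subKn // -ltnS.
    rewrite -sumrB; apply: eq_bigr => s _.
    by rewrite ps_sub_pt /D -scalerAr -scalerAl -scalerBr.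
  - by rewrite ltnS leq_addl.
by move: D0; rewrite /D addnK.
Qed.

Lemma Upt_u : Upt u.
Proof. by exists 1; [exact: oner_neq0|exists 0]. Qed.

Lemma Upt_generic k : Upt (pt k.+2%:R 0 : fps K).
Proof. by exists k.+2%:R; [exact: natK|exists 0]. Qed.

(** The slopes 2, 3, ... avoid 1 and -1, the slopes of the arguments of the two determinants, so
    that v - p - s h is regular. *)
Lemma generic_u k : k.+2%:R - 1 != 0 :> K.
Proof. by rewrite -natr1 addrK. Qed.

Lemma generic_uN k : k.+2%:R + 1 != 0 :> K.
Proof. by rewrite natr1. Qed.

Lemma natXE k : (k%:R * h : fps K) 0%N = 0.
Proof. by rewrite mulrC hXM. Qed.

Lemma base_star : - (u + N.-1%:R * h) = pt (-1) (1 - N%:R).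
Proof.
rewrite /u /pt rmorph0 mul0r addr0 !rmorphN !rmorph1 opprD; congr (_ + _).
by rewrite rmorphB rmorph1 rmorph_nat -{2}(prednK N_gt0) -natr1 opprD addrCA subrr addr0 mulNr.
Qed.

Lemma Upt_star : Upt (- (u + N.-1%:R * h)).
Proof. by rewrite base_star; exists (-1); [rewrite oppr_eq0 oner_neq0|exists (1 - N%:R)]. Qed.

Lemma regular_generic m p s : Upt p -> m.+2%:R - p 0%N != 0 ->
  regular (fps A) (pt m.+2%:R 0 - p - s%:R * h).
Proof.
move=> Up mp; apply: regular_unit.
by rewrite !fpsD !fpsN natXE ptE0 subr0.
Qed.

Lemma centralized_a k l (r : nat) : centralized (t (spos k) (spos l) r%:Z).
Proof.
apply: centralized_points => m; rewrite /AA_series.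
have comm p : Upt p -> m.+2%:R - p 0%N != 0 ->
    aE (pt m.+2%:R 0) k l * Arow h aT p = Arow h aT p * aE (pt m.+2%:R 0) k l.
  move=> Up mp; apply: (a_Arow_free (a := aT) Uh hreg natreg AA) => //.
  - exact: Upt_generic.
  - by move=> s; exact: regular_generic.
have c1 : aE (pt m.+2%:R 0) k l * Arow h aT u = Arow h aT u * aE (pt m.+2%:R 0) k l.
  by apply: comm; [exact: Upt_u|rewrite /base_pt ptE0 generic_u].
rewrite mulrA c1 -2!mulrA comm //; first exact: Upt_star.
by rewrite base_star ptE0 opprK generic_uN.
Qed.

Definition Tser i j : fps A := fun r => t i j r%:Z.

Lemma Tpt_const p i j x : Tpt t p i j * fps_const x - fps_const x * Tpt t p i j
  = ps_sub (pt_inv_of p) (fun r : nat => t i j r%:Z * x - x * t i j r%:Z).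
Proof.
apply/funext => m; rewrite fpsD fpsN fps_Mconst fps_constM mulr_suml mulr_sumr -sumrB.
by apply: eq_bigr => r _; rewrite -scalerAl -scalerAr -scalerBr.
Qed.

Lemma ps_sub_nat z (f : fps A) (n : nat) : ps_sub z (n%:R * f) = n%:R * (ps_sub z f : fps A) :> fps A.
Proof.
rewrite -!(rmorph_nat (@fps_const A)); apply/funext => m; rewrite fps_constM mulr_sumr.
by apply: eq_bigr => r _; rewrite fps_constM scalerAr.
Qed.

Lemma centralized_c1 k : centralized (t (nspos k) (spos k) 1).
Proof.
apply: centralized_const; rewrite /AA_series; have [cl] := clifford_exists (fps A) (N + N).
apply: (Arow_oddrow_cl (a := aT) Uh UN hreg natreg AA cl (c := fun p i j => cE p i j) (k := k)).
- move=> p i j; rewrite Tpt_const -mulrnAr -[cE p k j *+ 2]mulr_natl.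
  rewrite [X in ps_sub _ X](_ : _ = - ((i == k)%:R * (2%:R * Tser (nspos k) (spos j))) :> fps A).
    by rewrite ps_subN !ps_sub_nat.
  apply/funext => r; rewrite commAC_first // fpsN -!(rmorph_nat (@fps_const A)) !fps_constM.
  by rewrite [2%:R * _]mulr_natl mulrnAr.
- by move=> p j l Up; apply: (junctionAC ht t_neg rtt0) => //; exact: natK.
- exact: Upt_u.
Qed.

Lemma centralized_b1 k l : k != l -> centralized (t (spos k) (nspos l) 1).
Proof.
move=> kl; apply: centralized_const; rewrite /AA_series.
(* The column expansions start at u + N - 1 and at - u, so that u and - u become adjacent. *)
rewrite -(Acol_Arow_free (a := aT) Uh Uhm hreg natreg AA Upt_u).
rewrite -(Acol_Arow_free (a := aT) Uh Uhm hreg natreg AA Upt_star) opprD subrK.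
have [cl] := clifford_exists (fps A) (N + N).
apply: (Acol_oddcol_cl (a := aT) Uh Uhm UN hreg natreg AA cl (b := fun p i j => bE p i j) _ _ kl).
- by move=> p; apply: Upt_D; exact: natK.
- by move=> p; exact: Upt_reg.
- move=> p i j; rewrite Tpt_const.
  rewrite [X in ps_sub _ X](_ : _ = (j == k)%:R * Tser (spos i) (nspos l)
    - (j == l)%:R * Tser (spos i) (nspos k) :> fps A).
    by rewrite ps_subD ps_subN !ps_sub_nat.
  apply/funext => r; rewrite commAB_first // fpsD fpsN -!(rmorph_nat (@fps_const A)) !fps_constM.
  by rewrite eq_sym.
- by move=> p q i j k' l' Up Uq; exact: relAB.
- exact: Upt_u.
Qed.

Lemma centralized_c k j (r : nat) : centralized (t (nspos k) (spos j) r%:Z).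
Proof.
apply: centralized2.
have E : t (nspos k) (spos j) r%:Z *+ 2 = t (nspos k) (spos k) 1 * t (spos k) (spos j) r%:Z
    - t (spos k) (spos j) r%:Z * t (nspos k) (spos k) 1.
  by rewrite -opprB commAC_first // eqxx mul1r opprK.
rewrite E; apply: centralizedB; apply: centralizedM;
  by [exact: centralized_c1|exact: centralized_a].
Qed.

(** For N = 1 the commutators in [commAB_first] are 0 and yield no coefficients of b, so b(v) is
    taken at v = 2u, 3u, ... and treated by [rank_one_odd]. *)
Lemma centralized_b_unique k (r : nat) : (forall i : 'I_N, i = k) ->
  centralized (t (spos k) (nspos k) r%:Z).
Proof.
move=> uk; have N1 := ord_unique uk.
apply: centralized_points => m; rewrite /AA_series /Arow !(rdet_unique _ uk).
have -> : N.-1 = 0%N by rewrite N1.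
have -> : k = 0%N :> nat by have := ltn_ord k; rewrite [X in (_ < X)%N]N1; case: (k : nat).
rewrite mul0r !addr0; set v := pt m.+2%:R 0.
have Uu := Upt_u; have Uv : Upt v by exact: Upt_generic.
have UNu := UN Uu.
(* With a single row, [AA] says that p - q - h annihilates the commutator. *)
have alC1 p q : Upt p -> Upt q -> p 0%N != q 0%N -> aE p k k * aE q k k = aE q k k * aE p k k.
  move=> Up Uq pq; have reg : regular (fps A) (p - q - h).
    by apply: regular_unit; rewrite !fpsD !fpsN subr0 subr_eq0.
  apply: (regular_eq reg); apply/eqP; rewrite -subr_eq0; apply/eqP.
  transitivity ((p - q) *: (aE p k k * aE q k k - aE q k k * aE p k k)
    - h *: (aE p k k * aE q k k - aE q k k * aE p k k)).
    by lin_ring (fps K) (fps A).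
  by rewrite (AA k k k k Up Uq) subrr.
have u0 : u 0%N = 1 by rewrite /base_pt ptE0.
have v0 : v 0%N = m.+2%:R by rewrite /v ptE0.
have ne1 : 1 != m.+2%:R :> K by rewrite eq_sym -subr_eq0 generic_u.
have ne2 : - 1 != m.+2%:R :> K by rewrite eq_sym -subr_eq0 opprK generic_uN.
have ne3 : 1 != - 1 :> K by rewrite -subr_eq0 opprK; exact: (natK 1).
apply: (rank_one_odd (h := h) (al := fun p => aE p k k) (be := fun p => bE p k k)).
- move=> p q [->|->] [->|->] //; apply: alC1; rewrite ?fpsN ?u0 ?v0 //.
- move=> p q hp hq; have Up : Upt p by case: hp => ->.
  have Uq : Upt q by case: hq => ->.
  rewrite (relAB ht t_neg rtt0 k k k k Up Uq) eqxx mul1r; congr (_ + _ *: _).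
  apply: etrans (sum_only (i0 := k) _) _ => // i; rewrite (uk i) eqxx //.
- apply: regularM; first exact: hreg.
  by apply: Upt_reg; apply: Upt_D => //; exact: natK.
- apply: regularM; apply: regular_unit; rewrite !fpsD ?fpsN u0 v0; first by rewrite subr0 subr_eq0.
  by rewrite addrC generic_uN.
Qed.

Lemma centralized_b k j (r : nat) : centralized (t (spos k) (nspos j) r%:Z).
Proof.
case: (altP (@forallP _ (fun i : 'I_N => i == k))) => [uk|].
  have uk' i : i = k by apply/eqP.
  by rewrite (uk' j); apply: centralized_b_unique.
rewrite negb_forall => /existsP[l0 l0k].
(* Then b_lj^(1) is off-diagonal, and its commutator with a_kl^(r) is b_kj^(r) alone. *)
have [l lj] : exists l, l != j.
  by case: (altP (k =P j)) l0k => [->|kj _]; [exists l0|exists k].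
have E : t (spos k) (nspos j) r%:Z = t (spos k) (spos l) r%:Z * t (spos l) (nspos j) 1
    - t (spos l) (nspos j) 1 * t (spos k) (spos l) r%:Z.
  by rewrite commAB_first // eqxx mul1r (negPf lj) mul0r subr0.
rewrite E; apply: centralizedB; apply: centralizedM;
  by [exact: centralized_b1|exact: centralized_a].
Qed.

Lemma centralized_d k j (r : nat) : centralized (t (nspos k) (nspos j) r%:Z).
Proof.
(* The relation is solved for twice the coefficient of d. *)
apply: centralized2; have := commBC_first ht t0 t_neg rtt0 r%:Z j k.
set X := _ + _ => /eqP; rewrite eq_sym subr_eq addrC -subr_eq => /eqP <-.
apply: centralizedB.
  rewrite -mulrnAl; apply: centralizedM; last exact: centralized_a.
  by move=> m; rewrite -mulrnA; exact: commr_nat.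
apply: centralizedD; apply: centralizedM; by [exact: centralized_c1|exact: centralized_b].
Qed.

Lemma centralized_t i j r : centralized (t i j r).
Proof.
case: r => r; last by rewrite t_neg => m; rewrite mulr0 mul0r.
case: i j => [[] i] [[] j]; [exact: centralized_d|exact: centralized_c
  |exact: centralized_b|exact: centralized_a].
Qed.

End Centralizer.

(** * Transport of the relations from the free superalgebra *)

Section SuperMorphism.
Variables (K : fieldType) (A B : superAlgType K) (N : nat) (f : {lrmorphism A -> B}).
Hypothesis f_part : forall d x, f (part d x) = part d (f x).

Definition tens2_map (X : tens2 A N) : tens2 B N := fun i j k l => f (X i j k l).

Lemma tens2_map_mul X Y : tens2_map (tens2_mul X Y) = tens2_mul (tens2_map X) (tens2_map Y).
Proof.
apply: tens2_funext => i j k l; rewrite /tens2_map /tens2_mul rmorph_sum.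
apply: eq_bigr => a _; rewrite rmorph_sum; apply: eq_bigr => b _.
rewrite rmorph_sum; apply: eq_bigr => d _.
by rewrite /= linearZ /= rmorphM /= f_part.
Qed.

Lemma tens2_map_R a b : tens2_map (@Rcoef K A N a b) = @Rcoef K B N a b.
Proof.
apply: tens2_funext => i j k l; rewrite /tens2_map /Rcoef /tens2_1 /tens2_P /tens2_Q.
by case: a b => [|[|[|a]]] [|[|[|b]]];
  rewrite ?(rmorphD, rmorphN, rmorphM, rmorph_nat, rmorph_sign, rmorph0).
Qed.

Lemma rtt_rel_map (t : sidx N -> sidx N -> int -> A) r s i j k l :
  f (rtt_rel t r s i j k l) = rtt_rel (fun i j r => f (t i j r)) r s i j k l.
Proof.
have T1 r' : tens2_map (T1coef t r') = T1coef (fun i j r => f (t i j r)) r'.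
  by apply: tens2_funext => *; rewrite /tens2_map rmorphM rmorph_nat.
have T2 r' : tens2_map (T2coef t r') = T2coef (fun i j r => f (t i j r)) r'.
  by apply: tens2_funext => *; rewrite /tens2_map rmorphM rmorph_nat.
rewrite /rtt_rel rmorph_sum; apply: eq_bigr => a _; rewrite rmorph_sum.
apply: eq_bigr => b _; rewrite rmorphB -!T1 -!T2 -!tens2_map_R -!tens2_map_mul.
by [].
Qed.

End SuperMorphism.

Lemma free_alg_ind (K : fieldType) (N : nat) (P : free_alg K N -> Prop) :
    P 1 -> (forall x y, P x -> P y -> P (x + y)) -> (forall (c : K) x, P x -> P (c *: x)) ->
    (forall x y, P x -> P y -> P (x * y)) ->
    (forall i j (r : nat), P (free_T K i j r%:Z)) ->
  forall x, P x.
Proof.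
move=> P1 PD PZ PM PT x.
have P0 : P 0 by rewrite -(scale0r 1); apply: PZ.
have Pw (w : {fmonom letter N}) : P (mkmalgU w 1).
  case: w => w; elim: w => [|[[i j] r] w IH]; first by rewrite -fmoneE; exact: P1.
  rewrite (_ : mkmalgU _ 1 = free_T K i j r.+1%:Z * (mkmalgU (FMonom w) 1 : free_alg K N)).
    exact: PM.
  apply/esym; apply: etrans (fgmulUU _ _ _ _) _; rewrite mulr1.
  by congr mkmalgU; apply/eqP; rewrite fmP fmM fmU.
rewrite (monalgE (x : {malg K[{fmonom letter N}]})).
elim/big_ind: _ => // w _.
rewrite -[mcoeff _ _]mulr1 -malg_scaleU; exact: PZ.
Qed.

(** No sign arises from an even [x], so the homogeneous parts of [y] can be added up again. *)
Lemma supercomm_even (K : fieldType) (A : superAlgType K) (x y : A) : hom false x ->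
  supercomm x y = x * y - y * x.
Proof.
move=> hx; rewrite /supercomm big_bool !(part_hom _ hx) /=.
rewrite [X in X + _]big1 ?add0r => [|e _]; last by rewrite mulr0 mul0r scaler0 subrr.
rewrite sumrB -mulr_sumr part_sum; congr (_ - _).
by rewrite -[y in RHS](part_sum y) mulr_suml; apply: eq_bigr => e _; rewrite expr0 scale1r.
Qed.

Section EvenSeries.
Variables (K : fieldType) (A : superAlgType K).

Definition even_fps (f : fps A) : Prop := forall m, hom false (f m).

Lemma even_fpsD f g : even_fps f -> even_fps g -> even_fps (f + g).
Proof. by move=> hf hg m; apply: homD. Qed.

Lemma even_fpsM f g : even_fps f -> even_fps g -> even_fps (f * g).
Proof. by move=> hf hg m; apply: hom_sum => r _; exact: (homM (hf r) (hg _)). Qed.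

Lemma even_fps_const x : hom false x -> even_fps (fps_const x).
Proof. by move=> hx [|m] //; exact: hom0. Qed.

Lemma even_rdet n (F : 'I_n -> 'I_n -> fps A) :
  (forall i j, even_fps (F i j)) -> even_fps (rdet F).
Proof.
move=> hF; have h0 : even_fps 0 by move=> m; exact: hom0.
apply: big_ind => //; first exact: even_fpsD.
move=> s _; apply: even_fpsM.
  rewrite -(rmorph_sign (@fps_const A)); apply: even_fps_const; exact: hom_sign.
apply: big_ind => //; last exact: even_fpsM.
by rewrite -(rmorph1 (@fps_const A)); apply: even_fps_const; exact: hom1.
Qed.

Lemma even_ps_sub z (f : fps A) : even_fps f -> even_fps (ps_sub z f).
Proof. by move=> hf m; apply: hom_sum => r _; exact: homZ. Qed.

End EvenSeries.

(** * Composition of substitutions at affine points *)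

Section Substitution.
Variable K : fieldType.
Local Notation h := (hX K).

Lemma fps_cancel (q z z' : fps K) : q 0%N != 0 -> q * z = q * z' -> z = z'.
Proof.
move=> q0 /eqP; rewrite -subr_eq0 -mulrBr => /eqP H.
apply/eqP; rewrite -subr_eq0; apply/eqP.
apply: (@regular_unit K K^o q q0 (z - z')); rewrite -[RHS]H.
by apply/funext => m; rewrite fps_scaleE fpsM.
Qed.

Lemma hX_exp r m : (h ^+ r) m = (m == r)%:R.
Proof. by elim: r m => [|r IH] [|m]; rewrite ?fps1 // exprS hXM. Qed.

Lemma ps_subhX (V : lmodType K) (f : nat -> V) : ps_sub h f = f.
Proof.
apply/funext => m; rewrite /ps_sub (bigD1 ord_max) // big1 => [|r rm].
  by apply: etrans (addr0 _) _; rewrite hX_exp eqxx scale1r.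
by move: rm; rewrite hX_exp -val_eqE eq_sym => /negPf ->; rewrite scale0r.
Qed.

Definition fps_comp (w z : fps K) : fps K := ps_sub w (z : nat -> K^o).

Lemma fps_compM w z z' : w 0%N = 0 -> fps_comp w (z * z') = fps_comp w z * fps_comp w z'.
Proof. exact: (@ps_subM K K^o). Qed.

Lemma fps_compD w z z' : fps_comp w (z + z') = fps_comp w z + fps_comp w z'.
Proof. exact: (@ps_subD K K^o). Qed.

Lemma fps_comp_const w c : fps_comp w (fps_const c) = fps_const c.
Proof. exact: (@ps_sub_const K K^o). Qed.

Lemma fps_compX (w : fps K) : w 0%N = 0 -> fps_comp w h = w.
Proof.
move=> w0; apply/funext => -[|m]; first by rewrite /fps_comp /ps_sub big_ord1 scaler0 w0.
rewrite /fps_comp /ps_sub (bigD1 (Ordinal (isT : (1 < m.+2)%N))) //= big1 => [|r r1].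
  by rewrite addr0 expr1 /GRing.scale /= mulr1.
rewrite /hX (_ : (r == 1 :> nat)%N = false) ?scaler0 //.
by apply/negP => /eqP r1'; case/eqP: r1; apply/val_inj.
Qed.

(* Substituting h / q0 for h in h / (1 + k h) gives h / (q0 + k h). *)
Lemma fps_comp_pt_inv (q0 : fps K) (k : K) : Upt q0 -> Upt (q0 + fps_const k * h) ->
  fps_comp (pt_inv_of q0) (pt_inv_of (pt 1 k)) = pt_inv_of (q0 + fps_const k * h).
Proof.
move=> Uq Uqk; set w := pt_inv_of q0; set z := pt_inv_of _.
have U1 : Upt (pt 1 k) by exists 1; [exact: oner_neq0|exists k].
have E : (1 + fps_const k * w) * fps_comp w z = w.
  rewrite -[RHS]fps_compX // -(pt_invE U1) fps_compM // /pt fps_compD fps_compM // fps_compX //.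
  by rewrite !fps_comp_const rmorph1.
have q00 : (q0 + fps_const k * h) 0%N != 0.
  by case: Uqk => al al0 [ka ->]; rewrite ptE0.
apply: (fps_cancel q00); rewrite pt_invE // -{1}(pt_invE Uq) -/w.
rewrite -[RHS](pt_invE Uq) -/w -[in RHS]E; ring.
Qed.

End Substitution.

(** * Centrality in the extended Yangian *)

Section ExtendedYangian.
Variables (K : fieldType) (N : nat).
Hypothesis natK : forall k, k.+1%:R != 0 :> K.
Hypothesis N_gt0 : (0 < N)%N.
Local Notation X := (extYangian K N).
Local Notation h := (hX K).

Definition yT (i j : sidx N) (r : int) : X := toX (@rtt_ideal K N) (free_T K i j r).

Lemma part_toX d (f : free_alg K N) :
  toX (@rtt_ideal K N) (part d f) = part d (toX (@rtt_ideal K N) f : X).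
Proof. exact/esym/partXE. Qed.

Lemma yT_hom i j r : hom (bar i (+) bar j) (yT i j r).
Proof. by rewrite /hom -part_toX hom_free_T. Qed.

Lemma yT0 i j : yT i j 0 = (i == j)%:R.
Proof. exact: rmorph_nat. Qed.

Lemma yT_neg i j n : yT i j (Negz n) = 0.
Proof. exact: raddf0. Qed.

Lemma yT_rtt r s i j k l : rtt_rel yT r s i j k l = 0.
Proof.
rewrite -(toX_rtt_rel K r s i j k l).
exact/esym/(rtt_rel_map (f := toX (@rtt_ideal K N)) part_toX).
Qed.

Local Notation aT := (fun p i j => Tpt yT p (spos i) (spos j)).

(** Substitution respects sums and products, and composing it with the shift u + k gives the point
    q0 + k h by [fps_comp_pt_inv], provided that this point is admissible. *)
Lemma Aseries_pt (q0 : fps K) : (forall k : nat, Upt (q0 + k%:R * h)) ->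
  ps_sub (pt_inv_of q0) (Aseries K N) = Arow h aT q0.
Proof.
move=> Uq; have Uq0 : Upt q0 by have := Uq 0%N; rewrite mul0r addr0.
have -> : Aseries K N = \sum_(s : 'S_N) fps_const ((-1) ^+ s)
    * \prod_(k < N) (ps_sub (pt_inv_of (pt 1 k%:R)) (fun r => yT (spos k) (spos (s k)) r%:Z) : fps X) :> fps X.
  apply/funext => m; rewrite fps_sum; apply: eq_bigr => s _; rewrite fps_constM.
  have -> (x : X) : (-1) ^+ s *: x = (-1) ^+ s * x.
    by rewrite -signr_odd -[in RHS]signr_odd; case: (odd _); rewrite ?scale1r ?mul1r // scaleN1r mulN1r.
  congr (_ * _); apply: (congr1 (fun f : fps X => f m)); apply: eq_bigr => k _.
  apply/funext => r; rewrite ps_affineE /pt_inv_of ptE0 ptE1.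
  by [].
rewrite ps_sub_sum; apply: eq_bigr => s _; rewrite ps_subM // ps_sub_const rmorph_sign.
apply: (congr1 ( *%R ((-1) ^+ s : fps X))); rewrite ps_sub_prod //; apply: eq_bigr => k _.
rewrite ps_sub_comp //; congr ps_sub.
rewrite -(rmorph_nat (@fps_const K)); apply: fps_comp_pt_inv => //.
by rewrite rmorph_nat.
Qed.

Lemma yangian_ind (P : X -> Prop) :
    P 1 -> (forall x y, P x -> P y -> P (x + y)) -> (forall (c : K) x, P x -> P (c *: x)) ->
    (forall x y, P x -> P y -> P (x * y)) -> (forall i j r, P (yT i j r)) ->
  forall x, P x.
Proof.
move=> P1 PD PZ PM PT; elim/toX_ind => f.
apply: (free_alg_ind (P := fun f => P (toX (@rtt_ideal K N) f))) => [|x y|c x|x y|i j r].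
- by rewrite rmorph1.
- by rewrite raddfD; exact: PD.
- by rewrite linearZ; exact: PZ.
- by rewrite rmorphM; exact: PM.
- exact: PT.
Qed.

Lemma supercentral_AA_series m : supercentral (AA_series yT m).
Proof.
have ev p : even_fps (Arow h aT p).
  by apply: even_rdet => i j; apply: even_ps_sub => r; exact: (yT_hom (spos i) (spos j) r%:Z).
move=> y; rewrite supercomm_even; last exact: even_fpsM.
(* The quantifier over [m] is restored first: the induction on [y] concerns all coefficients
   together. *)
apply/eqP; rewrite subr_eq0; apply/eqP; move: m; change (centralized yT y).
elim/yangian_ind: y => [m|x y|c x hx m|x y|i j r].
- by rewrite mulr1 mul1r.
- exact: centralizedD.
- by rewrite -scalerAl -scalerAr hx.
- exact: centralizedM.
- exact: (centralized_t yT_hom yT0 yT_neg yT_rtt natK N_gt0).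
Qed.

Lemma Aseries_AA_series :
  ps_mul (Aseries K N) (ps_affine (-1) (1 - N%:R) (Aseries K N)) = AA_series yT.
Proof.
(* The point [pt 1 0] stands for u itself, whose inverse is h. *)
have id1 : ps_sub (pt_inv_of (pt 1 0)) (Aseries K N) = Aseries K N.
  rewrite (_ : pt_inv_of _ = h) ?ps_subhX //; apply/funext => -[|k] //.
  by rewrite /pt_inv_of ptE0 ptE1 /affine_inv mul0r oppr0 invr1 mul1r expr0n.
have U1 k : Upt (pt 1 0 + k%:R * h).
  by rewrite -(rmorph_nat (@fps_const K)) /pt rmorph0 mul0r addr0; exists 1; [exact: oner_neq0|exists k%:R].
rewrite /AA_series -(Aseries_pt U1) id1; congr (_ * _ : fps X).
rewrite base_star // -Aseries_pt => [|k].
  by apply/funext => m; rewrite ps_affineE /pt_inv_of ptE0 ptE1.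
exists (-1); first by rewrite oppr_eq0 oner_neq0.
exists (1 - N%:R + k%:R); rewrite /pt [in RHS]rmorphD mulrDl addrA.
by rewrite (rmorph_nat (@fps_const K) k).
Qed.

End ExtendedYangian.

Theorem theorem3 (R : realType) (N : nat) (hN : (0 < N)%N) (m : nat) :
  supercentral
    (ps_mul (Aseries R[i] N)
       (ps_affine (-1) (1 - N%:R) (Aseries R[i] N)) m).
Proof.
have natC k : k.+1%:R != 0 :> R[i] by rewrite Num.Theory.pnatr_eq0.
by rewrite Aseries_AA_series //; exact: supercentral_AA_series.
Qed.
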